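(* Let $r$ be a rational function which maps $\mathbb{C}^+$ into itself. Then the following are equivalent: (1) the composition operator $C_r$ is an isometry on $H^p(\mathbb{C}^+)$ for some (or equivalently every) $p$ with $1\le p<\infty$; (2) the composition operator $C_r$ is similar to an isometry on $H^p(\mathbb{C}^+)$ for some (or equivalently every) $p$ with $1\le p<\infty$; (3) $r$ is inner and $\lim_{|z|\to\infty} r(z)/z = 1$. (Thus ''for some $p$'' and ''for every $p$'' give equivalent versions of (1), and likewise of (2), and all of these are equivalent to (3).)
   Context: $\mathbb{C}^+=\{z\in\mathbb{C}:\operatorname{Im} z>0\}$ is the open upper half-plane. For $1\le p<\infty$, the Hardy space $H^p(\mathbb{C}^+)$ is the space of analytic functions $f$ on $\mathbb{C}^+$ for which $\|f\|^p=\sup_{y>0}\int_{\mathbb{R}}|f(x+iy)|^p\,dx$ is finite, with norm $\|f\|$. For an analytic map $r:\mathbb{C}^+\to\mathbb{C}^+$, the composition operator with symbol $r$ is $C_r f=f\circ r$. Saying that $C_r$ is an isometry (or similar to an isometry) on $H^p(\mathbb{C}^+)$ includes the assertion that $C_r$ maps $H^p(\mathbb{C}^+)$ boundedly into itself. An isometry is a norm-preserving linear operator, not assumed surjective. A bounded operator $T$ on a Banach space $X$ is similar to an isometry if there are a bounded invertible operator $S$ on $X$ (with bounded inverse) and an isometry $U$ on $X$ such that $T=S^{-1}US$. A self-map $r$ of $\mathbb{C}^+$ is inner if its boundary values map the boundary of the half-plane to itself almost everywhere; for rational $r$ this means $r(x)\in\mathbb{R}$ for almost every $x\in\mathbb{R}$.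 *)

(* Defs.v *)
From HB Require Import structures.
From mathcomp Require Import all_boot all_order all_algebra.
From mathcomp Require Import complex.
From mathcomp Require Import all_classical all_reals all_analysis.

Set Implicit Arguments.
Unset Strict Implicit.
Unset Printing Implicit Defensive.

Import Order.TTheory GRing.Theory Num.Theory.
Import numFieldNormedType.Exports.

Local Open Scope classical_set_scope.
Local Open Scope ring_scope.
Local Open Scope complex_scope.

(* The complex numbers over [R], seen as a normed space over themselves. *)
Notation Cplx R := ((complex R)^o).

Definition upper_half_plane (R : realType) : set (Cplx R) :=
  [set z : Cplx R | 0 < complex.Im z].

(* A space is given by a carrier [X] inside an ambient module [V] and a norm [N]
   that is only meaningful on [X]; operators are total functions on [V] of which
   only the action on [X] matters. *)
Section Operators.
Context {K : nzRingType} {R : realType} {V : lmodType K}.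
Implicit Types (X : set V) (N : V -> R) (T S U : V -> V).

Definition linear_operator_on X T : Prop :=
  (forall f, X f -> X (T f)) /\
  (forall (a : K) f g, X f -> X g -> T (a *: f + g) = a *: T f + T g).

Definition bounded_operator_on X N T : Prop :=
  linear_operator_on X T /\ exists M : R, forall f, X f -> N (T f) <= M * N f.

Definition isometry_on X N T : Prop :=
  linear_operator_on X T /\ forall f, X f -> N (T f) = N f.

Definition similar_to_isometry_on X N T : Prop :=
  bounded_operator_on X N T /\
  exists S S' U,
    [/\ bounded_operator_on X N S,
        bounded_operator_on X N S',
        (forall f, X f -> S' (S f) = f /\ S (S' f) = f),
        isometry_on X N U &
        forall f, X f -> T f = S' (U (S f))].

End Operators.

Section HardySpace.
Variable R : realType.
Implicit Types (p : R) (f r : Cplx R -> Cplx R).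

Local Open Scope ereal_scope.

(* The p-th power of the Hardy norm. *)
Definition hardy_sup p f : \bar R :=
  ereal_sup [set \int[lebesgue_measure]_x ((Normc.normc (f (x +i* y)) `^ p)%:E)
            | y in [set y : R | (0 < y)%R]].

(* A function on the upper half-plane is encoded by its extension by zero to the
   whole plane, so that equality in H^p is equality of functions. *)
Definition hardy_space p : set (Cplx R -> Cplx R) :=
  [set f | [/\ forall z, upper_half_plane z -> derivable f z 1%R,
               forall z, ~ upper_half_plane z -> f z = 0%R &
               hardy_sup p f < +oo]].

Definition hardy_norm p f : R := (fine (hardy_sup p f) `^ p^-1)%R.

Local Close Scope ereal_scope.

Definition composition_operator r f : Cplx R -> Cplx R :=
  fun z => if 0 < complex.Im z then f (r z) else 0.

(* In lowest terms; by the convention x / 0 = 0, the value at a pole is 0. *)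
Definition rational_function r : Prop :=
  exists P Q : {poly complex R},
    [/\ Q != 0, coprimep P Q & forall z, r z = P.[z] / Q.[z]].

(* The finitely many real poles of a rational function are a null set. *)
Definition rational_inner r : Prop :=
  {ae lebesgue_measure, forall x : R, complex.Im (r x%:C) = 0}.

(* The filter of neighbourhoods of infinity in the plane. *)
Definition at_infinity : set_system (Cplx R) :=
  filter_from [set: R] (fun M => [set z : Cplx R | M < Normc.normc z]).

End HardySpace.

#[global] Instance at_infinity_proper (R : realType) :
  ProperFilter (@at_infinity R).
Proof.
apply: filter_from_proper.
  apply: filter_from_filter; first by exists 0.
  move=> a b _ _; exists (Num.max a b) => // z /=.
  by rewrite gt_max => /andP.
move=> M _; exists ((`|M| + 1) +i* 0) => /=.
rewrite expr0n addr0 sqrtr_sqr ger0_norm ?addr_ge0//.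
by rewrite (le_lt_trans (ler_norm M))// ltrDl.
Qed.

(* Main.v *)
(* Write r = P / Q.  If r is real on the real line and r(z)/z -> 1, residues give
   that the kernel Im w / (pi |r(x) - w|^2) is a probability density in x, and
   Cauchy's theorem together with the convexity of s^p shows that |f(w)|^p is at
   most the average of |f(r(x + i0))|^p against it.  Integrating over the line
   Im w = y bounds the norm of f by that of f o r.  Conversely, for any self-map with
   r(z) ~ c z, the integral in x of Im r(x + iy) / (pi |r(x + iy) - t|^2) is 1/c, so
   averaging the Poisson formula for f yields ||f o r||^p <= ||f||^p / c.

   An operator similar to an isometry has its powers uniformly bounded above and
   below.  Testing this on f(z) = (z - s + i l)^-2 forces the rest: if r is
   bounded at infinity then f o r is not in H^p; r cannot grow faster than
   linearly because it preserves the half-plane; c > 1 contradicts the bound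
   above; if c < 1 the iterates stay close to c^n z on intervals of length about
   c^-n, so the norms of f o r^n blow up; and if r is not real on the real line,
   then r omits a neighbourhood of some real t, so that f o r stays bounded for
   s = t and l -> 0 while the norm of f does not. *)
Require Import Defs.
From mathcomp Require Import all_boot all_order all_algebra.
From mathcomp Require Import complex ring lra.
From mathcomp Require Import all_classical all_reals all_analysis measurable_realfun.
Import Order.TTheory GRing.Theory Num.Theory.
Import numFieldNormedType.Exports.
Local Open Scope classical_set_scope.
Local Open Scope ring_scope.
Local Open Scope complex_scope.
Set Implicit Arguments.
Unset Strict Implicit.
Unset Printing Implicit Defensive.
Import Normc.

(** * Complex differentiability *)

(** No boundary values of [f] are ever constructed: averages are taken on lines of height [d], with
    an error of order [d], and Fatou's lemma passes to the limit. Nor is any pointwise growth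
    estimate for [H^p] functions used; only the integrals of [|f o r|^p] over horizontal lines are
    controlled, through [|f| <= 1 + |f|^p]. Hence Cauchy's theorem is proved for integrands bounded
    far out by a multiple of [(1 + g z) / |z|^2], where [g] has bounded integrals on horizontal
    lines, and the vertical sides of the contours are found by averaging. The difference quotient of
    [f] at [w], composed with [r], may fail to be differentiable where [r z = w]; Goursat's argument
    is arranged so that continuity at these finitely many points suffices, and removable
    singularities never have to be discussed. *)

Section ComplexModulus.
Variable R : realType.
Implicit Types z w : Cplx R.

Lemma normrc z : `|z| = (normc z)%:C.
Proof. by rewrite normc_def; case: z. Qed.

Lemma normc_ge0 z : 0 <= normc z.
Proof. by case: z => a b /=; rewrite sqrtr_ge0. Qed.

Lemma normc_sqr z : normc z ^+ 2 = complex.Re z ^+ 2 + complex.Im z ^+ 2.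
Proof. by case: z => a b /=; rewrite sqr_sqrtr// addr_ge0// sqr_ge0. Qed.

Lemma normc_triangle z w : normc (z + w) <= normc z + normc w.
Proof. by move: (ler_normD z w); rewrite !normrc -rmorphD lecR. Qed.

Lemma normcN z : normc (- z) = normc z.
Proof. by case: z => a b /=; rewrite !sqrrN. Qed.

Lemma normcB z w : normc (z - w) = normc (w - z).
Proof. by rewrite -normcN opprB. Qed.

Lemma normc_eq0 z : (normc z == 0) = (z == 0).
Proof. by apply/eqP/eqP => [/eq0_normc//|->]; rewrite normc0. Qed.

Lemma normc_gt0 z : (0 < normc z) = (z != 0).
Proof. by rewrite lt_def normc_eq0 normc_ge0 andbT. Qed.

Lemma normcX z n : normc (z ^+ n) = normc z ^+ n.
Proof. by elim: n => [|n IH]; rewrite ?expr0 ?normc1// !exprS normcM IH. Qed.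

Lemma Re_le_normc z : `|complex.Re z| <= normc z.
Proof.
rewrite -ler_sqr ?nnegrE ?normc_ge0// normc_sqr real_normK ?num_real//.
by rewrite lerDl sqr_ge0.
Qed.

Lemma Im_le_normc z : `|complex.Im z| <= normc z.
Proof.
rewrite -ler_sqr ?nnegrE ?normc_ge0// normc_sqr real_normK ?num_real//.
by rewrite lerDr sqr_ge0.
Qed.

Lemma normc_le_ReIm z : normc z <= `|complex.Re z| + `|complex.Im z|.
Proof.
rewrite -ler_sqr ?nnegrE ?normc_ge0 ?addr_ge0// normc_sqr.
rewrite sqrrD !real_normK ?num_real//.
by rewrite addrAC lerDl mulrn_wge0// mulr_ge0.
Qed.

Lemma normc_real (x : R) : normc x%:C = `|x|.
Proof. by rewrite /= expr0n addr0 sqrtr_sqr. Qed.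

Lemma normc_conj z : normc z^* = normc z.
Proof. by case: z => a b /=; rewrite sqrrN. Qed.

Lemma normc_sub_ge z w : normc z - normc w <= normc (z - w).
Proof. by rewrite lerBlDr -{1}(subrK w z) normc_triangle. Qed.

Lemma normc_dist z w : `|normc z - normc w| <= normc (z - w).
Proof. by rewrite ler_norml lerNl opprB normc_sub_ge normcB normc_sub_ge. Qed.

Lemma ReD z w : complex.Re (z + w) = complex.Re z + complex.Re w.
Proof. by case: z w => [a b] [c d]. Qed.
Lemma ImD z w : complex.Im (z + w) = complex.Im z + complex.Im w.
Proof. by case: z w => [a b] [c d]. Qed.
Lemma ReB z w : complex.Re (z - w) = complex.Re z - complex.Re w.
Proof. by case: z w => [a b] [c d]. Qed.
Lemma ImB z w : complex.Im (z - w) = complex.Im z - complex.Im w.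
Proof. by case: z w => [a b] [c d]. Qed.
Lemma ReM z w : complex.Re (z * w) =
  complex.Re z * complex.Re w - complex.Im z * complex.Im w.
Proof. by case: z w => [a b] [c d]. Qed.
Lemma ImM z w : complex.Im (z * w) =
  complex.Re z * complex.Im w + complex.Im z * complex.Re w.
Proof. by case: z w => [a b] [c d]. Qed.

Lemma Re_inv z : complex.Re z^-1 = complex.Re z / normc z ^+ 2.
Proof. by rewrite normc_sqr; case: z. Qed.
Lemma Im_inv z : complex.Im z^-1 = - complex.Im z / normc z ^+ 2.
Proof. by rewrite normc_sqr; case: z => a b /=; rewrite mulNr. Qed.

End ComplexModulus.

Section ComplexContinuity.
Variable R : realType.
Implicit Types (z w : Cplx R) (F G : Cplx R -> Cplx R).

Lemma normC_ltE z (e : R) : (`|z| < e%:C) = (normc z < e).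
Proof. by rewrite normrc ltcR. Qed.

(** The radii of balls in [Cplx R] are themselves complex, and positive in the complex order means
    real and positive; this trades them for radii in [R]. *)
Lemma nbhs_cplxP z (P : set (Cplx R)) :
  nbhs z P <-> exists2 e : R, 0 < e & forall w, normc (w - z) < e -> P w.
Proof.
split.
  move=> /nbhs_ballP [e /= e0 H].
  have [_ er] : complex.Im e = 0 /\ 0 < complex.Re e.
    by move: e0; rewrite ltcE /= => /andP[/eqP -> ->].
  exists (complex.Re e) => // w wz; apply: H.
  rewrite /ball /= -normcB in wz *.
  move: e0; rewrite ltcE /= => /andP[/eqP ei _].
  by rewrite normrc ltcE /= ei eqxx.
move=> [e e0 H]; apply/nbhs_ballP; exists e%:C => /=.
  by rewrite ltcR.
by move=> w; rewrite /ball /= normC_ltE normcB => /H.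
Qed.

Lemma cvg_cplxP T (F : set_system T) {FF : Filter F} (f : T -> Cplx R) l :
  f @ F --> l <-> forall e : R, 0 < e -> \forall x \near F, normc (f x - l) < e.
Proof.
split => [H e e0|H].
  by apply: (H [set w | normc (w - l) < e]); apply/nbhs_cplxP; exists e.
move=> A /nbhs_cplxP[e e0 HA]; apply: filterS (H e e0) => x; exact: HA.
Qed.

Lemma cvg_nbhs_cplxP (T : topologicalType) (t : T) (f : T -> Cplx R) l :
  f @ t --> l <-> forall e : R, 0 < e -> \forall x \near t, normc (f x - l) < e.
Proof. exact: cvg_cplxP. Qed.

Lemma continuous_cplxP F z : {for z, continuous F} <->
  forall e : R, 0 < e ->
    exists2 d : R, 0 < d & forall w, normc (w - z) < d -> normc (F w - F z) < e.
Proof.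
split => [cF e e0|H].
  by apply/nbhs_cplxP; move/(@cvg_nbhs_cplxP _ z F (F z)) : cF => /(_ e e0).
by apply/(@cvg_nbhs_cplxP _ z F (F z)) => e e0; apply/nbhs_cplxP; exact: H.
Qed.

Lemma continuous_cplx (T : topologicalType) (f g : T -> R) (t : T) :
  {for t, continuous f} -> {for t, continuous g} ->
  {for t, continuous (fun x => (f x +i* g x : Cplx R))}.
Proof.
move=> /cvgrPdist_lt cf /cvgrPdist_lt cg; apply/cvg_nbhs_cplxP => e e0.
have e2 : 0 < e / 2 by rewrite divr_gt0.
near=> x.
apply: le_lt_trans (normc_le_ReIm _) _ => /=.
rewrite [e]splitr ltrD// distrC; near: x; [exact: cf|exact: cg].
Unshelve. all: by end_near. Qed.

Lemma continuous_lipschitz_normc (f : Cplx R -> R) :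
  (forall z w, `|f z - f w| <= normc (z - w)) -> continuous f.
Proof.
move=> H z A /nbhs_ballP[e /= e0 HA]; apply/nbhs_cplxP; exists e => // w wz.
by apply: HA; rewrite /ball /= distrC (le_lt_trans (H _ _)).
Qed.

Lemma continuous_Re : continuous (@complex.Re R : Cplx R -> R).
Proof. by apply: continuous_lipschitz_normc => z w; rewrite -ReB Re_le_normc. Qed.

Lemma continuous_Im : continuous (@complex.Im R : Cplx R -> R).
Proof. by apply: continuous_lipschitz_normc => z w; rewrite -ImB Im_le_normc. Qed.

Lemma continuous_normc : continuous (@normc R : Cplx R -> R).
Proof. by apply: continuous_lipschitz_normc => z w; exact: normc_dist. Qed.

Lemma nbhs_upper z : 0 < complex.Im z -> \forall w \near z, 0 < complex.Im w.
Proof.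
move=> z0; apply/nbhs_cplxP; exists (complex.Im z) => // w wz.
have := le_lt_trans (Im_le_normc (w - z)) wz.
by rewrite ImB ltr_norml => /andP[+ _]; rewrite ltrBrDr addrC subrr.
Qed.

Lemma ccont_cst (c : Cplx R) z : {for z, continuous (fun=> c : Cplx R)}.
Proof. by move=> A; exact: (@cst_continuous (Cplx R) (Cplx R) c z). Qed.

Lemma ccont_id z : {for z, continuous (fun w : Cplx R => w)}.
Proof. by move=> A. Qed.

Lemma ccontD F G z : {for z, continuous F} -> {for z, continuous G} ->
  {for z, continuous (fun w => F w + G w)}.
Proof. by move=> cF cG; exact: (continuousD cF cG). Qed.

Lemma ccontN F z : {for z, continuous F} -> {for z, continuous (fun w => - F w)}.
Proof. by move=> cF; exact: (continuousN cF). Qed.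

Lemma ccontB F G z : {for z, continuous F} -> {for z, continuous G} ->
  {for z, continuous (fun w => F w - G w)}.
Proof. by move=> cF cG; exact: (continuousB cF cG). Qed.

Lemma ccontM F G z : {for z, continuous F} -> {for z, continuous G} ->
  {for z, continuous (fun w => F w * G w)}.
Proof. by move=> cF cG; exact: (@continuousM (complex R) (Cplx R) F G z cF cG). Qed.

Lemma ccontV F z : F z != 0 -> {for z, continuous F} ->
  {for z, continuous (fun w => (F w)^-1)}.
Proof. by move=> Fz cF; exact: (@continuousV (complex R) (Cplx R) F z Fz cF). Qed.

Lemma ccont_comp F G z : {for z, continuous G} -> {for G z, continuous F} ->
  {for z, continuous (fun w => F (G w))}.
Proof. by move=> cG cF; exact: (@continuous_comp _ _ _ G F z cG cF). Qed.

(* Caratheodory's form of complex differentiability. *)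
Definition cdiff F z := exists2 g : Cplx R -> Cplx R,
  {for z, continuous g} & forall w, F w = F z + (w - z) * g w.

Lemma cdiffP F z l : (forall e : R, 0 < e -> exists2 d : R, 0 < d &
    forall w, w != z -> normc (w - z) < d -> normc ((F w - F z) / (w - z) - l) < e) ->
  cdiff F z.
Proof.
move=> H; exists (fun w => if w == z then l else (F w - F z) / (w - z)).
  apply/continuous_cplxP => e e0; have [d d0 Hd] := H e e0; exists d => // w wz.
  rewrite eqxx; case: eqVneq => [_|wnz]; first by rewrite subrr normc0.
  exact: Hd.
move=> w; case: eqVneq => [->|wz]; first by rewrite subrr mul0r addr0.
by rewrite mulrC divfK ?subr_eq0// addrC subrK.
Qed.

Lemma cdiff_quotient F z : cdiff F z -> exists l, forall e : R, 0 < e ->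
  exists2 d : R, 0 < d &
    forall w, w != z -> normc (w - z) < d -> normc ((F w - F z) / (w - z) - l) < e.
Proof.
move=> [g cg HF]; exists (g z) => e e0.
have /continuous_cplxP/(_ e e0)[d d0 Hd] := cg; exists d => // w wz /Hd.
by rewrite (HF w) addrAC subrr add0r mulrAC divff ?mul1r ?subr_eq0.
Qed.

Lemma derivable_cdiff F z : derivable F z 1 <-> cdiff F z.
Proof.
split => [/cvg_ex[/= l]|/cdiff_quotient[l H]].
  move=> /cvg_cplxP H; apply: (@cdiffP _ _ l) => e e0.
  have /nbhs_cplxP[d d0 Hd] := H e e0; exists d => // w wz wd.
  have := Hd (w - z); rewrite subr0 subr_eq0 => /(_ wd wz) /=.
  by rewrite /GRing.scale /= mulr1 subrK mulrC.
apply/cvg_ex; exists l; apply/cvg_cplxP => e /H[d d0 Hd].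
apply/nbhs_cplxP; exists d => // h; rewrite subr0 => hd h0 /=.
have := Hd (h + z); rewrite addrK -subr_eq0 addrK => /(_ h0 hd).
by rewrite /GRing.scale /= mulr1 mulrC.
Qed.

Lemma cdiff_near F G z : cdiff F z -> (\forall w \near z, F w = G w) -> cdiff G z.
Proof.
move=> /cdiff_quotient[l H] /nbhs_cplxP[d0 d00 FG].
apply: (@cdiffP _ _ l) => e /H[d dp Hd].
exists (Num.min d d0); first by rewrite lt_min dp.
move=> w wz; rewrite lt_min => /andP[/(Hd w wz) + /FG <-].
by rewrite -(FG z)// subrr normc0.
Qed.

Lemma cdiff_continuous F z : cdiff F z -> {for z, continuous F}.
Proof.
move=> [g cg HF].
have -> : F = (fun w => F z + (w - z) * g w) by apply/funext => w; rewrite -HF.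
exact: (ccontD (@ccont_cst _ _) (ccontM (ccontB (@ccont_id z) (@ccont_cst _ _)) cg)).
Qed.

Lemma cdiff_cst (c : Cplx R) z : cdiff (fun=> c) z.
Proof. by exists (fun=> 0) => [|w]; [exact: ccont_cst|rewrite mulr0 addr0]. Qed.

Lemma cdiff_id z : cdiff id z.
Proof. by exists (fun=> 1) => [|w]; [exact: ccont_cst|rewrite mulr1 addrC subrK]. Qed.

Lemma cdiffD F G z : cdiff F z -> cdiff G z -> cdiff (fun w => F w + G w) z.
Proof.
move=> [f cf HF] [g cg HG]; exists (fun w => f w + g w); first exact: (ccontD cf cg).
by move=> w; rewrite HF HG; ring.
Qed.

Lemma cdiffM F G z : cdiff F z -> cdiff G z -> cdiff (fun w => F w * G w) z.
Proof.
move=> dF dG; have cG := cdiff_continuous dG; move: dF dG => [f cf HF] [g cg HG].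
exists (fun w => f w * G w + F z * g w).
  exact: (ccontD (ccontM cf cG) (ccontM (@ccont_cst _ _) cg)).
by move=> w; rewrite [F w]HF [G w]HG; ring.
Qed.

Lemma cdiffN F z : cdiff F z -> cdiff (fun w => - F w) z.
Proof.
move=> dF; have := cdiffM (cdiff_cst (-1) z) dF.
by under eq_fun do rewrite mulN1r.
Qed.

Lemma cdiffB F G z : cdiff F z -> cdiff G z -> cdiff (fun w => F w - G w) z.
Proof. by move=> dF dG; apply: cdiffD => //; exact: cdiffN. Qed.

(** With [0^-1 = 0] the candidate [- f w / (F w * F z)] fails wherever [F] vanishes away from [z],
    while [cdiff] asks for an identity at every [w]. Hence the detour through [cdiffP], which only
    looks near [z]. *)
Lemma cdiffV F z : F z != 0 -> cdiff F z -> cdiff (fun w => (F w)^-1) z.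
Proof.
move=> Fz dF; have cF := cdiff_continuous dF; have [f cf HF] := dF.
have cV : {for z, continuous (fun w => (F w)^-1)} := ccontV Fz cF.
have cg : {for z, continuous (fun w => - f w * ((F w)^-1 * (F z)^-1))}.
  exact: (ccontM (ccontN cf) (ccontM cV (@ccont_cst _ _))).
apply: (@cdiffP _ _ (- f z * ((F z)^-1 * (F z)^-1))) => e e0.
have /continuous_cplxP/(_ _ e0)[d d0 Hd] := cg.
have /continuous_cplxP/(_ (normc (F z))) := cF.
rewrite normc_gt0 => /(_ Fz)[d' d'0 Hd'].
exists (Num.min d d'); first by rewrite lt_min d0.
move=> w wz; rewrite lt_min => /andP[/Hd wd /Hd' wd'].
have Fw : F w != 0 by apply: contraTneq wd' => ->; rewrite sub0r normcN ltxx.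
have -> : ((F w)^-1 - (F z)^-1) / (w - z) = - f w * ((F w)^-1 * (F z)^-1) => //.
have wz0 : w - z != 0 by rewrite subr_eq0.
have -> : (F w)^-1 - (F z)^-1 = - (F w - F z) * ((F w)^-1 * (F z)^-1).
  by field; rewrite Fw Fz.
have -> : F w - F z = (w - z) * f w by rewrite HF addrAC subrr add0r.
by field; rewrite Fw Fz wz0.
Qed.

Lemma cdiff_comp F G z : cdiff G z -> cdiff F (G z) -> cdiff (fun w => F (G w)) z.
Proof.
move=> dG; have cG := cdiff_continuous dG; move: dG => [g cg HG] [f cf HF].
exists (fun w => g w * f (G w)).
  exact: (ccontM cg (ccont_comp cG cf)).
by move=> w; rewrite [F (G w)]HF {1}(HG w); ring.
Qed.

Lemma cdiff_horner (P : {poly complex R}) z : cdiff (fun w => P.[w]) z.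
Proof.
elim/poly_ind: P => [|P c IH]; first by under eq_fun do rewrite horner0; exact: cdiff_cst.
under eq_fun do rewrite hornerMXaddC.
by apply: cdiffD; [apply: cdiffM => //; exact: cdiff_id|exact: cdiff_cst].
Qed.

End ComplexContinuity.

(** * The Cauchy-Goursat theorem on rectangles *)

Section SegmentIntegral.
Variable R : realType.
Implicit Types (g : R -> R) (a b k e M : R).

Definition seg g a b : R := \int[@lebesgue_measure R]_(x in `[a, b]) g x.

Lemma seg_integrable g a b : {in `[a, b], continuous g} ->
  (@lebesgue_measure R).-integrable `[a, b] (EFin \o g).
Proof.
move=> cg; apply: continuous_compact_integrable; first exact: segment_compact.
by apply: continuous_in_subspaceT => x /set_mem xab; exact: cg.
Qed.

Lemma seg_split m g a b : {in `[a, b], continuous g} -> a <= m -> m <= b ->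
  seg g a b = seg g a m + seg g m b.
Proof.
move=> cg am mb; apply/eqP; rewrite addrC -subr_eq; apply/eqP.
have ig := seg_integrable cg.
rewrite /seg Rintegral_itvB ?bnd_simp//.
rewrite Rintegral_itv_obnd_cbnd//.
apply: integrableS ig => //.
by apply: subset_itvr; rewrite bnd_simp.
Qed.

Lemma segB g1 g2 a b : {in `[a, b], continuous g1} -> {in `[a, b], continuous g2} ->
  seg (fun x => g1 x - g2 x) a b = seg g1 a b - seg g2 a b.
Proof. by move=> c1 c2; rewrite /seg RintegralB//; exact: seg_integrable. Qed.

Lemma seg_cst k a b : a <= b -> seg (fun=> k) a b = k * (b - a).
Proof.
move=> ab; rewrite /seg Rintegral_cst//= lebesgue_measure_itv/= lte_fin.
by case: ltP => //= ba; rewrite (@le_anti _ _ a b) ?ab// subrr.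
Qed.

Lemma seg_approx k e g a b : {in `[a, b], continuous g} -> a <= b ->
  (forall x, a <= x <= b -> `|g x - k| <= e) ->
  `|seg g a b - k * (b - a)| <= e * (b - a).
Proof.
move=> cg ab H.
have ck : {in `[a, b], continuous (fun=> k : R)} by move=> x _; exact: cst_continuous.
have cgk : {in `[a, b], continuous (fun x => g x - k)}.
  by move=> x xab; apply: continuousB; [exact: cg|exact: cst_continuous].
rewrite -(seg_cst _ ab) -segB// /seg.
apply: le_trans (le_normr_Rintegral _ (seg_integrable cgk)) _ => //.
rewrite -(seg_cst e ab); apply: le_Rintegral => //.
- by apply: seg_integrable => x xab; apply: cvg_norm; exact: cgk.
- by apply: seg_integrable => x xab; exact: cst_continuous.
Qed.

Lemma seg_le M g a b : {in `[a, b], continuous g} -> a <= b ->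
  (forall x, a <= x <= b -> `|g x| <= M) -> `|seg g a b| <= M * (b - a).
Proof.
move=> cg ab H; have := @seg_approx 0 M g a b cg ab.
by rewrite mul0r subr0; apply => x /H; rewrite subr0.
Qed.

End SegmentIntegral.

Section Goursat.
Variable R : realType.
Variable F : Cplx R -> Cplx R.
Hypothesis cF : forall z, 0 < complex.Im z -> {for z, continuous F}.

Lemma continuous_hline (y : R) : 0 < y ->
  continuous (fun x : R => F (x +i* y)).
Proof.
move=> y0 x; apply: (@continuous_comp _ _ _ (fun x : R => (x +i* y : Cplx R)) F); last exact: cF.
by apply: continuous_cplx; [exact: cvg_id|exact: cst_continuous].
Qed.

Lemma continuous_vline (x y : R) : 0 < y ->
  {for y, continuous (fun y : R => F (x +i* y))}.
Proof.
move=> y0; apply: (@continuous_comp _ _ _ (fun y : R => (x +i* y : Cplx R)) F); last exact: cF.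
by apply: continuous_cplx; [exact: cst_continuous|exact: cvg_id].
Qed.

Lemma continuous_Re_hline (y : R) : 0 < y ->
  continuous (fun x : R => complex.Re (F (x +i* y))).
Proof.
move=> y0 x; apply: (@continuous_comp _ _ _ (fun x : R => F (x +i* y)) (@complex.Re R)).
  exact: continuous_hline.
exact: continuous_Re.
Qed.

Lemma continuous_Im_vline (x y : R) : 0 < y ->
  {for y, continuous (fun y : R => complex.Im (F (x +i* y)))}.
Proof.
move=> y0; apply: (@continuous_comp _ _ _ (fun y : R => F (x +i* y)) (@complex.Im R)).
  exact: continuous_vline.
exact: continuous_Im.
Qed.

Local Notation H y a b := (seg (fun x : R => complex.Re (F (x +i* y))) a b).
Local Notation V x c d := (seg (fun y : R => complex.Im (F (x +i* y))) c d).

(* The real part of the integral of [F] along the boundary of the rectangle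
   [a, b] x [c, d]. *)
Definition rect_int a b c d : R := H c a b - H d a b - V b c d + V a c d.

Lemma hline_in (y a b : R) : 0 < y ->
  {in `[a, b], continuous (fun x : R => complex.Re (F (x +i* y)))}.
Proof. by move=> y0 x _; exact: continuous_Re_hline. Qed.

Lemma vline_in (x c d : R) : 0 < c ->
  {in `[c, d], continuous (fun y : R => complex.Im (F (x +i* y)))}.
Proof.
move=> c0 y; rewrite in_itv/= => /andP[cy _].
by apply: continuous_Im_vline; exact: lt_le_trans cy.
Qed.

Lemma rect_int_vsplit k a b c d : 0 < c -> c <= k -> k <= d ->
  rect_int a b c d = rect_int a b c k + rect_int a b k d.
Proof.
move=> c0 ck kd; rewrite /rect_int.
by rewrite !(@seg_split _ k _ c d)//; [ring|exact: vline_in..].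
Qed.

Lemma rect_int_hsplit m a b c d : 0 < c -> c <= d -> a <= m -> m <= b ->
  rect_int a b c d = rect_int a m c d + rect_int m b c d.
Proof.
move=> c0 cd am mb; rewrite /rect_int.
by rewrite !(@seg_split _ m _ a b)//; [ring|apply: hline_in..] => //; exact: lt_le_trans cd.
Qed.

(* The integral of an affine function vanishes. *)
Lemma rect_int_small l v z e a b c d : 0 < c -> a <= b -> c <= d ->
  (forall x y, a <= x <= b -> c <= y <= d ->
     normc (F (x +i* y) - v - l * ((x +i* y) - z)) <= e) ->
  `|rect_int a b c d| <= 2 * e * (b - a) + 2 * e * (d - c).
Proof.
move=> c0 ab cd He; have d0 : 0 < d by exact: lt_le_trans cd.
have h1 x y : a <= x <= b -> c <= y <= d ->
    normc (F (x +i* y) - (v + l * ((x +i* y) - z))) <= e.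
  by move=> xab ycd; rewrite opprD addrA He.
(* The affine part contributes [Im l * (d - c) * (b - a)] to each of the two pairs of opposite
   sides, and the pairs enter [rect_int] with opposite signs. *)
have A : `|H c a b - H d a b - (complex.Im l * (d - c)) * (b - a)| <= 2 * e * (b - a).
  rewrite -segB; [|exact: hline_in..].
  apply: seg_approx => //.
    by move=> x xab; exact: (continuousB (@hline_in c a b c0 x xab) (@hline_in d a b d0 x xab)).
  move=> x xab.
  have := h1 x c xab; rewrite lexx cd => /(_ isT) /(le_trans (Re_le_normc _)).
  have := h1 x d xab; rewrite lexx cd => /(_ isT) /(le_trans (Re_le_normc _)).
  rewrite !(ReB, ReD, ReM, ImB)/= !ler_norml => /andP[? ?] /andP[? ?].
  by apply/andP; split; lra.
have B : `|V b c d - V a c d - (complex.Im l * (b - a)) * (d - c)| <= 2 * e * (d - c).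
  rewrite -segB; [|exact: vline_in..].
  apply: seg_approx => //.
    by move=> y ycd; exact: (continuousB (@vline_in b c d c0 y ycd) (@vline_in a c d c0 y ycd)).
  move=> y ycd.
  have := h1 a y; rewrite lexx ab => /(_ isT ycd) /(le_trans (Im_le_normc _)).
  have := h1 b y; rewrite lexx ab => /(_ isT ycd) /(le_trans (Im_le_normc _)).
  rewrite !(ImB, ImD, ImM, ReB)/= !ler_norml => /andP[? ?] /andP[? ?].
  by apply/andP; split; lra.
rewrite /rect_int.
set h1' := H c a b in A *; set h2 := H d a b in A *; set v1 := V b c d in B *; set v2 := V a c d in B *.
move: A B; set k := complex.Im l; rewrite !ler_norml => /andP[? ?] /andP[? ?].
have E : k * (d - c) * (b - a) = k * (b - a) * (d - c) by ring.
by apply/andP; split; lra.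
Qed.

Record rect := Rect { ra : R; rb : R; rc : R; rd : R }.

Let valid (q : rect) := [/\ ra q <= rb q, 0 < rc q & rc q <= rd q].
Let RI (q : rect) := rect_int (ra q) (rb q) (rc q) (rd q).

(** One of the four quarters carries at least a quarter of the integral. Validity is assumed under
    the existential so that [choice] can turn the lemma into a total function to iterate. *)
Lemma rect_bisect (q : rect) : exists q' : rect, valid q ->
  [/\ valid q', ra q <= ra q', rb q' <= rb q &
      [/\ rc q <= rc q', rd q' <= rd q,
      rb q' - ra q' = (rb q - ra q) / 2, rd q' - rc q' = (rd q - rc q) / 2 &
      `|RI q| / 4 <= `|RI q'|]].
Proof.
case: q => a b c d; pose m := (a + b) / 2; pose k := (c + d) / 2.
have [vq|nvq] := pselect (valid (Rect a b c d)); last by exists (Rect a b c d).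
move: (vq) => [/= ab c0 cd].
have am : a <= m by rewrite /m; lra.
have mb : m <= b by rewrite /m; lra.
have ck : c <= k by rewrite /k; lra.
have kd : k <= d by rewrite /k; lra.
have k0 : 0 < k by exact: lt_le_trans ck.
have E : rect_int a b c d = rect_int a m c k + rect_int m b c k +
    (rect_int a m k d + rect_int m b k d).
  by rewrite (rect_int_vsplit _ _ c0 ck kd) !(@rect_int_hsplit m a b).
have [h1|h1] := lerP (`|rect_int a b c d| / 4) `|rect_int a m c k|.
  by exists (Rect a m c k) => _; split => //=; split => //=; rewrite ?/m ?/k; field.
have [h2|h2] := lerP (`|rect_int a b c d| / 4) `|rect_int m b c k|.
  by exists (Rect m b c k) => _; split => //=; split => //=; rewrite ?/m ?/k; field.
have [h3|h3] := lerP (`|rect_int a b c d| / 4) `|rect_int a m k d|.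
  by exists (Rect a m k d) => _; split => //=; split => //=; rewrite ?/m ?/k; field.
have [h4|h4] := lerP (`|rect_int a b c d| / 4) `|rect_int m b k d|.
  by exists (Rect m b k d) => _; split => //=; split => //=; rewrite ?/m ?/k; field.
exfalso; have := ler_normD (rect_int a m c k + rect_int m b c k)
  (rect_int a m k d + rect_int m b k d); rewrite -E.
have := ler_normD (rect_int a m c k) (rect_int m b c k).
have := ler_normD (rect_int a m k d) (rect_int m b k d).
by lra.
Qed.

Lemma nested_itv (a b : nat -> R) : (forall n, a n <= a n.+1) ->
  (forall n, b n.+1 <= b n) -> (forall n, a n <= b n) ->
  exists x, forall n, a n <= x <= b n.
Proof.
move=> ha hb hab.
have ia : {homo a : i j / (i <= j)%N >-> i <= j} by apply: homo_leq => //; exact: le_trans.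
have ib : {homo b : i j / (i <= j)%N >-> j <= i}.
  by apply: homo_leq => // i j l /[swap]; exact: le_trans.
have hab' i j : a i <= b j.
  apply: le_trans (ia _ _ (leq_maxl i j)) _.
  by apply: le_trans (hab _) _; exact: ib (leq_maxr i j).
have hs : has_sup (range a).
  split; first by exists (a 0%N), 0%N.
  by exists (b 0%N) => _ [n _ <-].
exists (sup (range a)) => n; apply/andP; split.
  by apply: ub_le_sup; [exact: hs.2|exists n].
by apply: ge_sup; [exact: hs.1|move=> _ [i _ <-]].
Qed.

Lemma goursat_closed a b c d : 0 < c -> a <= b -> c <= d ->
  (forall z, a <= complex.Re z <= b -> c <= complex.Im z <= d -> cdiff F z) ->
  rect_int a b c d = 0.
Proof.
move=> c0 ab cd dF.
have [s Hs] := choice rect_bisect.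
pose q n := iter n s (Rect a b c d).
have vq n : valid (q n).
  by elim: n => [|n IH] //=; have [] := Hs _ IH.
have [x Hx] : exists x, forall n, ra (q n) <= x <= rb (q n).
  apply: nested_itv => n; last by have [] := vq n.
    by have [] := Hs _ (vq n).
  by have [] := Hs _ (vq n).
have [y Hy] : exists y, forall n, rc (q n) <= y <= rd (q n).
  apply: nested_itv => n; last by have [] := vq n.
    by have [_ _ _ []] := Hs _ (vq n).
  by have [_ _ _ []] := Hs _ (vq n).
have wq n : rb (q n) - ra (q n) = (b - a) * 2^-1 ^+ n.
  elim: n => [|n IH]; first by rewrite mulr1.
  by have [_ _ _ [_ _ -> _ _]] := Hs _ (vq n); rewrite IH exprSr mulrA.
have hq n : rd (q n) - rc (q n) = (d - c) * 2^-1 ^+ n.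
  elim: n => [|n IH]; first by rewrite mulr1.
  by have [_ _ _ [_ _ _ -> _]] := Hs _ (vq n); rewrite IH exprSr mulrA.
have Jq n : `|rect_int a b c d| * (2^-1 ^+ n) ^+ 2 <= `|RI (q n)|.
  elim: n => [|n IH]; first by rewrite expr0 expr1n mulr1.
  have [_ _ _ [_ _ _ _]] := Hs _ (vq n).
  apply: le_trans; apply: le_trans (_ : `|rect_int a b c d| * (2^-1 ^+ n) ^+ 2 / 4 <= _).
    by rewrite [2^-1 ^+ n.+1]exprSr le_eqVlt; apply/orP; left; apply/eqP; field.
  by rewrite ler_pM2r ?invr_gt0.
have [g cg Fg] : cdiff F (x +i* y) by apply: dF; [exact: Hx 0%N|exact: Hy 0%N].
apply/eqP; rewrite -normr_le0; apply/ler_addgt0Pr => e e0; rewrite add0r.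
pose D := (b - a) + (d - c).
have D0 : 0 <= D by rewrite /D addr_ge0// subr_ge0.
(* Width plus height of the [n]-th rectangle is [D / 2^n], so its integral is at most
   [2 e' D^2 / 4^n]; the factor [4^-n] cancels against the lower bound [Jq]. *)
pose e' := e / (2 * D ^+ 2 + 1).
have e'0 : 0 < e' by rewrite divr_gt0// ltr_wpDl// mulr_ge0// sqr_ge0.
have /continuous_cplxP/(_ e' e'0)[r r0 Hr] := cg.
have [n Hn] : exists n, D * 2^-1 ^+ n < r.
  have /cvgrPdist_lt/(_ r r0)[N _ /(_ N (leqnn N))] : (fun n => D * 2^-1 ^+ n) @ \oo --> (0 : R).
    rewrite -[X in _ --> X](mulr0 D); apply: cvgM; first exact: cvg_cst.
    by apply: cvg_expr; rewrite ger0_norm ?invr_ge0// invf_lt1// ltr1n.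
  by rewrite sub0r normrN ger0_norm ?mulr_ge0 ?exprn_ge0 ?invr_ge0// => ?; exists N.
have H2 : 0 < (2^-1 : R) ^+ n by rewrite exprn_gt0// invr_gt0.
have : `|RI (q n)| <= 2 * (e' * (D * 2^-1 ^+ n)) * (rb (q n) - ra (q n)) +
    2 * (e' * (D * 2^-1 ^+ n)) * (rd (q n) - rc (q n)).
  have [v1 v2 v3] := vq n.
  apply: (@rect_int_small (g (x +i* y)) (F (x +i* y)) (x +i* y)) => // u v Hu Hv.
  have -> : F (u +i* v) - F (x +i* y) - g (x +i* y) * ((u +i* v) - (x +i* y)) =
      (g (u +i* v) - g (x +i* y)) * ((u +i* v) - (x +i* y)).
    by rewrite (Fg (u +i* v)); ring.
  have N : normc ((u +i* v : Cplx R) - (x +i* y)) <= D * 2^-1 ^+ n.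
    apply: le_trans (normc_le_ReIm _) _ => /=.
    rewrite /D mulrDl -wq -hq; apply: lerD.
      by move: Hu (Hx n) => /andP[? ?] /andP[? ?]; rewrite ler_norml; apply/andP; split; lra.
    by move: Hv (Hy n) => /andP[? ?] /andP[? ?]; rewrite ler_norml; apply/andP; split; lra.
  rewrite normcM ler_pM ?normc_ge0// ltW// Hr//.
  exact: le_lt_trans Hn.
move=> /(le_trans (Jq n)); rewrite -mulrDr wq hq -mulrDl -/D.
have -> : 2 * (e' * (D * 2^-1 ^+ n)) * (D * 2^-1 ^+ n) = 2 * e' * D ^+ 2 * (2^-1 ^+ n) ^+ 2 by ring.
rewrite ler_pM2r ?exprn_gt0// => /le_trans; apply.
rewrite /e' mulrAC mulrA ler_pdivrMr; last by rewrite ltr_wpDl// mulr_ge0// sqr_ge0.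
by have := sqr_ge0 D; nra.
Qed.

End Goursat.

(** * Goursat's theorem on strips, with finitely many exceptional points *)

Section Plane.
Variable R : realType.

(* Clamping the imaginary part makes a function on the half-plane continuous on
   the whole plane. *)
Lemma continuous_clamp (T : topologicalType) (G : Cplx R -> T) (c : R) : 0 < c ->
  (forall z, 0 < complex.Im z -> {for z, continuous G}) ->
  continuous (fun p : R * R => G (p.1 +i* Num.max p.2 c)).
Proof.
move=> c0 cG p.
apply: (@continuous_comp _ _ _ (fun p : R * R => (p.1 +i* Num.max p.2 c : Cplx R)) G).
  apply: continuous_cplx; first exact: cvg_fst.
  by apply: (@continuous_max R (R * R)%type snd (cst c)); [exact: cvg_snd|exact: cvg_cst].
by apply: cG => /=; rewrite lt_max c0 orbT.
Qed.

(** Measurability on [R * R] refers to the product sigma-algebra, so an open set has to be written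
    as a countable union of boxes; boxes with rational ends suffice. *)
Lemma measurable_continuous2 (f : R * R -> R) : continuous f -> measurable_fun setT f.
Proof.
move=> cf; apply: (measurability _ (RGenOInfty.measurableE R)).
move=> _ [_ [a -> <-]]; rewrite setTI.
pose box (q1 q2 q3 q4 : rat) : set (R * R) :=
  `]ratr q1, ratr q2[%classic `*` `]ratr q3, ratr q4[%classic.
pose A := f @^-1` `]a, +oo[%classic.
pose sel q1 q2 q3 q4 : set (R * R) :=
  if `[< box q1 q2 q3 q4 `<=` A >] then box q1 q2 q3 q4 else set0.
have -> : f @^-1` `]a, +oo[%classic =
    \bigcup_q1 \bigcup_q2 \bigcup_q3 \bigcup_q4 sel q1 q2 q3 q4.
  apply/seteqP; split; last first.
    by move=> p [q1 _ [q2 _ [q3 _ [q4 _]]]]; rewrite /sel; case: ifPn => // /asboolP; exact.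
  move=> [x y] fxy.
  have /(cf (x, y)) : nbhs (f (x, y)) `]a, +oo[%classic.
    by apply: open_nbhs_nbhs; split.
  move=> [[U V] /= [/nbhs_ballP[e1 /= e10 H1] /nbhs_ballP[e2 /= e20 H2]] UV].
  have lt1 (t e : R) : 0 < e -> t - e < t by move=> e0; rewrite ltrBlDr ltrDl.
  have lt2 (t e : R) : 0 < e -> t < t + e by move=> e0; rewrite ltrDl.
  have [q1 ] := rat_in_itvoo (lt1 x _ e10); rewrite in_itv/= => /andP[q1a q1b].
  have [q2 ] := rat_in_itvoo (lt2 x _ e10); rewrite in_itv/= => /andP[q2a q2b].
  have [q3 ] := rat_in_itvoo (lt1 y _ e20); rewrite in_itv/= => /andP[q3a q3b].
  have [q4 ] := rat_in_itvoo (lt2 y _ e20); rewrite in_itv/= => /andP[q4a q4b].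
  exists q1 => //; exists q2 => //; exists q3 => //; exists q4 => //.
  rewrite /sel ifT; first by split; rewrite /= in_itv/=; apply/andP.
  apply/asboolP => -[u v] [/=]; rewrite !in_itv/= => /andP[? ?] /andP[? ?].
  apply: (UV (u, v)); split => /=.
    by apply: H1; rewrite /ball/= ltr_norml; apply/andP; split; lra.
  by apply: H2; rewrite /ball/= ltr_norml; apply/andP; split; lra.
apply: bigcupT_measurable_rat => q1; apply: bigcupT_measurable_rat => q2.
apply: bigcupT_measurable_rat => q3; apply: bigcupT_measurable_rat => q4.
by rewrite /sel; case: ifP => _ //; exact: measurableX.
Qed.

Lemma rectangle_bounded (G : Cplx R -> Cplx R) (a b c d : R) : 0 < c ->
  (forall z, 0 < complex.Im z -> {for z, continuous G}) ->
  exists2 M : R, 0 < M & forall x y, a <= x <= b -> c <= y <= d -> normc (G (x +i* y)) <= M.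
Proof.
move=> c0 cG.
have cnG z : 0 < complex.Im z -> {for z, continuous (@normc R \o G : Cplx R -> R^o)}.
  by move=> z0; apply: continuous_comp; [exact: cG|exact: continuous_normc].
have cg := continuous_clamp c0 cnG.
have /compact_bounded[M [_ HM]] : compact
    ((fun p : R * R => normc (G (p.1 +i* Num.max p.2 c)) : R^o) @` (`[a, b] `*` `[c, d])).
  apply: continuous_compact; first exact: continuous_subspaceT.
  by apply: compact_setX; exact: segment_compact.
exists (`|M| + 1); first by rewrite ltr_wpDl.
move=> x y xab ycd; have /HM := le_lt_trans (ler_norm M) (ltr_pwDr ltr01 (lexx `|M|)).
move=> /(_ (normc (G (x +i* y)))); rewrite /= ger0_norm ?normc_ge0//; apply.
exists (x, y); first by split; rewrite /= in_itv/=.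
by move: ycd => /andP[cy _] /=; rewrite max_l.
Qed.

Section StripGoursat.
Variable F : Cplx R -> Cplx R.
Hypothesis cF : forall z, 0 < complex.Im z -> {for z, continuous F}.

Lemma continuous_hseg (a b y : R) : 0 < y ->
  {for y, continuous (fun y : R => seg (fun x : R => complex.Re (F (x +i* y))) a b)}.
Proof.
move=> y0.
have u0 : 0 < y / 2 by rewrite divr_gt0.
have [M M0 HM] := rectangle_bounded a b (y + 1) u0 cF.
rewrite /seg; apply: (@continuity_under_integral R _ _ (@lebesgue_measure R)
   (fun (y x : R) => complex.Re (F (x +i* y))) `[a, b] _ (y / 2) (y + 1) _ _ (fun=> M)) => //.
- move=> t /=; rewrite in_itv/= => /andP[t0 _].
  by apply: seg_integrable; apply: hline_in => //; exact: lt_trans t0.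
- apply: aeW => x _ t; rewrite inE/= in_itv/= => /andP[t0 _].
  apply: (@continuous_comp _ _ _ (fun y : R => F (x +i* y)) (@complex.Re R)).
    by apply: continuous_vline => //; exact: lt_trans t0.
  exact: continuous_Re.
- by apply: seg_integrable => x _; exact: cst_continuous.
- move=> t /=; rewrite in_itv/= => /andP[t0 t1]; apply: aeW => x /=; rewrite in_itv/= => xab.
  by apply: le_trans (Re_le_normc _) _; apply: HM => //; rewrite (ltW t0) (ltW t1).
- by rewrite inE/= in_itv/=; apply/andP; split; lra.
Qed.

(** The two horizontal sides nearly cancel, since by [continuous_hseg] their integrals depend
    continuously on the height, and the vertical sides are short. *)
Lemma rect_int_thin (a b y e : R) : 0 < y -> a <= b -> 0 < e ->
  exists2 r : R, 0 < r & forall c d, `|c - y| < r -> `|d - y| < r -> c <= d ->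
    `|rect_int F a b c d| <= e.
Proof.
move=> y0 ab e0.
have e4 : 0 < e / 4 by rewrite divr_gt0.
have /cvgrPdist_lt/(_ _ e4)/nbhs_ballP[r1 /= r10 H1] := @continuous_hseg a b y y0.
have u0 : 0 < y / 2 by rewrite divr_gt0.
have [M M0 HM] := rectangle_bounded a b (y + 1) u0 cF.
(* The bounds [y / 2] and [1] keep the heights where [M] bounds [F]. The last entry gives
   [d - c < 2 * (e / 8 / M)], so that each vertical side contributes at most [e / 4]. *)
pose r := Num.min r1 (Num.min (y / 2) (Num.min 1 (e / 8 / M))).
exists r; first by rewrite !lt_min r10 u0 ltr01 !divr_gt0.
move=> c d; rewrite !lt_min => /and4P[c1 c2 c3 c4] /and4P[d1 d2 d3 d4] cd.
have hc := H1 c; rewrite /ball/= distrC in hc; have {}hc := hc c1.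
have hd := H1 d; rewrite /ball/= distrC in hd; have {}hd := hd d1.
move: c2 c3 d2 d3 c4 d4; rewrite !ltr_norml => /andP[? ?] /andP[? ?] /andP[? ?] /andP[? ?].
move=> /andP[? ?] /andP[? ?].
have c0 : 0 < c by lra.
have V x : a <= x <= b -> `|seg (fun y : R => complex.Im (F (x +i* y))) c d| <= e / 4.
  move=> xab; apply: le_trans (@seg_le _ M _ _ _ _ _ _) _ => //; first exact: vline_in.
    move=> t /andP[ct td]; apply: le_trans (Im_le_normc _) _; apply: HM => //.
    by apply/andP; split; lra.
  rewrite mulrC -ler_pdivlMr//.
  have -> : e / 4 / M = 2 * (e / 8 / M) by field; rewrite lt0r_neq0.
  by lra.
have va := V a; have vb := V b; rewrite !lexx ab in va vb.
have {}va := va isT; have {}vb := vb isT.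
move: hc hd va vb; rewrite /rect_int !ltr_norml !ler_norml.
by move=> /andP[? ?] /andP[? ?] /andP[? ?] /andP[? ?]; apply/andP; split; lra.
Qed.

Lemma goursat_strip a b c d : 0 < c -> a <= b -> c <= d ->
  (forall z, c < complex.Im z < d -> cdiff F z) -> rect_int F a b c d = 0.
Proof.
move=> c0 ab cd dF.
have rr t : 0 < t -> rect_int F a b t t = 0.
  move=> t0; have := rect_int_vsplit cF a b t0 (lexx t) (lexx t).
  by move/eqP; rewrite -subr_eq subrr => /eqP.
move: cd; rewrite le_eqVlt => /predU1P[<-|cd]; first exact: rr.
apply/eqP; rewrite -normr_le0; apply/ler_addgt0Pr => e e0; rewrite add0r.
have e2 : 0 < e / 2 by rewrite divr_gt0.
have d0 : 0 < d by exact: lt_trans cd.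
have [r1 r10 H1] := rect_int_thin c0 ab e2.
have [r2 r20 H2] := rect_int_thin d0 ab e2.
pose s := Num.min (r1 / 2) (Num.min (r2 / 2) ((d - c) / 4)).
have s0 : 0 < s by rewrite !lt_min !divr_gt0// subr_gt0.
have s1 : s <= r1 / 2 by rewrite ge_min lexx.
have s2 : s <= r2 / 2 by rewrite !ge_min lexx !orbT.
have s3 : s <= (d - c) / 4 by rewrite !ge_min lexx !orbT.
have h1 : `|rect_int F a b c (c + s)| <= e / 2.
  apply: H1; rewrite ?subrr ?normr0//; last by lra.
  by rewrite addrAC subrr add0r gtr0_norm//; lra.
have h2 : `|rect_int F a b (d - s) d| <= e / 2.
  apply: H2; rewrite ?subrr ?normr0//; last by lra.
  by rewrite addrAC subrr add0r normrN gtr0_norm//; lra.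
rewrite (@rect_int_vsplit _ _ cF (c + s))//; [|lra|lra].
rewrite (@rect_int_vsplit _ _ cF (d - s) _ _ (c + s))//; [|lra|lra|lra].
have -> : rect_int F a b (c + s) (d - s) = 0.
  apply: goursat_closed => //; [lra|lra|] => z _ /andP[? ?].
  by apply: dF; apply/andP; split; lra.
rewrite add0r; apply: le_trans (ler_normD _ _) _.
by lra.
Qed.

(** Cutting the rectangle at the height of an exceptional point puts that point on the boundary of
    both pieces, where continuity is enough. The induction therefore runs on differentiability in
    the open strip only. *)
Lemma goursat (S : seq (Cplx R)) a b c d : 0 < c -> a <= b -> c <= d ->
  (forall z, 0 < complex.Im z -> z \notin S -> cdiff F z) -> rect_int F a b c d = 0.
Proof.
move=> c0 ab cd dF.
have : forall z, c < complex.Im z < d -> z \notin S -> cdiff F z.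
  by move=> z /andP[cz _]; apply: dF; exact: lt_trans cz.
elim: S c d c0 cd {dF} => [|s S IH] c d c0 cd dF.
  by apply: goursat_strip => // z zcd; exact: dF.
have [/andP[cs sd]|nsd] := boolP (c < complex.Im s < d).
  rewrite (@rect_int_vsplit _ _ cF (complex.Im s))//; [|exact: ltW..].
  rewrite !IH ?addr0// ?ltW//.
    - exact: lt_trans cs.
    - move=> z /andP[sz zd] zS; apply: dF; first by rewrite zd (lt_trans cs).
      by rewrite inE negb_or zS andbT; apply: contraTneq sz => ->; rewrite ltxx.
    move=> z /andP[cz zs] zS; apply: dF; first by rewrite cz (lt_trans zs).
    by rewrite inE negb_or zS andbT; apply: contraTneq zs => ->; rewrite ltxx.
apply: IH => // z zcd zS; apply: dF => //.
by rewrite inE negb_or zS andbT; apply: contraNneq nsd => <-.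
Qed.

End StripGoursat.
End Plane.

(** * Cauchy integrals along horizontal lines *)

Section Integrals.
Variable R : realType.
Local Notation mu := (@lebesgue_measure R).
Implicit Types (f g b : R -> R) (B K : R).

Lemma measurable_EFin_fun (D : set R) f : measurable_fun D f ->
  measurable_fun D (fun x => (f x)%:E).
Proof. by move=> mf; apply/measurable_EFinP. Qed.

Lemma ge0_le_int (D : set R) f g : measurable D ->
  measurable_fun D f -> measurable_fun D g ->
  (forall x, D x -> 0 <= f x) -> (forall x, D x -> f x <= g x) ->
  (\int[mu]_(x in D) (f x)%:E <= \int[mu]_(x in D) (g x)%:E)%E.
Proof.
move=> mD mf mg f0 fg; by apply: ge0_le_integral => //; exact: measurable_EFin_fun.
Qed.

Lemma ge0_intD (D : set R) f g : measurable D ->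
  measurable_fun D f -> measurable_fun D g ->
  (forall x, D x -> 0 <= f x) -> (forall x, D x -> 0 <= g x) ->
  (\int[mu]_(x in D) (f x + g x)%:E =
   \int[mu]_(x in D) (f x)%:E + \int[mu]_(x in D) (g x)%:E)%E.
Proof.
move=> mD mf mg f0 g0; under eq_integral do rewrite EFinD.
by apply: ge0_integralD => //; exact: measurable_EFin_fun.
Qed.

Lemma ge0_intZ (D : set R) (k : R) f : measurable D -> measurable_fun D f ->
  (forall x, D x -> 0 <= f x) -> 0 <= k ->
  (\int[mu]_(x in D) (k * f x)%:E = k%:E * \int[mu]_(x in D) (f x)%:E)%E.
Proof.
move=> mD mf f0 k0; under eq_integral do rewrite EFinM.
apply: ge0_integralZl_EFin => //.
exact: measurable_EFin_fun.
Qed.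

Lemma integrable_dom (D : set R) f b B : measurable D ->
  measurable_fun D f -> (forall x, D x -> `|f x| <= b x) -> measurable_fun D b ->
  (\int[mu]_(x in D) (b x)%:E <= B%:E)%E -> mu.-integrable D (EFin \o f).
Proof.
move=> mD mf fb mb bB; apply/integrableP; split; first exact/measurable_EFinP.
apply: le_lt_trans (_ : B%:E < +oo)%E; last exact: ltry.
apply: le_trans bB; apply: ge0_le_integral => //.
- by apply: measurableT_comp => //; exact/measurable_EFinP.
- exact/measurable_EFinP.
Qed.

Lemma Rintegral_dom (D : set R) f b B : measurable D ->
  measurable_fun D f -> (forall x, D x -> `|f x| <= b x) -> measurable_fun D b ->
  (\int[mu]_(x in D) (b x)%:E <= B%:E)%E -> `|\int[mu]_(x in D) f x| <= B.
Proof.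
move=> mD mf fb mb bB; have fi := integrable_dom mD mf fb mb bB.
apply: le_trans (@le_normr_Rintegral _ _ _ mu D f mD fi) _.
rewrite -lee_fin /Rintegral fineK.
  apply: le_trans bB; apply: ge0_le_integral => //.
  - by apply: measurableT_comp => //; exact: measurableT_comp.
  - exact/measurable_EFinP.
rewrite ge0_fin_numE; last by apply: integral_ge0 => x _; rewrite lee_fin.
by have /integrableP[_] := fi.
Qed.

(** The [u n] need not converge; they are only eventually above [f - e]. Fatou's lemma is applied to
    the minimum of [f] and [u n], which does converge to [f]. *)
Lemma fatou_le (f : R -> R) (u : nat -> R -> R) B :
  measurable_fun setT f -> (forall n, measurable_fun setT (u n)) ->
  (forall x, 0 <= f x) -> (forall n x, 0 <= u n x) ->
  (forall (x e : R), 0 < e -> \forall n \near \oo, f x <= u n x + e) ->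
  (forall n, (\int[mu]_x (u n x)%:E <= B%:E)%E) -> (\int[mu]_x (f x)%:E <= B%:E)%E.
Proof.
move=> mf muu f0 u0 fu uB.
pose v n x := Num.min (f x) (u n x).
have v0 n x : 0 <= v n x by rewrite le_min f0 u0.
have mv n : measurable_fun setT (v n) by exact: measurable_minr.
have fv x : limn_einf (fun n => (v n x)%:E) = (f x)%:E.
  apply: (cvg_limn_einf_sup _).1; apply: cvg_EFin; first exact: nearW.
  apply/cvgrPdist_le => e e0; have := fu x e e0; apply: filterS => n fun_.
  rewrite ger0_norm; last by rewrite subr_ge0 ge_min lexx.
  by rewrite /= /v; case: (leP (f x) (u n x)) => _; lra.
have -> : (\int[mu]_x (f x)%:E = \int[mu]_x limn_einf (fun n => (v n x)%:E))%E.
  by apply: eq_integral => x _; rewrite fv.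
apply: le_trans (fatou mu measurableT _ _) _.
- by move=> n; apply: measurable_EFin_fun; exact: mv.
- by move=> n x _; rewrite lee_fin.
rewrite limn_einf_lim; apply: lime_le; first exact: is_cvg_einfs.
apply: nearW => n; apply: le_trans (_ : (\int[mu]_x (v n x)%:E <= _)%E).
  by apply: ereal_inf_lbound; exists n => /=.
apply: le_trans (uB n); apply: ge0_le_int => //.
by move=> x _; rewrite ge_min lexx orbT.
Qed.

Lemma poisson_denom_gt0 (y t x : R) : 0 < y -> 0 < (x - t) ^+ 2 + y ^+ 2.
Proof. by move=> y0; rewrite ltr_wpDl ?sqr_ge0// exprn_gt0. Qed.

Lemma continuous_poisson (y t : R) : 0 < y ->
  continuous (fun x : R => y / ((x - t) ^+ 2 + y ^+ 2)).
Proof.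
move=> y0 x; apply: cvgM; first exact: cvg_cst.
apply: cvgV; first by rewrite gt_eqF// poisson_denom_gt0.
apply: cvgD; last exact: cvg_cst.
have H : (u - t) @[u --> x] --> x - t by apply: cvgB; [exact: cvg_id|exact: cvg_cst].
by rewrite expr2; under eq_fun do rewrite expr2; exact: cvgM.
Qed.

Lemma integral_poisson (y t : R) : 0 < y ->
  (\int[mu]_x (y / ((x - t) ^+ 2 + y ^+ 2))%:E = pi%:E)%E.
Proof.
move=> y0.
pose F x := (x - t) / y : R.
have dF (x : R) : is_derive x (1 : R) F (y^-1).
  have -> : F = (fun x => y^-1 * x + (- (t / y))) by apply/funext => u; rewrite /F; field; exact: lt0r_neq0.
  by apply: is_derive_eq; rewrite subr0 /GRing.scale/= mulr1.
have F'E : derive1 F = fun=> y^-1.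
  by apply/funext => x; rewrite derive1E; exact: derive_val.
transitivity (\int[mu]_x ((((fun x : R => (oneDsqr x)^-1) \o F) * (derive1 F)) x)%:E)%E.
  apply: eq_integral => x _; congr EFin.
  rewrite F'E !fctE /= /F /oneDsqr.
  have y1 : y != 0 by exact: lt0r_neq0.
  have -> : 1 + ((x - t) / y) ^+ 2 = ((x - t) ^+ 2 + y ^+ 2) / y ^+ 2 by field.
  have := lt0r_neq0 (poisson_denom_gt0 t x y0); set D := _ + _ => D0.
  by field; rewrite D0 y1.
rewrite -increasing_ge0_integration_by_substitutionT; first last.
- by move=> x; rewrite invr_ge0 ltW// oneDsqr_gt0.
- exact: continuous_oneDsqrV.
- apply/cvgryPgt => A; exists (A * y + t); split; first exact: num_real.
  by move=> x /= Ax; rewrite /F ltr_pdivlMr// ltrBrDr.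
- apply/cvgrNyPlt => A; exists (A * y + t); split; first exact: num_real.
  by move=> x /= Ax; rewrite /F ltr_pdivrMr// ltrBlDr.
- by move=> x; exact: ex_derive.
- by rewrite F'E; exact: is_cvg_cst.
- by rewrite F'E; exact: is_cvg_cst.
- by rewrite F'E => x; exact: cvg_cst.
- by move=> u v uv; rewrite /F ltr_pM2r ?invr_gt0// ltrD2r.
rewrite ge0_symfun_integralT; first last.
- by move=> x /=; rewrite /oneDsqr sqrrN.
- exact: continuous_oneDsqrV.
- by move=> x; rewrite invr_ge0 ltW// oneDsqr_gt0.
have -> : [set x : R | 0 <= x] = `[0, +oo[%classic.
  by apply/seteqP; split => x /=; rewrite in_itv/= andbT.
rewrite integral0y_oneDsqr -EFinM; congr EFin; by field.
Qed.

Lemma integral_poisson0 (y : R) : 0 < y ->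
  (\int[mu]_x (y / (x ^+ 2 + y ^+ 2))%:E = pi%:E)%E.
Proof. by move=> y0; rewrite -(integral_poisson 0 y0); under eq_integral do rewrite -[X in X ^+ 2]subr0. Qed.

Lemma integral_dom_poisson (g : R -> R) (A K y B : R) : 0 < y -> 0 <= A -> 0 <= K ->
  measurable_fun setT g -> (forall x, 0 <= g x) ->
  (\int[mu]_x (g x)%:E <= B%:E)%E ->
  (\int[mu]_x (A * (y / (x ^+ 2 + y ^+ 2)) + K * g x)%:E <= (A * pi + K * B)%:E)%E.
Proof.
move=> y0 A0 K0 mg g0 gB.
have p0 x : 0 <= y / (x ^+ 2 + y ^+ 2) by rewrite divr_ge0 ?ltW// -[x]subr0 poisson_denom_gt0.
have mp : measurable_fun setT (fun x : R => y / (x ^+ 2 + y ^+ 2)).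
  apply: continuous_measurable_fun => x; have := @continuous_poisson y 0 y0 x.
  by under eq_fun do rewrite subr0.
rewrite ge0_intD//; [|exact: measurable_funM|exact: measurable_funM|by move=> x _; rewrite mulr_ge0|by move=> x _; rewrite mulr_ge0].
by rewrite ge0_intZ// [X in (_ + X <= _)%E]ge0_intZ// integral_poisson0// [in leRHS]EFinD !EFinM leeD2l// lee_wpmul2l.
Qed.

End Integrals.

Section LineIntegral.
Variable R : realType.
Local Notation mu := (@lebesgue_measure R).

Lemma ge0_le_inte (D : set R) (f g : R -> \bar R) : measurable D ->
  measurable_fun D f -> measurable_fun D g ->
  (forall x, D x -> (0 <= f x)%E) -> (forall x, D x -> (f x <= g x)%E) ->
  (\int[mu]_(x in D) f x <= \int[mu]_(x in D) g x)%E.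
Proof. by move=> mD mf mg f0 fg; apply: ge0_le_integral. Qed.

(** Only horizontal lines are controlled, but by Tonelli the vertical integrals over [[a, b]] have
    mean at most [N * (b - a)] for abscissas in an interval of length 1. The slack [+ 1] turns this
    into a contradiction without a strict inequality between integrals. *)
Lemma exists_vertical (g : Cplx R -> R) (N T a b : R) :
  (forall z, 0 <= g z) ->
  (forall z, 0 < complex.Im z -> {for z, continuous g}) ->
  (forall y, 0 < y -> (\int[mu]_x (g (x +i* y))%:E <= N%:E)%E) ->
  0 < a -> a <= b ->
  exists2 X : R, T <= X <= T + 1 &
    (\int[mu]_(y in `[a, b]) (g (X +i* y))%:E <= (N * (b - a) + 1)%:E)%E.
Proof.
move=> g0 cg gN a0 ab; apply: contrapT => noX.
have N0 : 0 <= N.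
  by rewrite -lee_fin; apply: le_trans (gN _ a0); apply: integral_ge0 => x _; rewrite lee_fin.
have muab : mu `[a, b] = (b - a)%:E.
  by rewrite lebesgue_measure_itv/= lte_fin; case: ltP => // ba; rewrite (@le_anti _ _ a b) ?ab// subrr.
pose G (p : R * R) := g (p.1 +i* Num.max p.2 a).
have mG : measurable_fun setT G.
  by apply: measurable_continuous2; exact: (@continuous_clamp R R g a a0 cg).
pose D : set (R * R) := `[T, T + 1] `*` `[a, b].
pose h : R * R -> \bar R := (fun p => (G p)%:E) \_ D.
have mh : measurable_fun setT h.
  have mD : measurable D by rewrite /D; exact: measurableX.
  have mE : measurable_fun setT (fun p => (G p)%:E) by exact/measurable_EFinP.
  apply: (measurable_restrictT _ mD).1; exact: measurable_funTS.
have h0 p : (0 <= h p)%E.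
  by rewrite /h patchE; case: ifP => // _; rewrite lee_fin /G.
have mhG : measurable_fun [set: R] (fun y : R => (\int[mu]_x h (x, y))%E).
  by have H := measurable_fun_fubini_tonelli_G (m1:=mu) h mh h0; rewrite /fubini_G in H.
have mhF : measurable_fun [set: R] (fun x : R => (\int[mu]_y h (x, y))%E).
  by have H := measurable_fun_fubini_tonelli_F (m2:=mu) h mh h0; rewrite /fubini_F in H.
pose K := N * (b - a) + 1.
have K0 : 0 <= K by rewrite /K addr_ge0// mulr_ge0// subr_ge0.
have mg y : 0 < y -> measurable_fun setT (fun x : R => g (x +i* y)).
  move=> y0; apply: continuous_measurable_fun => x.
  apply: (@continuous_comp _ _ _ (fun x : R => (x +i* y : Cplx R)) g); last exact: cg.
  by apply: continuous_cplx; [exact: cvg_id|exact: cst_continuous].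
have U : (\int[mu]_y \int[mu]_x h (x, y) <= (N * (b - a))%:E)%E.
  have -> : (N * (b - a))%:E = (\int[mu]_y (N * \1_`[a, b]%classic y)%:E)%E.
    by rewrite ge0_intZ// integral_indic// setIT EFinM; congr (_ * _)%E; exact: esym muab.
  apply: ge0_le_inte => //.
  - by apply: measurable_EFin_fun; exact: measurable_funM.
  - by move=> y _; exact: integral_ge0.
  - move=> y _; rewrite indicE; have [yab|yab] := boolP (y \in `[a, b]%classic).
      rewrite mulr1; have y0 : 0 < y by move: yab; rewrite inE/= in_itv/= => /andP[/(lt_le_trans a0)].
      apply: le_trans (gN y y0); apply: ge0_le_inte => //.
      + exact: (measurable_fun_pair1 y mh).
      + exact: measurable_EFin_fun (mg _ y0).
      + move=> x _; rewrite /h patchE; case: ifPn => [|_]; last by rewrite lee_fin.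
        by rewrite inE => -[_ /=]; rewrite in_itv/= => /andP[ay _]; rewrite /G /= max_l.
    rewrite mulr0; rewrite (_ : (\int[mu]_x h (x, y))%E = 0%E)//; apply: integral0_eq => x _.
    by rewrite /h patchE in_setX (negbTE yab) andbF.
have L : (K%:E <= \int[mu]_x \int[mu]_y h (x, y))%E.
  have -> : K%:E = (\int[mu]_x (K * \1_`[T, T + 1]%classic x)%:E)%E.
    rewrite ge0_intZ// integral_indic// setIT -[LHS]mule1; congr (_ * _)%E.
    rewrite /= lebesgue_measure_itv/= lte_fin ltrDl ltr01.
    by rewrite -EFinD addrAC subrr add0r.
  apply: ge0_le_inte => //.
  - by apply: measurable_EFin_fun; exact: measurable_funM.
  - by move=> x _; rewrite lee_fin mulr_ge0.
  - move=> x _; rewrite indicE; have [xT|_] := boolP (x \in `[T, T + 1]%classic); last by rewrite mulr0; exact: integral_ge0.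
    rewrite mulr1 leNgt; apply/negP => lt; apply: noX; exists x.
      by move: xT; rewrite inE/= in_itv.
    apply/ltW; suff -> : (\int[mu]_(y in `[a, b]) (g (x +i* y))%:E = \int[mu]_y h (x, y))%E by [].
    rewrite integral_mkcond; apply: eq_integral => y _.
    rewrite /h !patchE in_setX xT/=; case: ifPn => // yab.
    rewrite /G/= max_l//; move: yab; rewrite inE/= in_itv/= => /andP[//].
have E : (\int[mu]_x \int[mu]_y h (x, y) = \int[mu]_y \int[mu]_x h (x, y))%E.
  by have H := fubini_tonelli (m1:=mu) (m2:=mu) h mh h0; exact H.
have := L; rewrite E => /le_trans/(_ U).
by rewrite lee_fin /K gerDl leNgt ltr01.
Qed.

End LineIntegral.

Section LineIntegral.
Variable R : realType.
Local Notation mu := (@lebesgue_measure R).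
Variables (F : Cplx R -> Cplx R) (S : seq (Cplx R)) (g : Cplx R -> R) (C N rho : R).
Hypothesis cF : forall z, 0 < complex.Im z -> {for z, continuous F}.
Hypothesis dF : forall z, 0 < complex.Im z -> z \notin S -> cdiff F z.
Hypothesis g0 : forall z, 0 <= g z.
Hypothesis cg : forall z, 0 < complex.Im z -> {for z, continuous g}.
Hypothesis gN : forall y : R, 0 < y -> (\int[mu]_x (g (x +i* y))%:E <= N%:E)%E.
Hypothesis C0 : 0 <= C.
Hypothesis rho0 : 0 < rho.
Hypothesis FC : forall z, 0 < complex.Im z -> rho <= normc z ->
  normc (F z) <= C * (1 + g z) / normc z ^+ 2.

Lemma measurable_hline (G : Cplx R -> R) (y : R) : 0 < y ->
  (forall z, 0 < complex.Im z -> {for z, continuous G}) ->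
  measurable_fun setT (fun x : R => G (x +i* y)).
Proof.
move=> y0 cG; apply: continuous_measurable_fun => x.
apply: (@continuous_comp _ _ _ (fun x : R => (x +i* y : Cplx R)) G); last exact: cG.
by apply: continuous_cplx; [exact: cvg_id|exact: cst_continuous].
Qed.

Lemma measurable_Re_hline (y : R) : 0 < y ->
  measurable_fun setT (fun x : R => complex.Re (F (x +i* y))).
Proof. by move=> y0; apply: continuous_measurable_fun; exact: continuous_Re_hline. Qed.

Let N0 : 0 <= N.
Proof.
by rewrite -lee_fin; apply: le_trans (gN ltr01); apply: integral_ge0 => x _; rewrite lee_fin.
Qed.

(** Both [x ^+ 2] and [k ^+ 2] are at most [|z|^2], hence [1 / |z|^2 <= 2 / (x^2 + k^2)], a Poisson
    kernel of known integral. A large [k] makes the total of order [1 / k]. *)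
Lemma FC_poisson (x y k : R) : 0 < y -> 0 < k -> rho <= normc (x +i* y : Cplx R) ->
  k ^+ 2 <= normc (x +i* y : Cplx R) ^+ 2 ->
  normc (F (x +i* y)) <= 2 * C / k * (k / (x ^+ 2 + k ^+ 2)) + C / k ^+ 2 * g (x +i* y).
Proof.
move=> y0 k0 hr hk; apply: le_trans (FC _ hr) _ => //.
set z : Cplx R := x +i* y; have gz := g0 z.
have n0 : 0 < normc z ^+ 2 by apply: lt_le_trans hk; rewrite exprn_gt0.
have k20 : 0 < k ^+ 2 by rewrite exprn_gt0.
have xk : 0 < x ^+ 2 + k ^+ 2 by rewrite ltr_wpDl ?sqr_ge0.
have xz : x ^+ 2 <= normc z ^+ 2 by rewrite normc_sqr /= lerDl sqr_ge0.
have -> : C * (1 + g z) / normc z ^+ 2 = C / normc z ^+ 2 + C * g z / normc z ^+ 2.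
  by rewrite mulrDr mulr1 mulrDl.
apply: lerD.
  have -> : 2 * C / k * (k / (x ^+ 2 + k ^+ 2)) = C * (2 / (x ^+ 2 + k ^+ 2)).
    by field; rewrite ?gt_eqF// lt0r_neq0.
  rewrite ler_wpM2l// -[X in X <= _]mul1r ler_pdivrMr// mulrAC ler_pdivlMr// mul1r.
  by rewrite /z; lra.
rewrite [leRHS]mulrAC ler_wpM2l ?mulr_ge0//.
by rewrite lef_pV2 ?posrE.
Qed.

Lemma line_integrable (d : R) : 0 < d ->
  mu.-integrable setT (EFin \o (fun x : R => complex.Re (F (x +i* d)))).
Proof.
move=> d0.
have [M M0 HM] := rectangle_bounded (- rho) rho d d0 cF.
pose k := Num.min 1 rho.
have k0 : 0 < k by rewrite lt_min ltr01.
have kr : k <= rho by rewrite ge_min lexx orbT.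
(* The first summand covers [|x| <= rho], where only [|F| <= M] is known and
   [x^2 + k^2 <= rho^2 + k^2]; the second comes from [FC_poisson]. *)
pose A := M * (rho ^+ 2 + k ^+ 2) / k + 2 * C / k.
have A1 : 0 <= M * (rho ^+ 2 + k ^+ 2) / k.
  by rewrite divr_ge0 ?(ltW k0)// mulr_ge0 ?(ltW M0)// addr_ge0 ?sqr_ge0.
apply: (@integrable_dom _ setT _ (fun x => A * (k / (x ^+ 2 + k ^+ 2)) + C / k ^+ 2 * g (x +i* d))).
- by [].
- exact: measurable_Re_hline.
- move=> x _; apply: le_trans (Re_le_normc _) _.
  have xk : 0 < x ^+ 2 + k ^+ 2 by rewrite ltr_wpDl ?sqr_ge0// exprn_gt0.
  have p0 : 0 <= k / (x ^+ 2 + k ^+ 2) by rewrite divr_ge0 ?ltW.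
  have q0 : 0 <= C / k ^+ 2 * g (x +i* d) by rewrite mulr_ge0// divr_ge0// sqr_ge0.
  have [xr|xr] := lerP `|x| rho.
    apply: le_trans (HM x d _ _) _; rewrite ?lexx -?ler_norml//.
    apply: le_trans (_ : A * (k / (x ^+ 2 + k ^+ 2)) <= _); last by rewrite lerDl.
    apply: le_trans (_ : M * (rho ^+ 2 + k ^+ 2) / k * (k / (x ^+ 2 + k ^+ 2)) <= _).
      have -> : M * (rho ^+ 2 + k ^+ 2) / k * (k / (x ^+ 2 + k ^+ 2)) =
          M * ((rho ^+ 2 + k ^+ 2) / (x ^+ 2 + k ^+ 2)).
        by field; rewrite ?gt_eqF// lt0r_neq0.
      rewrite ler_pMr// ler_pdivlMr// mul1r lerD2r -real_normK ?num_real//.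
      by rewrite ler_sqr ?nnegrE// ltW.
    by rewrite ler_wpM2r// /A lerDl divr_ge0 ?mulr_ge0// ltW.
  apply: le_trans (@FC_poisson x d k _ _ _ _) _ => //.
  + by apply: le_trans (Re_le_normc _); exact: ltW.
  + rewrite ler_pXn2r ?nnegrE ?normc_ge0 ?(ltW k0)//; apply: le_trans kr _.
    by apply: le_trans (Re_le_normc _); exact: ltW.
  + by rewrite lerD2r ler_wpM2r// /A lerDr.
- apply: measurable_funD; last by apply: measurable_funM => //; exact: measurable_hline.
  apply: measurable_funM => //; apply: continuous_measurable_fun => x.
  by have := @continuous_poisson R k 0 k0 x; under eq_fun do rewrite subr0.
- apply: integral_dom_poisson (gN d0) => //; last exact: measurable_hline.
  + by rewrite /A addr_ge0// divr_ge0 ?mulr_ge0 ?(ltW k0).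
  + by rewrite divr_ge0 ?sqr_ge0.
Qed.

Lemma tail_bound (D : set R) (y k : R) : measurable D -> 0 < y -> 0 < k ->
  (forall x : R, D x -> rho <= normc (x +i* y : Cplx R) /\
     k ^+ 2 <= normc (x +i* y : Cplx R) ^+ 2) ->
  `|\int[mu]_(x in D) complex.Re (F (x +i* y))| <= 2 * C / k * pi + C / k ^+ 2 * N.
Proof.
move=> mD y0 k0 H.
have mb : measurable_fun setT (fun x : R => 2 * C / k * (k / (x ^+ 2 + k ^+ 2)) + C / k ^+ 2 * g (x +i* y)).
  apply: measurable_funD; last by apply: measurable_funM => //; exact: measurable_hline.
  apply: measurable_funM => //; apply: continuous_measurable_fun => x.
  by have := @continuous_poisson R k 0 k0 x; under eq_fun do rewrite subr0.
apply: (@Rintegral_dom _ _ _ (fun x => 2 * C / k * (k / (x ^+ 2 + k ^+ 2)) + C / k ^+ 2 * g (x +i* y))) => //.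
- by apply: measurable_funTS; exact: measurable_Re_hline.
- by move=> x /H[h1 h2]; apply: le_trans (Re_le_normc _) _; exact: FC_poisson.
- exact: measurable_funTS.
- apply: le_trans (ge0_subset_integral mu mD measurableT _ _ _) _ => //.
  + exact: measurable_EFin_fun.
  + move=> x _; rewrite lee_fin addr_ge0// mulr_ge0// divr_ge0 ?mulr_ge0 ?sqr_ge0 ?(ltW k0)//.
    by rewrite addr_ge0 ?sqr_ge0.
  + apply: integral_dom_poisson (gN y0) => //; last exact: measurable_hline.
    * by rewrite divr_ge0 ?mulr_ge0// ltW.
    * by rewrite divr_ge0 ?sqr_ge0.
Qed.

Lemma vertical_bound (X a b B : R) : 0 < a -> a <= b -> 0 < `|X| -> rho <= `|X| ->
  (\int[mu]_(y in `[a, b]) (g (X +i* y))%:E <= B%:E)%E ->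
  `|seg (fun y : R => complex.Im (F (X +i* y))) a b| <= C / X ^+ 2 * (b - a + B).
Proof.
move=> a0 ab X0 rX gB; rewrite -(real_normK (num_real X)).
pose G (y : R) := g (X +i* Num.max y a).
have mG : measurable_fun setT G.
  apply: continuous_measurable_fun => y.
  apply: (@continuous_comp _ _ _ (fun y : R => (X +i* Num.max y a : Cplx R)) g).
    apply: continuous_cplx; first exact: cst_continuous.
    by apply: (@continuous_max R R id (cst a)); [exact: cvg_id|exact: cvg_cst].
  by apply: cg => /=; rewrite lt_max a0 orbT.
have GE y : y \in `[a, b]%classic -> G y = g (X +i* y).
  by rewrite inE/= in_itv/= => /andP[ay _]; rewrite /G max_l.
have G0 y : 0 <= G y by exact: g0.
have k0 : 0 <= C / `|X| ^+ 2 by rewrite divr_ge0 ?sqr_ge0.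
apply: (@Rintegral_dom _ _ _ (fun y => C / `|X| ^+ 2 * (1 + G y))) => //.
- have H := measurable_int _ (seg_integrable (@vline_in R F cF X a b a0)).
  have H' : measurable_fun `[a, b] (fun y : R => (complex.Im (F (X +i* y)))%:E) by exact H.
  exact/measurable_EFinP.
- move=> y yab; have y0 : 0 < y by move: yab; rewrite /= in_itv/= => /andP[/(lt_le_trans a0)].
  have Xz : `|X| <= normc (X +i* y : Cplx R).
    exact: (Re_le_normc (X +i* y)).
  apply: le_trans (Im_le_normc _) _; apply: le_trans (FC _ _) _ => //.
    exact: le_trans Xz.
  rewrite GE ?inE// mulrAC ler_wpM2r ?addr_ge0// ler_wpM2l// lef_pV2 ?posrE ?exprn_gt0//.
    by rewrite ler_pXn2r ?nnegrE ?normc_ge0 ?(ltW X0).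
  exact: lt_le_trans Xz.
- by apply: measurable_funTS; apply: measurable_funM => //; exact: measurable_funD.
- have mG' : measurable_fun `[a, b] G by exact: measurable_funTS.
  rewrite ge0_intZ//; [|exact: measurable_funD|by move=> y _; rewrite addr_ge0].
  rewrite [leRHS]EFinM lee_wpmul2l ?lee_fin// ge0_intD// EFinD leeD//.
    rewrite integral_cst//= lebesgue_measure_itv/= lte_fin.
    by case: ltP => //= ba; rewrite ?mule0 ?mul1e// lee_fin subr_ge0.
  apply: le_trans gB; rewrite le_eqVlt; apply/orP; left; apply/eqP.
  by apply: eq_integral => y yab; rewrite GE.
Qed.

Lemma line_integral_eq0 (d : R) : 0 < d ->
  \int[mu]_x complex.Re (F (x +i* d)) = 0.
Proof.
move=> d0.
(* The first two summands come from the top side at height [Y] and from the part of the line outside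
   the contour, the last from the two vertical sides, each at most [C * (2 + N) / Y]. *)
pose K := 4 * C * pi + 2 * C * N + 2 * C * (2 + N).
have K0 : 0 <= K by rewrite /K !addr_ge0 ?mulr_ge0 ?pi_ge0 ?addr_ge0.
suff H Y : Num.max 1 (Num.max rho d) <= Y -> `|\int[mu]_x complex.Re (F (x +i* d))| <= K / Y.
  apply/eqP; rewrite -normr_le0; apply/ler_addgt0Pr => e e0; rewrite add0r.
  pose Y := Num.max (K / e) (Num.max 1 (Num.max rho d)).
  have Y0 : 0 < Y by rewrite !lt_max ltr01 orbT.
  apply: le_trans (H Y _) _; first by rewrite le_max lexx orbT.
  by rewrite ler_pdivrMr// -ler_pdivrMl// mulrC le_max lexx.
rewrite !ge_max => /and3P[Y1 Yr Yd].
have Y0 : 0 < Y by exact: lt_le_trans Y1.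
(* Starting at [- Y - 1] leaves room for the unit interval, so that [X1 <= - Y] whatever abscissa is
   found. *)
have [X1 /andP[X1a X1b] HX1] := exists_vertical (- Y - 1) g0 cg gN d0 Yd.
have [X2 /andP[X2a X2b] HX2] := exists_vertical Y g0 cg gN d0 Yd.
have X12 : X1 <= X2 by lra.
have iF := line_integrable d0.
have zero := goursat cF d0 X12 Yd dF.
have split : \int[mu]_x complex.Re (F (x +i* d)) =
    seg (fun x : R => complex.Re (F (x +i* d))) X1 X2 +
    \int[mu]_(x in ~` `[X1, X2]) complex.Re (F (x +i* d)).
  rewrite /seg -(setUv `[X1, X2]) Rintegral_setU//.
  - exact: measurableC.
  - by rewrite setUv.
  - by rewrite disj_set2E setICr.
have tail : `|\int[mu]_(x in ~` `[X1, X2]) complex.Re (F (x +i* d))| <= 2 * C / Y * pi + C / Y ^+ 2 * N.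
  apply: tail_bound => //; first exact: measurableC.
  move=> x /=; rewrite in_itv/= => /negP; rewrite negb_and -!ltNge => xX.
  have Yx : Y <= normc (x +i* d : Cplx R).
    apply: le_trans (Re_le_normc _) => /=; rewrite ler_normr.
    by case/orP: xX => ?; apply/orP; [right|left]; lra.
  by split; [exact: le_trans Yx|rewrite ler_pXn2r ?nnegrE ?normc_ge0 ?(ltW Y0)].
have top : `|seg (fun x : R => complex.Re (F (x +i* Y))) X1 X2| <= 2 * C / Y * pi + C / Y ^+ 2 * N.
  apply: tail_bound => // x _.
  have Yx : Y <= normc (x +i* Y : Cplx R).
    by apply: le_trans (Im_le_normc _); exact: ler_norm.
  by split; [exact: le_trans Yx|rewrite ler_pXn2r ?nnegrE ?normc_ge0 ?(ltW Y0)].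
have vert X : Y <= `|X| -> (\int[mu]_(y in `[d, Y]) (g (X +i* y))%:E <= (N * (Y - d) + 1)%:E)%E ->
    `|seg (fun y : R => complex.Im (F (X +i* y))) d Y| <= C / Y ^+ 2 * (Y * (2 + N)).
  move=> YX HX; apply: le_trans (vertical_bound d0 Yd _ (le_trans Yr YX) HX) _.
    exact: lt_le_trans YX.
  rewrite -(real_normK (num_real X)).
  apply: ler_pM.
  - by rewrite divr_ge0 ?sqr_ge0.
  - by rewrite addr_ge0 ?subr_ge0// addr_ge0// mulr_ge0// subr_ge0.
  - rewrite ler_wpM2l// lef_pV2 ?posrE ?exprn_gt0//.
      by rewrite ler_pXn2r ?nnegrE ?(ltW Y0).
    by rewrite (lt_le_trans Y0).
  - have : N * (Y - d) <= N * Y by rewrite ler_wpM2l// gerBl ltW.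
    by lra.
have YX1 : Y <= `|X1| by rewrite ler_normr; apply/orP; right; lra.
have YX2 : Y <= `|X2| by rewrite ler_normr; apply/orP; left; lra.
have v1 := vert X1 YX1 HX1; have v2 := vert X2 YX2 HX2.
have {}zero : seg (fun x : R => complex.Re (F (x +i* d))) X1 X2 =
    seg (fun x : R => complex.Re (F (x +i* Y))) X1 X2 +
    seg (fun y : R => complex.Im (F (X2 +i* y))) d Y -
    seg (fun y : R => complex.Im (F (X1 +i* y))) d Y.
  by move: zero; rewrite /rect_int; lra.
rewrite split zero.
apply: le_trans (ler_normD _ _) _; apply: le_trans (lerD (ler_normB _ _) tail) _.
apply: le_trans (lerD (lerD (ler_normD _ _) v1) (lexx _)) _.
apply: le_trans (lerD (lerD (lerD top v2) (lexx _)) (lexx _)) _.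
have YN : C / Y ^+ 2 * N <= C * N / Y.
  rewrite mulrAC ler_wpM2l ?mulr_ge0// lef_pV2 ?posrE ?exprn_gt0//.
  by rewrite expr2 ler_pMl.
have -> : K / Y = 2 * (2 * C / Y * pi + C * N / Y) + 2 * (C / Y ^+ 2 * (Y * (2 + N))).
  by rewrite /K; field; exact: lt0r_neq0.
by lra.
Qed.

End LineIntegral.

(** * Rational functions and their kernels *)

Section Polynomials.
Variable R : realType.
Local Notation C := (complex R).
Local Notation mu := (@lebesgue_measure R).
Implicit Types (A B : {poly C}) (z w : Cplx R).

Lemma normc_sum (I : Type) (s : seq I) (f : I -> Cplx R) :
  normc (\sum_(i <- s) f i) <= \sum_(i <- s) normc (f i).
Proof.
elim/big_ind2 : _ => [|x a y b xa yb|//]; first by rewrite normc0.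
by apply: le_trans (normc_triangle _ _) _; exact: lerD.
Qed.

Lemma poly_upper A n : (size A <= n.+1)%N ->
  exists2 K : R, 0 < K & forall z, normc A.[z] <= K * (1 + normc z) ^+ n.
Proof.
move=> sA; exists (1 + \sum_(i < n.+1) normc (A`_i : Cplx R)).
  by rewrite ltr_wpDr// sumr_ge0// => i _; exact: normc_ge0.
move=> z; rewrite (horner_coef_wide _ sA); apply: le_trans (normc_sum _ _) _.
have z1 : 1 <= 1 + normc z by rewrite lerDl normc_ge0.
rewrite mulrDl mul1r mulr_suml -[leLHS]add0r; apply: lerD.
  by rewrite exprn_ge0// addr_ge0// normc_ge0.
apply: ler_sum => i _; rewrite normcM normcX ler_wpM2l ?normc_ge0//.
apply: le_trans (_ : (1 + normc z) ^+ i <= _); last by rewrite ler_weXn2l// -ltnS.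
by apply: lerXn2r; rewrite ?nnegrE ?lerDr ?addr_ge0 ?normc_ge0.
Qed.

Lemma poly_lipschitz A n : (size A <= n.+1)%N ->
  exists2 K : R, 0 < K & forall z w, normc w <= 1 ->
    normc (A.[z + w] - A.[z]) <= K * normc w * (1 + normc z) ^+ n.
Proof.
elim: n A => [|n IH] A sA.
  exists 1 => // z w _; rewrite (size1_polyC sA) !hornerC subrr normc0.
  by rewrite !mulr_ge0 ?normc_ge0// exprn_ge0// addr_ge0 ?normc_ge0.
have [A' [c AE]] : exists A' c, A = A' * 'X + c%:P.
  elim/poly_ind: A {sA} => [|A' c _]; last by exists A', c.
  by exists 0, 0; rewrite mul0r addr0.
have sA' : (size A' <= n.+1)%N.
  have [->|A'0] := eqVneq A' 0; first by rewrite size_poly0.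
  by move: sA; rewrite AE size_MXaddC (negbTE A'0).
have [K K0 HK] := IH A' sA'; have [K' K'0 HK'] := poly_upper sA'.
exists (2 * K + K' * 2 ^+ n + K'); first by rewrite !addr_gt0 ?mulr_gt0 ?exprn_gt0.
move=> z w w1; rewrite AE !hornerMXaddC.
have -> : A'.[z + w] * (z + w) + c - (A'.[z] * z + c) =
  (A'.[z + w] - A'.[z]) * (z + w) + A'.[z] * w by ring.
have z0 := normc_ge0 z; have w0 := normc_ge0 w.
have zw : normc (z + w) <= 1 + normc z by apply: le_trans (normc_triangle _ _) _; lra.
have zn : 0 <= (1 + normc z) ^+ n by rewrite exprn_ge0// addr_ge0.
apply: le_trans (normc_triangle _ _) _; rewrite !normcM exprS.
apply: le_trans (_ : K * normc w * (1 + normc z) ^+ n * (1 + normc z) +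
    K' * (1 + normc z) ^+ n * normc w <= _).
  apply: lerD; first by rewrite ler_pM ?normc_ge0// HK.
  by rewrite ler_wpM2r// HK'.
have h1 : 0 <= normc w * (1 + normc z) ^+ n by rewrite mulr_ge0.
have h2 : 0 <= normc w * (1 + normc z) ^+ n * normc z by rewrite mulr_ge0.
have h3 : 0 <= (2 : R) ^+ n by rewrite exprn_ge0.
set t := normc w * (1 + normc z) ^+ n in h1 h2.
have -> : K * normc w * (1 + normc z) ^+ n * (1 + normc z) + K' * (1 + normc z) ^+ n * normc w =
   K * (t + t * normc z) + K' * t by rewrite /t; ring.
have -> : (2 * K + K' * 2 ^+ n + K') * normc w * ((1 + normc z) * (1 + normc z) ^+ n) =
   (2 * K + K' * 2 ^+ n + K') * (t + t * normc z) by rewrite /t; ring.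
set s := t * normc z in h2 *.
apply: le_trans (_ : (2 * K + K') * (t + s) <= _).
  by nra.
rewrite ler_wpM2r ?addr_ge0// lerD2r lerDl mulr_ge0//.
by rewrite ltW.
Qed.

Definition root_list B : seq C := sval (closed_field_poly_normal B).

Lemma root_listE B : B = lead_coef B *: \prod_(b <- root_list B) ('X - b%:P).
Proof. by rewrite /root_list; case: closed_field_poly_normal. Qed.

Lemma mem_root_list B b : B != 0 -> (b \in root_list B) = root B b.
Proof.
by move=> B0; rewrite [B in RHS]root_listE rootZ ?lead_coef_eq0// root_prod_XsubC.
Qed.

Lemma size_root_list B : B != 0 -> (size (root_list B)).+1 = size B.
Proof.
by move=> B0; rewrite [B in RHS]root_listE size_scale ?lead_coef_eq0// size_prod_XsubC.
Qed.

Lemma poly_lower B (E : Cplx R -> Prop) (d : R) : B != 0 -> 0 < d ->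
  (forall z b, E z -> root B b -> d <= normc (z - b)) ->
  exists2 k : R, 0 < k & forall z, E z -> k * (1 + normc z) ^+ (size B).-1 <= normc B.[z].
Proof.
move=> B0 d0 H.
have {H}H z : E z -> {in root_list B, forall b, d <= normc (z - b)}.
  by move=> Ez b; rewrite mem_root_list// => /H; exact.
have -> : (size B).-1 = size (root_list B) by rewrite -size_root_list.
suff [k k0 Hk] : exists2 k : R, 0 < k & forall z, E z ->
    k * (1 + normc z) ^+ size (root_list B) <=
    normc (\prod_(b <- root_list B) (z - b)).
  exists (normc (lead_coef B : Cplx R) * k).
    by rewrite mulr_gt0// normc_gt0 lead_coef_eq0.
  move=> z /Hk Hz; rewrite [B in B.[_]]root_listE hornerZ horner_prod.
  under eq_bigr do rewrite hornerXsubC.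
  by rewrite normcM -mulrA ler_wpM2l ?normc_ge0.
elim: (root_list B) H => [|b s IH] H.
  by exists 1 => // z _; rewrite big_nil normc1 mulr1.
have [|k k0 Hk] := IH; first by move=> z Ez c cs; apply: H => //; rewrite inE cs orbT.
(* From [1 + |z| <= |z - b| + (1 + |b|)] and [1 <= |z - b| / d] follows [1 + |z| <= |z - b| / e]. *)
pose e := (1 + (1 + normc (b : Cplx R)) / d)^-1.
have e0 : 0 < e by rewrite invr_gt0 ltr_wpDr// divr_ge0 ?addr_ge0 ?normc_ge0// ltW.
exists (e * k); first by rewrite mulr_gt0.
move=> z Ez; rewrite big_cons normcM exprS.
have -> : e * k * ((1 + normc z) * (1 + normc z) ^+ size s) =
    (e * (1 + normc z)) * (k * (1 + normc z) ^+ size s) by ring.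
have z0 : 0 <= 1 + normc z by rewrite addr_ge0// normc_ge0.
apply: ler_pM => //; [by rewrite mulr_ge0// ltW|by rewrite mulr_ge0 ?exprn_ge0// ltW| |exact: Hk].
rewrite /e mulrC ler_pdivrMr; last by rewrite -invr_gt0.
have db : d <= normc (z - b) by apply: H => //; rewrite inE eqxx.
have := normc_triangle (z - b) b; rewrite subrK => zb.
rewrite mulrDr mulr1 [leLHS]addrC.
have : 1 + normc (b : Cplx R) <= normc (z - b) * ((1 + normc (b : Cplx R)) / d).
  by rewrite mulrCA ler_peMr ?addr_ge0 ?normc_ge0// ler_pdivlMr// mul1r.
by lra.
Qed.

Lemma far_from_roots B : B != 0 ->
  exists2 r : R, 1 <= r & forall z b, r <= normc z -> root B b -> 1 <= normc (z - b).
Proof.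
move=> B0; have : forall b, root B b -> b \in root_list B by move=> b; rewrite mem_root_list.
(* [root B] is generalized to an arbitrary predicate, which the induction restricts to the points
   other than the head of the list. *)
elim: (root_list B) (root B) => [|c s IH] Q HQ; first by exists 1 => // z b _ /HQ.
have [|r r1 Hr] := IH (fun b => Q b && (b != c)).
  by move=> b /andP[/HQ]; rewrite inE => /orP[/eqP->|//]; rewrite eqxx.
exists (Num.max r (1 + normc (c : Cplx R))); first by rewrite le_max r1.
move=> z b; rewrite ge_max => /andP[rz cz] Qb.
have [->|bc] := eqVneq b c; first by have := normc_sub_ge z (c : Cplx R); lra.
by apply: Hr => //; rewrite Qb.
Qed.

Lemma far_from_real_roots B : B != 0 -> (forall b, root B b -> complex.Im b != 0) ->
  exists2 d : R, 0 < d & forall z b, `|complex.Im z| <= d -> root B b -> d <= normc (z - b).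
Proof.
move=> B0 BR.
suff [d d0 Hd] : exists2 d : R, 0 < d & forall b, root B b -> 2 * d <= `|complex.Im b|.
  exists d => // z b zd /Hd bd; apply: le_trans (Im_le_normc _).
  by rewrite ImB distrC; apply: le_trans (lerB_dist _ _); lra.
have : forall b, root B b -> (b \in root_list B) && (complex.Im b != 0).
  by move=> b rb; rewrite mem_root_list// rb BR.
elim: (root_list B) (root B) => [|c s IH] Q HQ; first by exists 1 => // b /HQ.
have [|d d0 Hd] := IH (fun b => Q b && (b != c)).
  by move=> b /andP[/HQ/andP[]]; rewrite inE => /orP[/eqP->|->->//]; rewrite eqxx.
have [Qc|Qc] := boolP (Q c); last first.
  exists d => // b Qb; apply: Hd; rewrite Qb; apply: contraNneq Qc => <-; exact: Qb.
have /andP[_ Ic] := HQ c Qc.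
exists (Num.min d (`|complex.Im c| / 2)); first by rewrite lt_min d0 divr_gt0// normr_gt0.
move=> b Qb; rewrite -ler_pdivlMl// mulrC.
have [->|bc] := eqVneq b c; first by rewrite ge_min lexx orbT.
by have := Hd b; rewrite Qb bc => /(_ isT) h; rewrite ge_min; apply/orP; left; lra.
Qed.

(** The degrees differ by at least two, which gives the quadratic decay that makes the quotient
    integrable on lines. *)
Lemma rat_bound A B n (E : Cplx R -> Prop) (d : R) : (size A <= n.+1)%N -> size B = n.+3 ->
  0 < d -> (forall z b, E z -> root B b -> d <= normc (z - b)) ->
  exists2 K : R, 0 < K & forall z, E z -> normc (A.[z] / B.[z]) <= K / (1 + normc z) ^+ 2.
Proof.
move=> sA sB d0 H.
have B0 : B != 0 by rewrite -size_poly_eq0 sB.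
have [K K0 HK] := poly_upper sA; have [k k0 Hk] := poly_lower B0 d0 H.
exists (K / k); first by rewrite divr_gt0.
move=> z Ez; rewrite normcM normcV.
have := Hk z Ez; rewrite sB /= => Bz.
have z0 : 0 < 1 + normc z by rewrite ltr_wpDr// normc_ge0.
have Bz0 : 0 < normc B.[z] by apply: lt_le_trans Bz; rewrite mulr_gt0// exprn_gt0.
rewrite ler_pdivrMr//; apply: le_trans (HK z) _.
have -> : K * (1 + normc z) ^+ n = K / k / (1 + normc z) ^+ 2 * (k * (1 + normc z) ^+ n.+2).
  have -> : (1 + normc z) ^+ n.+2 = (1 + normc z) ^+ n * (1 + normc z) ^+ 2.
    by rewrite -exprD addn2.
  by field; rewrite !lt0r_neq0.
by rewrite ler_wpM2l// divr_ge0 ?divr_ge0 ?exprn_ge0 ?(ltW K0) ?(ltW k0) ?(ltW z0).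
Qed.

(** Over the common denominator [B.[z + w] * B.[z]], of degree [2 n + 4], the numerator grows like
    [d] times a power [2 n + 2] of [1 + |x|]. What remains is integrable in [x], with integral of
    order [d]: this lets a line descend to the real axis. *)
Lemma rat_perturb A B n : (size A <= n.+1)%N -> size B = n.+3 ->
  (forall b, root B b -> complex.Im b != 0) ->
  exists2 d0 : R, 0 < d0 & exists2 K : R, 0 < K & forall x d : R, 0 <= d <= d0 ->
    B.[x +i* d] != 0 /\
    normc (A.[x +i* d] / B.[x +i* d] - A.[x +i* 0] / B.[x +i* 0]) <= K * d / (x ^+ 2 + 1).
Proof.
move=> sA sB BR.
have B0 : B != 0 by rewrite -size_poly_eq0 sB.
have [d d0 Hd] := far_from_real_roots B0 BR.
have [K1 K10 HK1] := poly_upper sA; have [K2 K20 HK2] := poly_lipschitz sA.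
have sB' : (size B <= n.+3)%N by rewrite sB.
have [K3 K30 HK3] := poly_upper sB'; have [K4 K40 HK4] := poly_lipschitz sB'.
have [k k0 Hk] := poly_lower (E := fun z => `|complex.Im z| <= d) B0 d0 Hd.
rewrite sB /= in Hk.
exists (Num.min d 1); first by rewrite lt_min d0 ltr01.
pose K := (K2 * K3 + K1 * K4) / (k * k).
have K0 : 0 < K by rewrite divr_gt0 ?addr_gt0 ?mulr_gt0.
exists K => // x e /andP[e0]; rewrite le_min => /andP[ed e1].
pose z : Cplx R := x +i* 0; pose w : Cplx R := 0 +i* e.
have zwE : (x +i* e : Cplx R) = z + w by apply/eqP; rewrite eq_complex/= addr0 add0r !eqxx.
have nw : normc w = e by rewrite /w /= expr0n add0r sqrtr_sqr ger0_norm.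
have nz : normc z = `|x| by rewrite /z normc_real.
have zw : normc z <= normc (z + w) by rewrite nz -zwE; exact: (Re_le_normc (x +i* e)).
pose T := 1 + normc z; have T0 : 0 < T by rewrite /T ltr_wpDr// normc_ge0.
have Bz : k * T ^+ n.+2 <= normc B.[z] by apply: Hk => /=; rewrite normr0 ltW.
have Bzw : k * T ^+ n.+2 <= normc B.[z + w].
  apply: le_trans (Hk _ _); last by rewrite -zwE /= ger0_norm.
  apply: ler_wpM2l; first exact: ltW.
  by apply: lerXn2r; rewrite ?nnegrE /T ?lerD2l ?addr_ge0 ?normc_ge0.
have kT : 0 < k * T ^+ n.+2 by rewrite mulr_gt0 ?exprn_gt0.
have Bz0 : B.[z] != 0 by rewrite -normc_gt0 (lt_le_trans kT).
have Bzw0 : B.[z + w] != 0 by rewrite -normc_gt0 (lt_le_trans kT).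
rewrite zwE; split => //.
have -> : A.[z + w] / B.[z + w] - A.[z] / B.[z] =
    ((A.[z + w] - A.[z]) * B.[z] - A.[z] * (B.[z + w] - B.[z])) / (B.[z + w] * B.[z]).
  by field; rewrite Bz0 Bzw0.
have w1 : normc w <= 1 by rewrite nw.
rewrite normcM normcV normcM ler_pdivrMr ?mulr_gt0 ?(lt_le_trans kT)//.
apply: le_trans (_ : (K2 * K3 + K1 * K4) * e * T ^+ (n + n.+2) <= _).
  apply: le_trans (normc_triangle _ _) _; rewrite normcN !normcM.
  apply: le_trans (_ : K2 * e * T ^+ n * (K3 * T ^+ n.+2) + K1 * T ^+ n * (K4 * e * T ^+ n.+2) <= _).
    by apply: lerD; apply: ler_pM; rewrite ?normc_ge0 -?nw ?HK1 ?HK2 ?HK3 ?HK4.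
  by rewrite exprD le_eqVlt; apply/orP; left; apply/eqP; ring.
have x2 : x ^+ 2 + 1 <= T ^+ 2.
  by rewrite /T nz sqrrD expr1n mul1r real_normK ?num_real// addrC addrAC lerDl mulrn_wge0.
have x0 : 0 < x ^+ 2 + 1 by rewrite ltr_wpDl ?sqr_ge0.
apply: le_trans (_ : K * e / (x ^+ 2 + 1) * (k * T ^+ n.+2 * (k * T ^+ n.+2)) <= _); last first.
  apply: ler_wpM2l; last by apply: ler_pM => //; exact: ltW.
  by apply: divr_ge0; [apply: mulr_ge0 => //; exact: ltW|exact: ltW].
have -> : K * e / (x ^+ 2 + 1) * (k * T ^+ n.+2 * (k * T ^+ n.+2)) =
    (K2 * K3 + K1 * K4) * e * T ^+ (n + n.+2) * (T ^+ 2 / (x ^+ 2 + 1)).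
  have -> : T ^+ n.+2 = T ^+ n * T ^+ 2 by rewrite -exprD addn2.
  rewrite exprD; have -> : T ^+ n.+2 = T ^+ n * T ^+ 2 by rewrite -exprD addn2.
  by rewrite /K; field; rewrite !lt0r_neq0.
rewrite ler_peMr//; last by rewrite ler_pdivlMr// mul1r.
rewrite !mulr_ge0 ?exprn_ge0 ?(ltW T0)//.
by rewrite addr_ge0 ?mulr_ge0// ltW.
Qed.

End Polynomials.

Section RationalLine.
Variable R : realType.
Local Notation C := (complex R).
Local Notation mu := (@lebesgue_measure R).
Implicit Types (A B : {poly C}) (z w : Cplx R).

Lemma cdiff_rat A B z : B.[z] != 0 -> cdiff (fun z : Cplx R => A.[z] / B.[z] : Cplx R) z.
Proof.
by move=> Bz; apply: cdiffM; [exact: cdiff_horner|apply: cdiffV => //; exact: cdiff_horner].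
Qed.

Lemma far_bound (K : R) (z : Cplx R) : 0 <= K -> 1 <= normc z ->
  K / (1 + normc z) ^+ 2 <= K / normc z ^+ 2.
Proof.
move=> K0 z1; have z0 : 0 < normc z by exact: lt_le_trans z1.
rewrite ler_wpM2l// lef_pV2 ?posrE ?exprn_gt0//; last by rewrite addr_gt0.
by rewrite lerXn2r ?nnegrE ?addr_ge0 ?(ltW z0)// lerDr.
Qed.

Lemma rat_line_Re A B n : (size A <= n.+1)%N -> size B = n.+3 ->
  (forall b, root B b -> complex.Im b <= 0) -> forall y : R, 0 < y ->
  mu.-integrable setT (EFin \o (fun x : R => complex.Re (A.[x +i* y] / B.[x +i* y]))) /\
  \int[mu]_x complex.Re (A.[x +i* y] / B.[x +i* y]) = 0.
Proof.
move=> sA sB BR y y0.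
have B0 : B != 0 by rewrite -size_poly_eq0 sB.
have Bz z : 0 < complex.Im z -> B.[z] != 0.
  by move=> z0; apply/negP => /BR; rewrite leNgt z0.
have [rho rho1 Hrho] := far_from_roots B0.
have rho0 : 0 < rho by exact: lt_le_trans rho1.
have [K K0 HK] := rat_bound (E := fun z => rho <= normc z) sA sB ltr01 Hrho.
pose F (z : Cplx R) : Cplx R := A.[z] / B.[z].
have dF z : 0 < complex.Im z -> z \notin [::] -> cdiff F z.
  by move=> z0 _; apply: cdiff_rat; exact: Bz.
have cF z : 0 < complex.Im z -> {for z, continuous F}.
  by move=> z0; apply: cdiff_continuous; exact: dF.
have FC z : 0 < complex.Im z -> rho <= normc z ->
    normc (F z) <= K * (1 + (fun=> 0 : R) z) / normc z ^+ 2.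
  move=> _ rz; rewrite addr0 mulr1; apply: le_trans (HK z rz) _.
  by apply: far_bound; [exact: ltW|exact: le_trans rz].
have g0 (t : R) : 0 < t -> (\int[mu]_x (0 : R)%:E <= (0 : R)%:E)%E.
  by move=> _; rewrite integral0.
have cg z : 0 < complex.Im z -> {for z, continuous (fun _ : Cplx R => 0 : R)}.
  by move=> _; exact: cst_continuous.
split.
  exact: (line_integrable cF (fun=> lexx _) cg g0 (ltW K0) rho0 FC y0).
exact: (line_integral_eq0 cF dF (fun=> lexx _) cg g0 (ltW K0) rho0 FC y0).
Qed.

Lemma measurable_rat_real A B : (forall b, root B b -> complex.Im b != 0) ->
  measurable_fun setT (fun x : R => complex.Re (A.[x +i* 0] / B.[x +i* 0])).
Proof.
move=> BR; apply: continuous_measurable_fun => x.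
have Bx : B.[(x +i* 0 : Cplx R)] != 0.
  by apply/negP => /BR /=; rewrite eqxx.
apply: (@continuous_comp _ _ _ (fun x : R => (A.[x +i* 0] / B.[x +i* 0] : Cplx R)) (@complex.Re R)); last first.
  exact: continuous_Re.
apply: (@continuous_comp _ _ _ (fun x : R => (x +i* 0 : Cplx R)) (fun z : Cplx R => A.[z] / B.[z] : Cplx R)).
  by apply: continuous_cplx; [exact: cvg_id|exact: cst_continuous].
by apply: cdiff_continuous; exact: cdiff_rat.
Qed.

Lemma poisson1_ge0 (x : R) : 0 <= 1 / (x ^+ 2 + 1 ^+ 2).
Proof. by rewrite divr_ge0// addr_ge0 ?sqr_ge0. Qed.

Lemma measurable_poisson1 : measurable_fun setT (fun x : R => 1 / (x ^+ 2 + 1 ^+ 2)).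
Proof.
apply: continuous_measurable_fun => x.
by have := @continuous_poisson R 1 0 ltr01 x; under eq_fun do rewrite subr0.
Qed.

Lemma rat_real_integrable A B n : (size A <= n.+1)%N -> size B = n.+3 ->
  (forall b, root B b -> complex.Im b != 0) ->
  mu.-integrable setT (EFin \o (fun x : R => complex.Re (A.[x +i* 0] / B.[x +i* 0]))).
Proof.
move=> sA sB BR.
have B0 : B != 0 by rewrite -size_poly_eq0 sB.
have [d d0 Hd] := far_from_real_roots B0 BR.
have [K K0 HK] := rat_bound (E := fun z => `|complex.Im z| <= d) sA sB d0 Hd.
apply: (@integrable_dom _ setT _ (fun x => K * (1 / (x ^+ 2 + 1 ^+ 2))) (K * pi)) => //.
- exact: measurable_rat_real.
- move=> x _; apply: le_trans (Re_le_normc _) _; apply: le_trans (HK _ _) _.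
    by rewrite /= normr0 ltW.
  have p1 : 0 < 1 + `|x| by rewrite ltr_wpDr.
  have p2 : 0 < x ^+ 2 + 1 ^+ 2 by rewrite expr1n ltr_wpDl ?sqr_ge0.
  rewrite mul1r ler_wpM2l ?(ltW K0)// normc_real lef_pV2 ?posrE ?exprn_gt0//.
  by rewrite sqrrD mul1r real_normK ?num_real// addrC lerD2r lerDl mulrn_wge0.
- by apply: measurable_funM => //; exact: measurable_poisson1.
- rewrite ge0_intZ//; [|exact: measurable_poisson1|by move=> x _; exact: poisson1_ge0|exact: ltW].
  by rewrite integral_poisson0.
Qed.

(** With all poles strictly below the axis, the integral vanishes at every height [d > 0], and by
    [rat_perturb] lowering the line to the axis changes it by at most a multiple of [d]. *)
Lemma rat_line_real A B n : (size A <= n.+1)%N -> size B = n.+3 ->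
  (forall b, root B b -> complex.Im b < 0) ->
  \int[mu]_x complex.Re (A.[x +i* 0] / B.[x +i* 0]) = 0.
Proof.
move=> sA sB BR.
have BR' b : root B b -> complex.Im b != 0 by move=> /BR /ltr0_neq0.
have [d0 d00 [K K0 HK]] := rat_perturb sA sB BR'.
have i0 := rat_real_integrable sA sB BR'.
apply/eqP; rewrite -normr_le0; apply/ler_addgt0Pr => e e0; rewrite add0r.
pose d := Num.min d0 (e / (K * pi)).
have Kpi : 0 < K * pi by rewrite mulr_gt0// pi_gt0.
have dp : 0 < d by rewrite lt_min d00 divr_gt0.
have [i1 z1] := rat_line_Re sA sB (fun b h => ltW (BR b h)) dp.
rewrite -[X in `|X|]subr0 -[X in `|_ - X|]z1 -RintegralB//.
apply: (@Rintegral_dom _ _ _ (fun x => K * d * (1 / (x ^+ 2 + 1 ^+ 2)))) => //.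
- apply: measurable_funB; first exact: measurable_rat_real.
  apply: (@measurable_Re_hline R (fun z : Cplx R => A.[z] / B.[z] : Cplx R)) => // z z0.
  apply: cdiff_continuous; apply: cdiff_rat.
  by apply/negP => /BR; rewrite ltNge (ltW z0).
- move=> x _; rewrite -ReB; apply: le_trans (Re_le_normc _) _; rewrite normcB mul1r expr1n.
  by apply: (HK x d _).2; rewrite (ltW dp) ge_min lexx.
- by apply: measurable_funM => //; exact: measurable_poisson1.
- rewrite ge0_intZ//; [|exact: measurable_poisson1|by move=> x _; exact: poisson1_ge0|].
    rewrite integral_poisson0// -EFinM lee_fin mulrAC -ler_pdivlMl// mulrC.
    by rewrite ge_min lexx orbT.
  by rewrite mulr_ge0 ?ltW.
Qed.

End RationalLine.

Section RationalKernels.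
Variable R : realType.
Local Notation C := (complex R).
Local Notation mu := (@lebesgue_measure R).
Variables (P Q : {poly C}) (m : nat) (c : R).
Hypothesis sQ : size Q = m.+1.
Hypothesis c0 : 0 < c.
Hypothesis sPQ : (size (P - c%:C *: ('X * Q))%R <= m.+1)%N.
Hypothesis selfPQ : forall z : Cplx R, 0 < complex.Im z -> 0 < complex.Im (P.[z] / Q.[z] : Cplx R).
Implicit Types (z w v : Cplx R).

Lemma cC_neq0 : (c%:C : C) != 0.
Proof. by rewrite eq_complex /= negb_and (lt0r_neq0 c0). Qed.

Lemma Q_neq0 : Q != 0.
Proof. by rewrite -size_poly_eq0 sQ. Qed.

Lemma size_cXQ : size (c%:C *: ('X * Q)) = m.+2.
Proof. by rewrite size_scale ?cC_neq0// mulrC size_mulX ?Q_neq0// sQ. Qed.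

Lemma size_PvQ v : size (P - v *: Q) = m.+2.
Proof.
rewrite -(subrK (c%:C *: ('X * Q)) P) addrAC addrC size_polyDl size_cXQ// ltnS.
apply: leq_trans (size_polyD _ _) _; rewrite geq_max sPQ size_polyN.
by apply: leq_trans (size_scale_leq _ _) _; rewrite sQ.
Qed.

Lemma PvQ_neq0 v : P - v *: Q != 0.
Proof. by rewrite -size_poly_eq0 size_PvQ. Qed.

Lemma Q_upper z : 0 < complex.Im z -> Q.[z] != 0.
Proof.
by move=> /selfPQ; apply: contraTneq => ->; rewrite invr0 mulr0 ltxx.
Qed.

Lemma root_PvQ_upper v z : 0 < complex.Im z -> root (P - v *: Q) z -> P.[z] / Q.[z] = v.
Proof.
move=> z0; rewrite /root hornerD hornerN hornerZ subr_eq0 => /eqP ->.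
by rewrite mulfK// Q_upper.
Qed.

(* [Anum v / Bden v] is [1 / (r - v) - c^-1 / (z - v)]: the leading terms cancel,
   so that it is integrable on lines and Cauchy's theorem applies to it. *)
Definition Anum v : {poly C} := ('X - v%:P) * Q - (c%:C)^-1 *: (P - v *: Q).
Definition Bden v : {poly C} := (P - v *: Q) * ('X - v%:P).

Lemma size_Anum v : (size (Anum v) <= m.+1)%N.
Proof.
have -> : Anum v = - (c%:C)^-1 *: (P - c%:C *: ('X * Q)) - (v - (c%:C)^-1 * v) *: Q.
  rewrite /Anum -!mul_polyC !polyCN polyCB !polyCM.
  have : (c%:C)^-1%:P * (c%:C)%:P = 1 :> {poly C} by rewrite -polyCM mulVf ?cC_neq0.
  set a := _%:P; set b := _%:P => ab.
  transitivity (('X - v%:P) * Q - a * (P - v%:P * Q) + (a * b - 1) * 'X * Q).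
    by rewrite ab subrr !mul0r addr0.
  ring.
apply: leq_trans (size_polyD _ _) _; rewrite geq_max size_polyN; apply/andP; split.
  exact: leq_trans (size_scale_leq _ _) sPQ.
by apply: leq_trans (size_scale_leq _ _) _; rewrite sQ.
Qed.

Lemma size_Bden v : size (Bden v) = m.+3.
Proof. by rewrite size_mul ?PvQ_neq0 ?polyXsubC_eq0// size_PvQ size_XsubC addn2. Qed.

Lemma Anum_Bden v z : (P - v *: Q).[z] != 0 -> z != v -> Q.[z] != 0 ->
  (Anum v).[z] / (Bden v).[z] = (P.[z] / Q.[z] - v)^-1 - (c%:C)^-1 / (z - v).
Proof.
move=> PQ zv Qz.
have zv0 : z - v != 0 by rewrite subr_eq0.
have rv : P.[z] / Q.[z] - v = (P - v *: Q).[z] / Q.[z].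
  by rewrite !(hornerE, hornerZ) /= mulrBl mulfK.
rewrite rv invf_div /Anum /Bden !(hornerM, hornerD, hornerN, hornerZ, hornerX, hornerC) in PQ *.
move: PQ; set p := P.[z] - v * Q.[z] => PQ.
by field; rewrite PQ zv0 cC_neq0.
Qed.

Lemma int_eq_add (phi D p : R -> R) (L : R) :
  (forall x, phi x = D x + p x) -> mu.-integrable setT (EFin \o D) ->
  \int[mu]_x D x = 0 -> measurable_fun setT p -> (forall x, 0 <= p x) ->
  (\int[mu]_x (p x)%:E = L%:E)%E ->
  mu.-integrable setT (EFin \o phi) /\ (\int[mu]_x (phi x)%:E = L%:E)%E.
Proof.
move=> phiE iD D0 mp p0 pL.
have ip : mu.-integrable setT (EFin \o p).
  apply: (@integrable_dom _ setT _ p L) => //; last by rewrite pL.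
  by move=> x _; rewrite ger0_norm.
have -> : phi = (fun x => D x + p x) by apply/funext.
split; first by have := integrableD measurableT iD ip.
have -> : (\int[mu]_x (D x + p x)%:E = \int[mu]_x (D x)%:E + \int[mu]_x (p x)%:E)%E.
  by have := integralD_EFin measurableT iD ip.
rewrite pL; have -> : (\int[mu]_x (D x)%:E = 0)%E.
  by rewrite -[LHS]fineK ?integrable_fin_num//; congr EFin.
by rewrite add0e.
Qed.

(** The Cauchy theorem for lines is stated for real parts; the factor ['i] makes it yield imaginary
    parts. *)
Lemma Im_iC z : complex.Re ('i%C * z) = - complex.Im z.
Proof. by rewrite ReM /= mul0r mul1r sub0r. Qed.

Lemma Im_inv_real z (t : R) :
  complex.Im (z - t%:C)^-1 = - (complex.Im z / normc (z - t%:C) ^+ 2).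
Proof. by rewrite Im_inv ImB /= subr0 mulNr. Qed.

Lemma Im_cV_inv (x y : R) v : complex.Im ((c%:C)^-1 / ((x +i* y) - v)) =
  - (c^-1 * ((y - complex.Im v) / ((x - complex.Re v) ^+ 2 + (y - complex.Im v) ^+ 2))).
Proof.
rewrite -fmorphV ImM /= mul0r addr0.
by rewrite Im_inv normc_sqr ImB ReB /= mulNr mulrN.
Qed.

(** For real [v = t] the imaginary part of [Anum v / Bden v] is, up to sign, the integrand minus
    [c^-1] times a Poisson kernel. Since [r] never takes a real value in the upper half-plane, no
    pole lies there and this difference integrates to 0. *)
Lemma integral_pullback (t y : R) : 0 < y ->
  (\int[mu]_x (complex.Im (P.[x +i* y] / Q.[x +i* y] : Cplx R) /
      normc (P.[x +i* y] / Q.[x +i* y] - t%:C : Cplx R) ^+ 2)%:E = (c^-1 * pi)%:E)%E.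
Proof.
move=> y0; pose v : Cplx R := t%:C.
have BR b : root (Bden v) b -> complex.Im b <= 0.
  rewrite rootM root_XsubC => /orP[rb|/eqP->//]; rewrite leNgt; apply/negP => b0.
  by have := selfPQ b0; rewrite (root_PvQ_upper b0 rb) ltxx.
have sA : (size ('i%C *: Anum v) <= m.+1)%N.
  exact: leq_trans (size_scale_leq _ _) (size_Anum v).
have [iD D0] := rat_line_Re sA (size_Bden v) BR y0.
have p0 x : 0 <= c^-1 * (y / ((x - t) ^+ 2 + y ^+ 2)).
  by rewrite mulr_ge0 ?invr_ge0 ?divr_ge0 ?(ltW c0) ?(ltW y0)// ltW// poisson_denom_gt0.
have mp : measurable_fun setT (fun x : R => y / ((x - t) ^+ 2 + y ^+ 2)).
  by apply: continuous_measurable_fun; exact: continuous_poisson.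
refine (proj2 (@int_eq_add _ _ (fun x => c^-1 * (y / ((x - t) ^+ 2 + y ^+ 2))) (c^-1 * pi) _ iD D0 _ p0 _)).
- move=> x; have z0 : 0 < complex.Im (x +i* y : Cplx R) by [].
  rewrite hornerZ -mulrA Im_iC Anum_Bden; first last.
  + exact: Q_upper.
  + by apply/negP => /eqP zv; move: z0; rewrite zv ltxx.
  + apply/negP => rb; have /BR : root (Bden v) (x +i* y) by rewrite rootM /root rb.
    by rewrite leNgt y0.
  by rewrite ImB Im_inv_real Im_cV_inv /= subr0; ring.
- exact: measurable_funM.
- by rewrite ge0_intZ ?integral_poisson// ?invr_ge0 ?(ltW c0)// => x _; rewrite divr_ge0 ?(ltW y0)// ltW// poisson_denom_gt0.
Qed.

Section Inner.
Hypothesis copPQ : coprimep P Q.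
Hypothesis realPQ : forall x : R, Q.[(x +i* 0 : Cplx R)] != 0 ->
  complex.Im (P.[(x +i* 0 : Cplx R)] / Q.[(x +i* 0 : Cplx R)]) = 0.

(* [kfun w] is [1 / ((r - w) (r - conj w))], cleared of the poles of [r] so that it
   takes its correct value 0 there; it is [|r - w|^-2] on the real line. *)
Definition kden w : {poly C} := (P - w *: Q) * (P - w^* *: Q).
Definition kfun w z : Cplx R := (Q * Q).[z] / (kden w).[z].
Definition kker w (x : R) : R := complex.Re (kfun w (x +i* 0)).

Lemma size_QQ : (size (Q * Q)%R <= (m + m).+1)%N.
Proof. by rewrite size_mul ?Q_neq0// sQ addSn /= addnS. Qed.

Lemma size_kden w : size (kden w) = (m + m).+3%N.
Proof. by rewrite size_mul ?PvQ_neq0// !size_PvQ !addSn /= !addnS. Qed.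

Lemma P_neq0_at_root z : Q.[z] = 0 -> P.[z] != 0.
Proof.
move=> Qz; apply/negP => Pz; have := coprimep_root copPQ Pz.
by rewrite Qz eqxx.
Qed.

(** At a pole [P - v *: Q] reduces to [P], which is nonzero there by coprimality; elsewhere [r] is
    real and [v] is not. *)
Lemma real_not_root v (x : R) : complex.Im v != 0 -> ~~ root (P - v *: Q) (x +i* 0).
Proof.
move=> v0; rewrite /root hornerD hornerN hornerZ subr_eq0; apply/negP => /eqP E.
have [Qx|Qx] := eqVneq Q.[(x +i* 0 : Cplx R)] 0.
  by have := P_neq0_at_root Qx; rewrite E Qx mulr0 eqxx.
by have := realPQ Qx; rewrite E mulfK// => /eqP; rewrite (negbTE v0).
Qed.

Lemma kden_root_real w b : complex.Im w != 0 -> root (kden w) b -> complex.Im b != 0.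
Proof.
case: b => x y w0; rewrite rootM /=; have [->|//] := eqVneq y 0.
rewrite (negbTE (real_not_root x w0)) (negbTE (@real_not_root w^* x _))//.
by case: w w0 => a b /=; rewrite oppr_eq0.
Qed.

Lemma kfunE w (x : R) : complex.Im w != 0 -> Q.[(x +i* 0 : Cplx R)] != 0 ->
  kfun w (x +i* 0) =
  ((normc (P.[(x +i* 0 : Cplx R)] / Q.[(x +i* 0 : Cplx R)] - w) ^+ 2)^-1)%:C.
Proof.
move=> w0 Qx; have := realPQ Qx.
have := real_not_root x w0; have := @real_not_root w^* x.
rewrite /root /kfun /kden !(hornerM, hornerD, hornerN, hornerZ).
set p := P.[_] in Qx *; set q := Q.[_] in Qx *.
set t := p / q; have pE : p = t * q by rewrite /t divfK.
clearbody t; rewrite pE => h1 h2 t0.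
have -> : t * q - w * q = (t - w) * q by ring.
have -> : t * q - w^* * q = (t - w^*) * q by ring.
have qq : q * q != 0 by rewrite mulf_neq0.
have -> : (t - w) * q * ((t - w^*) * q) = (t - w) * (t - w^*) * (q * q) by ring.
rewrite invfM mulrCA divff// mulr1 fmorphV; congr (_^-1).
move: t0; case: t {h1 h2 pE} => a b /= ->; case: w w0 => u v v0 /=.
rewrite sub0r sqr_sqrtr ?addr_ge0 ?sqr_ge0// sqrrN.
by apply/eqP; rewrite eq_complex /=; apply/andP; split; apply/eqP; ring.
Qed.

Lemma kfun0 w (x : R) : Q.[(x +i* 0 : Cplx R)] = 0 -> kfun w (x +i* 0) = 0.
Proof. by move=> Qx; rewrite /kfun hornerM Qx mul0r mul0r. Qed.

Lemma kfun_real w (x : R) : complex.Im w != 0 -> kfun w (x +i* 0) = (kker w x)%:C.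
Proof.
move=> w0; rewrite /kker; have [Qx|Qx] := eqVneq Q.[(x +i* 0 : Cplx R)] 0.
  by rewrite kfun0.
by rewrite kfunE.
Qed.

Lemma kker_ge0 w (x : R) : complex.Im w != 0 -> 0 <= kker w x.
Proof.
move=> w0; rewrite /kker; have [Qx|Qx] := eqVneq Q.[(x +i* 0 : Cplx R)] 0.
  by rewrite kfun0.
by rewrite kfunE//= invr_ge0 sqr_ge0.
Qed.

Lemma kker_le w (x : R) : complex.Im w != 0 ->
  kker w x <= (normc (P.[(x +i* 0 : Cplx R)] / Q.[(x +i* 0 : Cplx R)] - w) ^+ 2)^-1.
Proof.
move=> w0; rewrite /kker; have [Qx|Qx] := eqVneq Q.[(x +i* 0 : Cplx R)] 0.
  by rewrite kfun0//= invr_ge0 sqr_ge0.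
by rewrite kfunE.
Qed.

Lemma measurable_kker w : complex.Im w != 0 -> measurable_fun setT (kker w).
Proof. by move=> w0; apply: measurable_rat_real => b; exact: kden_root_real. Qed.

(** Here [v] is the conjugate of [w]: [r] takes this value neither above the axis nor on it, so all
    poles of [Anum v / Bden v] lie strictly below, and the argument of [integral_pullback] works on
    the axis itself. At a pole of [r] the kernel is 0 and only the Poisson term remains. *)
Lemma integral_kker w : 0 < complex.Im w ->
  (\int[mu]_x (complex.Im w * kker w x)%:E = (c^-1 * pi)%:E)%E.
Proof.
move=> w0; have w0' : complex.Im w != 0 by rewrite gt_eqF.
have wc0 : complex.Im w^* = - complex.Im w by case: w {w0 w0'}.
have wcR : complex.Re w^* = complex.Re w by case: w {w0 w0' wc0}.
have wc0' : complex.Im w^* != 0 by rewrite wc0 oppr_eq0.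
set y := complex.Im w in w0 w0' wc0 *.
have BR b : root (Bden w^*) b -> complex.Im b < 0.
  rewrite rootM root_XsubC => /orP[rb|/eqP->]; last by rewrite wc0 oppr_lt0.
  rewrite ltNge le_eqVlt negb_or; apply/andP; split.
    apply/negP => /eqP b0; move: rb; case: b b0 => u v /= <-.
    by apply/negP; exact: real_not_root.
  apply/negP => b0; have := selfPQ b0; rewrite (root_PvQ_upper b0 rb) wc0.
  by rewrite oppr_gt0 ltNge (ltW w0).
have BR' b : root (Bden w^*) b -> complex.Im b != 0 by move=> /BR/ltr0_neq0.
have sA : (size ('i%C *: Anum w^*) <= m.+1)%N.
  exact: leq_trans (size_scale_leq _ _) (size_Anum _).
have D0 := rat_line_real sA (size_Bden _) BR.
have iD := rat_real_integrable sA (size_Bden _) BR'.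
have p0 x : 0 <= c^-1 * (y / ((x - complex.Re w) ^+ 2 + y ^+ 2)).
  by rewrite mulr_ge0 ?invr_ge0 ?divr_ge0 ?(ltW c0) ?(ltW w0)// ltW// poisson_denom_gt0.
have mp : measurable_fun setT (fun x : R => y / ((x - complex.Re w) ^+ 2 + y ^+ 2)).
  by apply: continuous_measurable_fun; exact: continuous_poisson.
refine (proj2 (@int_eq_add _ _ (fun x => c^-1 * (y / ((x - complex.Re w) ^+ 2 + y ^+ 2))) (c^-1 * pi) _ iD D0 _ p0 _)).
- move=> x; rewrite hornerZ -mulrA Im_iC.
  have xw : (x +i* 0 : Cplx R) != w^*.
    by apply/eqP => E; move: wc0'; rewrite -E eqxx.
  have PQx : (P - w^* *: Q).[(x +i* 0 : Cplx R)] != 0 by exact: real_not_root.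
  have [Qx|Qx] := eqVneq Q.[(x +i* 0 : Cplx R)] 0.
    rewrite /kker kfun0//= mulr0.
    have -> : (Anum w^*).[x +i* 0] / (Bden w^*).[x +i* 0] = - ((c%:C)^-1 / ((x +i* 0) - w^*)).
      move: PQx; rewrite /Anum /Bden !(hornerM, hornerD, hornerN, hornerZ, hornerX, hornerC) Qx.
      rewrite !mulr0 subr0 sub0r => Px.
      have xw0 : (x +i* 0 : Cplx R) - w^* != 0 by rewrite subr_eq0.
      by field; rewrite Px xw0 cC_neq0.
    have ImN (z : Cplx R) : complex.Im (- z) = - complex.Im z by case: z.
    by rewrite ImN Im_cV_inv wc0 wcR sub0r !opprK addNr.
  rewrite Anum_Bden// ImB Im_cV_inv wc0 wcR !sub0r !opprK /kker kfunE//=.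
  rewrite Im_inv ImB realPQ// wc0 sub0r opprK.
  have -> : normc (P.[(x +i* 0 : Cplx R)] / Q.[(x +i* 0 : Cplx R)] - w^*) =
      normc (P.[(x +i* 0 : Cplx R)] / Q.[(x +i* 0 : Cplx R)] - w).
    rewrite -[LHS]normc_conj; congr normc.
    have := realPQ Qx; case: (_ / _) => a b /= ->; case: w {w0 w0' wc0 wcR wc0' y BR BR' sA D0 iD p0 mp xw PQx} => u v.
    by apply/eqP; rewrite eq_complex /=; apply/andP; split; apply/eqP; ring.
  ring.
- exact: measurable_funM.
- by rewrite ge0_intZ ?integral_poisson// ?invr_ge0 ?(ltW c0)// => x _; rewrite divr_ge0 ?(ltW w0)// ltW// poisson_denom_gt0.
Qed.

End Inner.
End RationalKernels.

(** * Kernel averages of p-th powers *)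

Section PowR.
Variable R : realType.
Implicit Types (a s p : R).

(** This is Young's inequality [s * 1 <= s^p / p + 1 / q] for the conjugate exponent [q], multiplied
    by [p]. *)
Lemma powR_bernoulli s p : 0 <= s -> 1 <= p -> p * s <= s `^ p + (p - 1).
Proof.
move=> s0; rewrite le_eqVlt => /predU1P[<-|p1].
  by rewrite powRr1// mul1r subrr addr0.
have p0 : 0 < p by lra.
have q0 : 0 < p - 1 by lra.
have H : p^-1 + (p / (p - 1))^-1 = 1 by field; rewrite !lt0r_neq0.
have := @conjugate_powR R s 1 p (p / (p - 1)) s0 ler01 p0 (divr_gt0 p0 q0) H.
rewrite mulr1 powR1 -(ler_pM2l p0) => /le_trans; apply.
by rewrite le_eqVlt; apply/orP; left; apply/eqP; field; rewrite !lt0r_neq0.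
Qed.

Lemma powR_tangent a s p : 0 < a -> 0 <= s -> 1 <= p ->
  a `^ p + p * a `^ p / a * (s - a) <= s `^ p.
Proof.
move=> a0 s0 p1; have sa : 0 <= s / a by rewrite divr_ge0// ltW.
have := powR_bernoulli sa p1; rewrite -(ler_pM2l (powR_gt0 p a0)) mulrDr.
have E : a * (s / a) = s by rewrite mulrCA divff ?lt0r_neq0// mulr1.
rewrite -powRM ?(ltW a0)// E => H.
have -> : a `^ p + p * a `^ p / a * (s - a) = a `^ p * (p * (s / a)) - a `^ p * (p - 1).
  by field; rewrite lt0r_neq0.
by rewrite lerBlDr.
Qed.

Lemma le_1powR s p : 0 <= s -> 1 <= p -> s <= 1 + s `^ p.
Proof.
move=> s0 p1; have [s1|s1] := leP s 1.
  by apply: le_trans s1 _; rewrite lerDl powR_ge0.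
apply: le_trans (_ : s `^ p <= _); last by rewrite lerDr.
by rewrite -{1}(powRr1 s0) ler_powR// ltW.
Qed.

Lemma powR_le_id s p : 0 <= s <= 1 -> 1 <= p -> s `^ p <= s.
Proof.
move=> /andP[s0 s1] p1; have -> : p = 1 + (p - 1) by rewrite addrC subrK.
rewrite powRD; last by rewrite addrC subrK; apply/implyP => /eqP p0; lra.
rewrite powRr1// ler_piMr//; apply: le_trans (_ : 1 `^ (p - 1) <= _); last by rewrite powR1.
by apply: ge0_ler_powR; rewrite ?nnegrE ?subr_ge0.
Qed.

Lemma continuous_powR_norm p : 1 <= p -> continuous (fun s : R => `|s| `^ p).
Proof.
move=> p1 s; have [->|s0] := eqVneq s 0.
  apply/cvgrPdist_lt => e e0; rewrite normr0 powR0; last by rewrite gt_eqF//; lra.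
  have m0 : 0 < Num.min 1 e by rewrite lt_min ltr01.
  apply/nbhs_ballP; exists (Num.min 1 e) => //= t.
  rewrite /ball/= sub0r normrN lt_min => /andP[t1 te].
  rewrite sub0r normrN ger0_norm ?powR_ge0//; apply: le_lt_trans te.
  by rewrite powR_le_id// normr_ge0 ltW.
have n0 : 0 < `|s| by rewrite normr_gt0.
have cl : {for s, continuous (fun t : R => expR (p * ln `|t|))}.
  apply: (@continuous_comp _ _ _ (fun t : R => p * ln `|t|) expR); last exact: continuous_expR.
  apply: cvgM; first exact: cvg_cst.
  apply: (@continuous_comp _ _ _ (fun t : R => `|t|) (@ln R)); last exact: continuous_ln.
  exact: norm_continuous.
have E : `|s| `^ p = expR (p * ln `|s|) by rewrite /powR gt_eqF.
rewrite /prop_for /continuous_at -E in cl.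
apply: cvg_trans cl; apply: near_eq_cvg; near=> t.
rewrite /powR gt_eqF// normr_gt0; near: t.
apply/nbhs_ballP; exists `|s| => // t; rewrite /ball/= => st.
by apply: contraTneq st => ->; rewrite subr0 ltxx.
Unshelve. all: by end_near. Qed.

Lemma continuous_powR_normc (h : Cplx R -> Cplx R) (z : Cplx R) p : 1 <= p ->
  {for z, continuous h} -> {for z, continuous (fun z => normc (h z) `^ p : R)}.
Proof.
move=> p1 ch.
have -> : (fun z => normc (h z) `^ p) = (fun s : R => `|s| `^ p) \o (@normc R \o h).
  by apply/funext => w /=; rewrite ger0_norm// normc_ge0.
apply: continuous_comp; last exact: continuous_powR_norm.
by apply: continuous_comp => //; exact: continuous_normc.
Qed.

End PowR.

Section Transfer.
Variable R : realType.
Local Notation mu := (@lebesgue_measure R).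

(** Tonelli bounds the integral of the [n]-th average by [L * N], and [fatou_le] removes [n]. The
    bound on [k (s, x)] for fixed [s] makes the inner integral finite, so that its real and extended
    values agree. *)
Lemma kernel_average_integral_le (u : nat -> R -> R) (k : R * R -> R) (Phi : R -> R) (N L : R) :
  (forall n, measurable_fun setT (u n)) -> (forall n x, 0 <= u n x) ->
  measurable_fun setT k -> (forall q, 0 <= k q) ->
  measurable_fun setT Phi -> (forall s, 0 <= Phi s) ->
  0 <= L -> (forall x, (\int[mu]_s (k (s, x))%:E <= L%:E)%E) ->
  (forall n, (\int[mu]_x (u n x)%:E <= N%:E)%E) ->
  (forall s, exists B, forall x, k (s, x) <= B) ->
  (forall s (e : R), 0 < e -> \forall n \near \oo,
     Phi s <= \int[mu]_x (u n x * k (s, x)) + e) ->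
  (\int[mu]_s (Phi s)%:E <= (L * N)%:E)%E.
Proof.
move=> mu_ u0 mk k0 mPhi Phi0 L0 kL uN kB PhiU.
pose f n (q : R * R) : \bar R := (u n q.2 * k q)%:E.
have mf n : measurable_fun setT (f n).
  apply/measurable_EFinP; apply: measurable_funM => //.
  by apply: measurableT_comp => //; exact: measurable_snd.
have f0 n q : (0 <= f n q)%E by rewrite lee_fin mulr_ge0.
have mfF n : measurable_fun [set: R] (fun s : R => (\int[mu]_x f n (s, x))%E).
  by have H := measurable_fun_fubini_tonelli_F (m2:=mu) (f n) (mf n) (f0 n); rewrite /fubini_F in H.
have mks s : measurable_fun setT (fun x => k (s, x)) by exact: (measurable_fun_pair2 s mk).
have mkx x : measurable_fun setT (fun s => k (s, x)) by exact: (measurable_fun_pair1 x mk).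
have ffin n s : (\int[mu]_x f n (s, x))%E = (\int[mu]_x (u n x * k (s, x)))%:E.
  rewrite /Rintegral fineK// ge0_fin_numE; last by apply: integral_ge0 => x _; rewrite lee_fin mulr_ge0.
  have [B HB] := kB s.
  have B0 : 0 <= B by apply: le_trans (HB 0).
  apply: le_lt_trans (_ : (B * N)%:E < +oo)%E; last exact: ltry.
  apply: le_trans (_ : \int[mu]_x (B * u n x)%:E <= _)%E.
    apply: ge0_le_int => //.
    - exact: measurable_funM.
    - exact: measurable_funM.
    - by move=> x _; rewrite mulr_ge0.
    - by move=> x _; rewrite mulrC ler_wpM2r.
  by rewrite ge0_intZ// EFinM lee_wpmul2l ?lee_fin.
apply: (@fatou_le _ Phi (fun n s => \int[mu]_x (u n x * k (s, x)))) => //.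
- move=> n; have -> : (fun s => \int[mu]_x (u n x * k (s, x))) = fine \o (fun s : R => (\int[mu]_x f n (s, x))%E).
    by apply/funext => s /=; rewrite ffin.
  exact: measurableT_comp.
- by move=> n s; apply: Rintegral_ge0 => x _; rewrite mulr_ge0.
- move=> n.
  have -> : (\int[mu]_s (\int[mu]_x (u n x * k (s, x)))%:E = \int[mu]_s \int[mu]_x f n (s, x))%E.
    by apply: eq_integral => s _; rewrite ffin.
  have E : (\int[mu]_s \int[mu]_x f n (s, x) = \int[mu]_x \int[mu]_s f n (s, x))%E.
    by have H := fubini_tonelli (m1:=mu) (m2:=mu) (f n) (mf n) (f0 n); exact H.
  rewrite E; apply: le_trans (_ : \int[mu]_x (L * u n x)%:E <= _)%E; last first.
    by rewrite ge0_intZ// EFinM lee_wpmul2l ?lee_fin.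
  apply: ge0_le_inte => //.
  + by have H := measurable_fun_fubini_tonelli_G (m1:=mu) (f n) (mf n) (f0 n); rewrite /fubini_G in H.
  + by apply: measurable_EFin_fun; exact: measurable_funM.
  + by move=> x _; exact: integral_ge0.
  + move=> x _; rewrite /f /= ge0_intZ// mulrC EFinM lee_wpmul2l ?lee_fin//.
Qed.

End Transfer.

Section KernelAverage.
Variable R : realType.
Local Notation C := (complex R).
Local Notation mu := (@lebesgue_measure R).
Local Notation intR f := (mu.-integrable setT (EFin \o f)).

Lemma intR_D (f g : R -> R) : intR f -> intR g ->
  intR (fun x => f x + g x) /\
  \int[mu]_x (f x + g x) = \int[mu]_x f x + \int[mu]_x g x.
Proof.
move=> fi gi; split; first by have := integrableD measurableT fi gi.
exact: (RintegralD measurableT fi gi).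
Qed.

Lemma intR_Z (k : R) (f : R -> R) : intR f ->
  intR (fun x => k * f x) /\ \int[mu]_x (k * f x) = k * \int[mu]_x f x.
Proof.
move=> fi; split; first by have := integrableZl measurableT k fi.
exact: (RintegralZl k measurableT fi).
Qed.

Lemma intR_ge0 (f : R -> R) (B : R) : measurable_fun setT f -> (forall x, 0 <= f x) ->
  (\int[mu]_x (f x)%:E <= B%:E)%E -> intR f /\ \int[mu]_x f x <= B.
Proof.
move=> mf f0 fB; have fi : intR f.
  by apply: (@integrable_dom _ setT _ f B) => // x _; rewrite ger0_norm.
split=> //; apply: le_trans (ler_norm _) _.
by apply: (@Rintegral_dom _ setT _ f B) => // x _; rewrite ger0_norm.
Qed.

Lemma intR_le (f g : R -> R) : intR f -> intR g -> (forall x, f x <= g x) ->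
  \int[mu]_x f x <= \int[mu]_x g x.
Proof. by move=> fi gi fg; apply: le_Rintegral. Qed.

Variables (P Q : {poly C}) (m : nat).
Hypothesis sQ : size Q = m.+1.
Hypothesis sPQ : (size (P - (1 : R)%:C *: ('X * Q))%R <= m.+1)%N.
Hypothesis selfPQ : forall z : Cplx R, 0 < complex.Im z -> 0 < complex.Im (P.[z] / Q.[z] : Cplx R).
Hypothesis copPQ : coprimep P Q.
Hypothesis realPQ : forall x : R, Q.[(x +i* 0 : Cplx R)] != 0 ->
  complex.Im (P.[(x +i* 0 : Cplx R)] / Q.[(x +i* 0 : Cplx R)]) = 0.
Local Notation r z := (P.[z] / Q.[z] : Cplx R).
Let c1 : (0 : R) < 1 := ltr01.

Variables (f : Cplx R -> Cplx R) (p N : R) (w : Cplx R).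
Hypothesis p1 : 1 <= p.
Hypothesis df : forall z, 0 < complex.Im z -> cdiff f z.
Hypothesis w0 : 0 < complex.Im w.
Local Notation G z := (normc (f (r z)) `^ p).
Hypothesis hN : forall y : R, 0 < y -> (\int[mu]_x (G (x +i* y))%:E <= N%:E)%E.

Let w0' : complex.Im w != 0. Proof. by rewrite gt_eqF. Qed.

Lemma cdiff_r (z : Cplx R) : 0 < complex.Im z -> cdiff (fun z : Cplx R => r z) z.
Proof. by move=> z0; apply: cdiff_rat; exact: (Q_upper selfPQ z0). Qed.

Lemma kfun_upper (z : Cplx R) : 0 < complex.Im z -> r z != w ->
  kfun P Q w z = (r z - w)^-1 * (r z - w^*)^-1.
Proof.
move=> z0 rw; have Qz := Q_upper selfPQ z0.
have rw' : r z != w^*.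
  apply/eqP => E; have := selfPQ z0; rewrite E; case: w w0 => a b /= b0.
  by rewrite oppr_gt0 ltNge (ltW b0).
rewrite /kfun /kden !(hornerM, hornerD, hornerN, hornerZ).
rewrite -subr_eq0 in rw; rewrite -subr_eq0 in rw'; move: rw rw'.
set a := P.[z]; set q := Q.[z] in Qz *.
have -> : a - w * q = (a / q - w) * q by rewrite mulrBl divfK.
have -> : a - w^* * q = (a / q - w^*) * q by rewrite mulrBl divfK.
set s := a / q - w; set t := a / q - w^* => s0 t0.
by field; rewrite s0 t0 Qz.
Qed.

(* The kernel is the boundary value of [1 / ((r - w) (r - conj w))], and
   [(f (r z) - f w) / (r z - w)] is analytic, so by Cauchy's theorem the average
   of [f (r (x + i d))] against it tends to [f w]; a tangent line to the convex
   function [s ^ p] turns this into an inequality between p-th powers. *)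
Lemma powR_le_kernel_average : exists K d0 : R, [/\ 0 < d0, 0 <= K & forall d, 0 < d < d0 ->
  normc (f w) `^ p <=
  \int[mu]_x (G (x +i* d) * (complex.Im w / pi * kker P Q w x)) + K * d].
Proof.
have k0 x := kker_ge0 copPQ realPQ x w0'.
have pi0 : 0 < pi :> R := pi_gt0 R.
have cp0 : 0 < complex.Im w / pi by rewrite divr_gt0.
have G0 z : 0 <= G z by exact: powR_ge0.
set a := normc (f w).
(* The tangent at [a] has slope [p * a ^ p / a], which presupposes that [a] is nonzero; for [a = 0]
   the left-hand side is 0. *)
have [a0|a0] := eqVneq a 0.
  exists 0, 1; split => // d _; rewrite a0 powR0; last by rewrite gt_eqF// (lt_le_trans ltr01).
  rewrite mul0r addr0; apply: Rintegral_ge0 => x _.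
  by apply: mulr_ge0; [exact: G0|apply: mulr_ge0 => //; exact: ltW].
have {}a0 : 0 < a by rewrite lt_def a0 normc_ge0.
have [g cg fg] := df w0.
have fgE z : z != w -> g z = (f z - f w) / (z - w).
  by move=> zw; rewrite (fg z) addrAC subrr add0r mulrAC divff ?mul1r// subr_eq0.
have dg z : 0 < complex.Im z -> z != w -> cdiff g z.
  move=> z0 zw; apply: (@cdiff_near _ (fun z => (f z - f w) / (z - w))).
    apply: cdiffM; first by apply: cdiffB; [exact: df|exact: cdiff_cst].
    apply: cdiffV; first by rewrite subr_eq0.
    by apply: cdiffB; [exact: cdiff_id|exact: cdiff_cst].
  apply/nbhs_cplxP; exists (normc (z - w)); first by rewrite normc_gt0 subr_eq0.
  move=> v; rewrite normcB => vz; rewrite fgE//.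
  by apply: contraTneq vz => ->; rewrite ltxx.
have cgz z : 0 < complex.Im z -> {for z, continuous g}.
  move=> z0; have [->//|zw] := eqVneq z w.
  by apply: cdiff_continuous; exact: dg.
(* [u] rotates [f w] onto the positive axis, so that the real part of [u * (h - f w)] is at most
   [|h| - a]. *)
pose u : Cplx R := (f w)^* / a%:C.
have aC : (a%:C : C) != 0 by rewrite eq_complex /= negb_and (lt0r_neq0 a0).
have nu : normc u = 1.
  by rewrite /u normcM normcV normc_conj normc_real ger0_norm ?divff// ?lt0r_neq0// ltW.
have uf : u * f w = a%:C.
  rewrite /u mulrAC; apply: (mulIf aC); rewrite divfK//.
  have := normc_sqr (f w); rewrite -/a; case: (f w) => b e /= E.
  have -> : a%:C * a%:C = (a ^+ 2)%:C :> C by rewrite expr2 rmorphM.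
  rewrite E; apply/eqP; rewrite eq_complex /=.
  by apply/andP; split; apply/eqP; ring.
clearbody u.
(* Apart from the solutions of [r z = w] this is [u * (f (r z) - f w)] times the kernel. There [g]
   supplies the derivative of [f], but is only known to be continuous; these points form the
   exceptional list [S]. *)
pose F (z : Cplx R) : Cplx R := u * (g (r z) / (r z - w^*)).
have rww z : 0 < complex.Im z -> r z - w^* != 0.
  move=> z0; rewrite subr_eq0; apply/eqP => E; have := selfPQ z0; rewrite E.
  by case: w w0 => b e /= e0; rewrite oppr_gt0 ltNge (ltW e0).
have FE z : 0 < complex.Im z -> r z != w -> F z = u * (f (r z) - f w) * kfun P Q w z.
  by move=> z0 zw; rewrite /F fgE// kfun_upper//; ring.
have cF z : 0 < complex.Im z -> {for z, continuous F}.
  move=> z0; have cr := cdiff_continuous (cdiff_r z0).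
  apply: (ccontM (@ccont_cst _ u z)); apply: ccontM.
    by apply: (ccont_comp cr); apply: cgz; exact: selfPQ.
  by apply: ccontV; [exact: rww|exact: (ccontB cr (@ccont_cst _ _ _))].
pose S := root_list (P - w *: Q).
have PQ0 := PvQ_neq0 sQ c1 sPQ w.
have rS z : 0 < complex.Im z -> z \notin S -> r z != w.
  move=> z0; rewrite mem_root_list//; apply: contraNneq => E.
  have Qz := Q_upper selfPQ z0.
  by rewrite /root hornerD hornerN hornerZ -E divfK// subrr.
have dF z : 0 < complex.Im z -> z \notin S -> cdiff F z.
  move=> z0 zS; have dr := cdiff_r z0.
  apply: cdiffM; first exact: cdiff_cst.
  apply: cdiffM.
    by apply: (cdiff_comp dr); apply: dg; [exact: selfPQ|exact: rS].
  by apply: cdiffV; [exact: rww|apply: cdiffB => //; exact: cdiff_cst].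
have sB := size_kden sQ c1 sPQ w; have sA := size_QQ sQ.
have B0 : kden P Q w != 0 by rewrite -size_poly_eq0 sB.
have [rho rho1 Hrho] := far_from_roots B0.
have rho0 : 0 < rho by exact: lt_le_trans rho1.
have [K1 K10 HK1] := rat_bound (E := fun z => rho <= normc z) sA sB ltr01 Hrho.
have ncG z : normc (f (r z)) <= 1 + G z by apply: le_1powR => //; exact: normc_ge0.
have FC z : 0 < complex.Im z -> rho <= normc z ->
    normc (F z) <= (K1 * (1 + a)) * (1 + G z) / normc z ^+ 2.
  move=> z0 rz; have z1 : 1 <= normc z by exact: le_trans rz.
  have rw : r z != w.
    apply/eqP => E; have Qz := Q_upper selfPQ z0.
    have /Hrho : root (kden P Q w) z.
      by rewrite rootM {1}/root hornerD hornerN hornerZ -E divfK// subrr eqxx.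
    by move=> /(_ z rz); rewrite subrr normc0 ler10.
  rewrite FE// (normcM _ (kfun P Q w z)) (normcM u) nu mul1r.
  have h1 : normc (f (r z) - f w) <= (1 + a) * (1 + G z).
    apply: le_trans (normc_triangle _ _) _; rewrite normcN -/a.
    have := ncG z; have := G0 z; nra.
  apply: le_trans (_ : (1 + a) * (1 + G z) * (K1 / normc z ^+ 2) <= _).
    apply: ler_pM; [exact: normc_ge0|exact: normc_ge0|exact: h1|].
    exact: le_trans (HK1 z rz) (far_bound (ltW K10) z1).
  by rewrite le_eqVlt; apply/orP; left; apply/eqP; ring.
have cG (z : Cplx R) : 0 < complex.Im z ->
    {for z, continuous (fun z : Cplx R => (G z : R))}.
  move=> z0; have cfr : {for z, continuous (fun z : Cplx R => f (r z))} :=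
    ccont_comp (cdiff_continuous (cdiff_r z0)) (cdiff_continuous (df (selfPQ z0))).
  exact: (continuous_powR_normc p1 cfr).
have C0 : 0 <= K1 * (1 + a) by rewrite mulr_ge0 ?addr_ge0 ?ltW.
have [d1 d10 [K2 K20 HK2]] := rat_perturb sA sB (fun b => @kden_root_real R P Q copPQ realPQ w b w0').
pose beta := p * a `^ p / a.
have beta0 : 0 <= beta.
  by rewrite /beta divr_ge0 ?mulr_ge0 ?powR_ge0 ?(ltW a0)// (le_trans ler01).
pose M0 := (1 + a) * pi + N.
have N0 : 0 <= N.
  by rewrite -lee_fin; apply: le_trans (hN ltr01); apply: integral_ge0 => x _; rewrite lee_fin.
have M00 : 0 <= M0.
  by apply: addr_ge0 => //; apply: mulr_ge0; [apply: addr_ge0 => //; exact: ltW|exact: ltW].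
exists (complex.Im w / pi * beta * K2 * M0), d1; split => //.
  by apply: mulr_ge0 => //; apply: mulr_ge0; [apply: mulr_ge0 => //|]; exact: ltW.
move=> d /andP[d0 dd1].
have iF := line_integrable cF (fun z => G0 z) cG hN C0 rho0 FC d0.
have zF := line_integral_eq0 cF dF (fun z => G0 z) cG hN C0 rho0 FC d0.
(* The kernel lives on the axis and [F] at height [d]: replacing one height by the other costs
   [K2 * d / (x^2 + 1)] times [|f (r z) - f w|], which the last term pays. After integration the
   term in [F] disappears by Cauchy's theorem. *)
have ptw x : a `^ p * kker P Q w x + beta * complex.Re (F (x +i* d)) <=
   G (x +i* d) * kker P Q w x + beta * (K2 * d) * ((1 + a) * (1 / (x ^+ 2 + 1 ^+ 2)) + 1 * G (x +i* d)).
  have dd : 0 <= d <= d1 by rewrite (ltW d0) (ltW dd1).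
  have [Bd Hd] := HK2 x d dd.
  have z0 : 0 < complex.Im (x +i* d : Cplx R) by [].
  have rw : r (x +i* d) != w.
    apply/eqP => E; have Qz := Q_upper selfPQ z0.
    move: Bd; rewrite /kden hornerM mulf_eq0 negb_or => /andP[/eqP + _]; apply.
    by rewrite hornerD hornerN hornerZ -E divfK// subrr.
  rewrite FE//; set h := f (r (x +i* d)).
  have -> : kfun P Q w (x +i* d) = (kker P Q w x)%:C +
      (kfun P Q w (x +i* d) - kfun P Q w (x +i* 0)).
    by rewrite (kfun_real copPQ realPQ x w0') addrC subrK.
  rewrite mulrDr ReD ReM /= mulr0 subr0.
  set v := u * (h - f w); set D := kfun P Q w (x +i* d) - _.
  have nv : normc v <= 1 + a + G (x +i* d).
    rewrite /v normcM nu mul1r; apply: le_trans (normc_triangle _ _) _.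
    by rewrite normcN -/a; have := ncG (x +i* d); rewrite -/h; lra.
  have vD : complex.Re (v * D) <= (1 + a + G (x +i* d)) * (K2 * d / (x ^+ 2 + 1)).
    apply: le_trans (ler_norm _) _; apply: le_trans (Re_le_normc _) _.
    by rewrite normcM; apply: ler_pM; rewrite ?normc_ge0.
  have Rv : complex.Re v <= normc h - a.
    rewrite /v mulrBr uf ReB /= lerD2r; apply: le_trans (ler_norm _) _.
    by apply: le_trans (Re_le_normc _) _; rewrite normcM nu mul1r.
  have tg := powR_tangent a0 (normc_ge0 h) p1; rewrite -/beta in tg.
  have s1 : beta * complex.Re v <= G (x +i* d) - a `^ p.
    by apply: le_trans (_ : beta * (normc h - a) <= _); [rewrite ler_wpM2l|rewrite -/h; lra].
  have s2 := ler_wpM2r (k0 x) s1.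
  have s3 := ler_wpM2l beta0 vD.
  have x21 : 0 < x ^+ 2 + 1 by rewrite ltr_wpDl ?sqr_ge0.
  have x22 : (x ^+ 2 + 1)^-1 <= 1 by rewrite invf_le1// lerDr sqr_ge0.
  have s4 : (1 + a + G (x +i* d)) * (K2 * d / (x ^+ 2 + 1)) <=
      (K2 * d) * ((1 + a) * (1 / (x ^+ 2 + 1 ^+ 2)) + 1 * G (x +i* d)).
    rewrite expr1n mul1r; have Kd : 0 <= K2 * d by rewrite mulr_ge0// ltW.
    have -> : (1 + a + G (x +i* d)) * (K2 * d / (x ^+ 2 + 1)) =
       K2 * d * ((1 + a) * (x ^+ 2 + 1)^-1 + G (x +i* d) * (x ^+ 2 + 1)^-1) by ring.
    by rewrite ler_wpM2l// mul1r lerD2l ler_piMr.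
  have s5 := ler_wpM2l beta0 s4.
  rewrite mulrDr; move: s2 s3 s5.
  rewrite mulrBl -mulrA; lra.
have mG : measurable_fun setT (fun x : R => G (x +i* d)).
  exact: (measurable_hline d0 cG).
have mk := measurable_kker copPQ realPQ w0'.
have [iG IG] := intR_ge0 mG (fun x => G0 _) (hN d0).
have iwk : intR (fun x => complex.Im w * kker P Q w x) /\
    \int[mu]_x (complex.Im w * kker P Q w x) = pi.
  have Hk := integral_kker sQ c1 sPQ selfPQ copPQ realPQ w0.
  have [|||i1 _] := @intR_ge0 (fun x => complex.Im w * kker P Q w x) (1^-1 * pi).
  - exact: measurable_funM.
  - by move=> x; rewrite mulr_ge0// ltW.
  - by rewrite Hk.
  by split => //; rewrite /Rintegral Hk /= invr1 mul1r.
have [ik Ik] := intR_Z (complex.Im w)^-1 iwk.1.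
have kE : (fun x => (complex.Im w)^-1 * (complex.Im w * kker P Q w x)) = kker P Q w.
  by apply/funext => x; rewrite mulrA mulVf// mul1r.
rewrite kE iwk.2 in ik Ik.
have kle x : kker P Q w x <= (complex.Im w ^+ 2)^-1.
  apply: le_trans (kker_le copPQ realPQ x w0') _.
  have [Qx|Qx] := eqVneq Q.[(x +i* 0 : Cplx R)] 0.
    rewrite Qx invr0 mulr0 sub0r normcN lef_pV2 ?posrE ?exprn_gt0//.
      by rewrite normc_sqr lerDr sqr_ge0.
    by rewrite normc_gt0; apply: contraTneq w0 => ->; rewrite ltxx.
  have E : complex.Im (r (x +i* 0) - w) = - complex.Im w by rewrite ImB realPQ// sub0r.
  have n0 : 0 < normc (r (x +i* 0) - w).
    by rewrite normc_gt0; apply: contraTneq w0 => E0; move: E; rewrite E0 /= => /eqP; rewrite eq_sym oppr_eq0 => /eqP ->; rewrite ltxx.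
  rewrite lef_pV2 ?posrE ?exprn_gt0// normc_sqr E sqrrN.
  by rewrite lerDr sqr_ge0.
have iGk : intR (fun x => G (x +i* d) * kker P Q w x).
  apply: (@integrable_dom _ setT _ (fun x => (complex.Im w ^+ 2)^-1 * G (x +i* d)) ((complex.Im w ^+ 2)^-1 * N)) => //.
  - exact: measurable_funM.
  - by move=> x _; rewrite ger0_norm ?mulr_ge0// mulrC ler_wpM2r.
  - exact: measurable_funM.
  - by rewrite ge0_intZ ?invr_ge0 ?sqr_ge0// EFinM lee_wpmul2l ?lee_fin ?invr_ge0 ?sqr_ge0// hN.
have [iE IE] : intR (fun x => (1 + a) * (1 / (x ^+ 2 + 1 ^+ 2)) + 1 * G (x +i* d)) /\
    \int[mu]_x ((1 + a) * (1 / (x ^+ 2 + 1 ^+ 2)) + 1 * G (x +i* d)) <= M0.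
  apply: intR_ge0.
  - apply: measurable_funD; apply: measurable_funM => //; exact: measurable_poisson1.
  - by move=> x; rewrite addr_ge0// mulr_ge0 ?poisson1_ge0// addr_ge0// ltW.
  - rewrite /M0 -[N]mul1r; apply: integral_dom_poisson (hN d0) => //.
    by rewrite addr_ge0// ltW.
have [i1 I1] := intR_Z (a `^ p) ik.
have [i2 I2] := intR_Z beta iF.
have [i3 I3] := intR_Z (beta * (K2 * d)) iE.
have [i4 I4] := intR_D i1 i2.
have [i5 I5] := intR_D iGk i3.
have := intR_le i4 i5 ptw.
rewrite I4 I1 I2 Ik zF mulr0 addr0 I5 I3 => H.
have [_ I6] := intR_Z (complex.Im w / pi) iGk.
under eq_Rintegral do rewrite mulrCA.
rewrite I6.
have H' : a `^ p * ((complex.Im w)^-1 * pi) <= \int[mu]_x (G (x +i* d) * kker P Q w x) + beta * (K2 * d) * M0.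
  apply: le_trans H _; rewrite lerD2l; apply: ler_wpM2l => //.
  by apply: mulr_ge0 => //; apply: mulr_ge0; exact: ltW.
have := ler_wpM2l (ltW cp0) H'.
have -> : complex.Im w / pi * (a `^ p * ((complex.Im w)^-1 * pi)) = a `^ p.
  transitivity (a `^ p * (complex.Im w / complex.Im w) * (pi / pi)); first by ring.
  by rewrite !divff ?(lt0r_neq0 pi0)// !mulr1.
move=> /le_trans; apply; rewrite mulrDr lerD2l le_eqVlt; apply/orP; left; apply/eqP; ring.
Qed.

End KernelAverage.

(** * Bounds for composition operators *)

Section HardyBounds.
Variable R : realType.
Local Notation C := (complex R).
Local Notation mu := (@lebesgue_measure R).

Lemma hardy_sup_leP (p : R) (f : Cplx R -> Cplx R) (B : \bar R) :
  (hardy_sup p f <= B)%E <->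
  (forall y : R, 0 < y -> (\int[mu]_x (normc (f (x +i* y)) `^ p)%:E <= B)%E).
Proof.
split=> [H y y0|H]; last by apply: ge_ereal_sup => _ [y /= y0 <-]; exact: H.
by apply: le_trans H; apply: ereal_sup_ubound; exists y.
Qed.

Lemma hardy_sup_ge0 (p : R) (f : Cplx R -> Cplx R) : (0 <= hardy_sup p f)%E.
Proof.
apply: le_trans (_ : \int[mu]_x (normc (f (x +i* 1)) `^ p)%:E <= _)%E.
  by apply: integral_ge0 => x _; rewrite lee_fin powR_ge0.
by apply: ereal_sup_ubound; exists 1 => /=.
Qed.

Section KernelContinuity.
Variables (P Q : {poly C}).
Hypothesis copPQ : coprimep P Q.
Hypothesis realPQ : forall x : R, Q.[(x +i* 0 : Cplx R)] != 0 ->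
  complex.Im (P.[(x +i* 0 : Cplx R)] / Q.[(x +i* 0 : Cplx R)]) = 0.

Lemma kker_le_Im (w : Cplx R) (x : R) : complex.Im w != 0 ->
  kker P Q w x <= (complex.Im w ^+ 2)^-1.
Proof.
move=> w0; apply: le_trans (kker_le copPQ realPQ x w0) _.
have w20 : 0 < complex.Im w ^+ 2 by rewrite exprn_even_gt0.
have E : complex.Im (P.[x +i* 0] / Q.[x +i* 0] - w : Cplx R) ^+ 2 = complex.Im w ^+ 2.
  have [Qx|Qx] := eqVneq Q.[(x +i* 0 : Cplx R)] 0.
    by rewrite Qx invr0 mulr0 sub0r; case: w {w0 w20} => a b /=; rewrite sqrrN.
  by rewrite ImB realPQ// sub0r sqrrN.
have le : complex.Im w ^+ 2 <= normc (P.[x +i* 0] / Q.[x +i* 0] - w : Cplx R) ^+ 2.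
  by rewrite normc_sqr E lerDr sqr_ge0.
by rewrite lef_pV2 ?posrE ?(lt_le_trans w20).
Qed.

(** Joint continuity provides the measurability on the product that Tonelli's theorem needs. *)
Lemma continuous_kker (W : R -> Cplx R) : continuous W -> (forall s, complex.Im (W s) != 0) ->
  continuous (fun q : R * R => kker P Q (W q.1) q.2).
Proof.
move=> cW W0 q.
pose T : topologicalType := (R * R)%type.
have cr (A : {poly C}) : {for q, continuous (fun q : T => A.[q.2 +i* 0] : Cplx R)}.
  have c1 : {for q, continuous (fun q : T => (q.2 +i* 0 : Cplx R))}.
    by apply: continuous_cplx; [exact: cvg_snd|exact: cvg_cst].
  have c2 := cdiff_continuous (cdiff_horner A (q.2 +i* 0 : Cplx R)).
  exact: (@continuous_comp T (Cplx R) (Cplx R) _ _ q c1 c2).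
have cw : {for q, continuous (fun q : T => W q.1)}.
  by apply: (@continuous_comp _ _ _ (fst : T -> R) W); [exact: cvg_fst|exact: cW].
have cc : {for q, continuous (fun q : T => (W q.1)^* : Cplx R)}.
  have c1 : {for W q.1, continuous (fun z : Cplx R => z^* : Cplx R)}.
    by apply/continuous_cplxP => e e0; exists e => // z zq; rewrite -rmorphB normc_conj.
  exact: (@continuous_comp T (Cplx R) (Cplx R) _ _ q cw c1).
have cM (f g : T -> Cplx R) : {for q, continuous f} -> {for q, continuous g} ->
    {for q, continuous (fun q => f q * g q)}.
  by move=> cf cg; exact: (@continuousM (complex R) T f g q cf cg).
have cB (f g : T -> Cplx R) : {for q, continuous f} -> {for q, continuous g} ->
    {for q, continuous (fun q => f q - g q)}.
  by move=> cf cg; exact: (continuousB cf cg).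
pose H (q : T) : Cplx R :=
  (Q.[q.2 +i* 0] * Q.[q.2 +i* 0]) / ((P.[q.2 +i* 0] - W q.1 * Q.[q.2 +i* 0]) *
     (P.[q.2 +i* 0] - (W q.1)^* * Q.[q.2 +i* 0])).
have -> : (fun q : R * R => kker P Q (W q.1) q.2) = (@complex.Re R) \o H.
  by apply/funext => v; rewrite /kker /kfun /kden !(hornerM, hornerD, hornerN, hornerZ).
suff cH : {for q, continuous H}.
  exact: (@continuous_comp T (Cplx R) R H (@complex.Re R) q cH (@continuous_Re R (H q))).
have cD := cM _ _ (cB _ _ (cr P) (cM _ _ cw (cr Q))) (cB _ _ (cr P) (cM _ _ cc (cr Q))).
apply: (cM _ _ (cM _ _ (cr Q) (cr Q))).
apply: (@continuousV (complex R) T _ q _ cD).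
rewrite mulf_neq0//.
  have := real_not_root copPQ realPQ q.2 (W0 q.1).
  by rewrite /root !(hornerM, hornerD, hornerN, hornerZ).
have W0' : complex.Im (W q.1)^* != 0 by have := W0 q.1; case: (W q.1) => a b /=; rewrite oppr_eq0.
have := real_not_root copPQ realPQ q.2 W0'.
by rewrite /root !(hornerM, hornerD, hornerN, hornerZ).
Qed.

End KernelContinuity.

Section IntegralAlong.
Variables (P Q : {poly C}) (m : nat).
Hypothesis sQ : size Q = m.+1.
Hypothesis sPQ : (size (P - (1 : R)%:C *: ('X * Q))%R <= m.+1)%N.
Hypothesis selfPQ : forall z : Cplx R, 0 < complex.Im z -> 0 < complex.Im (P.[z] / Q.[z] : Cplx R).
Hypothesis copPQ : coprimep P Q.
Hypothesis realPQ : forall x : R, Q.[(x +i* 0 : Cplx R)] != 0 ->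
  complex.Im (P.[(x +i* 0 : Cplx R)] / Q.[(x +i* 0 : Cplx R)]) = 0.

(** Both norm inequalities are instances: the lower one takes a horizontal line for [W], the upper
    one the identity for [P / Q] and the image of a line under the symbol for [W]. Only the bound
    [L] on the integrated kernel differs. *)
Lemma integral_along_le (f : Cplx R -> Cplx R) (p N L : R) (W : R -> Cplx R) : 1 <= p ->
  (forall z, 0 < complex.Im z -> cdiff f z) ->
  (forall y : R, 0 < y ->
    (\int[mu]_x (normc (f (P.[x +i* y] / Q.[x +i* y])) `^ p)%:E <= N%:E)%E) ->
  continuous W -> (forall s, 0 < complex.Im (W s)) -> 0 <= L ->
  (forall x : R, (\int[mu]_s (complex.Im (W s) / pi * kker P Q (W s) x)%:E <= L%:E)%E) ->
  (\int[mu]_s (normc (f (W s)) `^ p)%:E <= (L * N)%:E)%E.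
Proof.
move=> p1 df hN cW W0 L0 HL.
have W0' s : complex.Im (W s) != 0 by rewrite gt_eqF.
pose d (n : nat) : R := n.+1%:R^-1.
have d0 n : 0 < d n by rewrite invr_gt0.
have dcvg : d @ \oo --> (0 : R) by exact: cvg_harmonic.
have W1 s : 0 < complex.Im (W s) / pi by rewrite divr_gt0// pi_gt0.
have cG (z : Cplx R) : 0 < complex.Im z ->
    {for z, continuous (fun z : Cplx R => (normc (f (P.[z] / Q.[z])) `^ p : R))}.
  move=> z0; have cfr : {for z, continuous (fun z : Cplx R => f (P.[z] / Q.[z]))} :=
    ccont_comp (cdiff_continuous (cdiff_r selfPQ z0)) (cdiff_continuous (df _ (selfPQ z0))).
  exact: (continuous_powR_normc p1 cfr).
apply: (@kernel_average_integral_le R (fun n x => normc (f (P.[x +i* d n] / Q.[x +i* d n])) `^ p)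
  (fun q => complex.Im (W q.1) / pi * kker P Q (W q.1) q.2)) => //.
- move=> n; exact: (measurable_hline (d0 n) cG).
- by move=> n x; exact: powR_ge0.
- apply: measurable_funM; last first.
    by apply: measurable_continuous2; exact: continuous_kker.
  apply: measurable_continuous2 => q; apply: cvgM; last exact: cvg_cst.
  apply: (@continuous_comp _ _ _ (fun q : R * R => W q.1) (@complex.Im R)); last exact: continuous_Im.
  by apply: (@continuous_comp _ _ _ (fst : R * R -> R) W); [exact: cvg_fst|exact: cW].
- by move=> q; rewrite mulr_ge0 ?kker_ge0// ltW.
- apply: continuous_measurable_fun => s.
  have cfW : {for W s, continuous (fun z => normc (f z) `^ p : R)}.
    by apply: (continuous_powR_normc p1); apply: cdiff_continuous; exact: df.
  exact: (@continuous_comp _ _ _ W (fun z => normc (f z) `^ p : R) s (cW s) cfW).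
- by move=> s; exact: powR_ge0.
- by move=> n; exact: hN.
- move=> s; exists (complex.Im (W s) / pi * (complex.Im (W s) ^+ 2)^-1) => x.
  by rewrite ler_wpM2l ?(ltW (W1 s))// kker_le_Im.
- move=> s e e0.
  have [K [r0 [r00 K0 H]]] := powR_le_kernel_average sQ sPQ selfPQ copPQ realPQ p1 df (W0 s) hN.
  have K1 : 0 < K + 1 by rewrite ltr_wpDl.
  have m0 : 0 < Num.min r0 (e / (K + 1)) by rewrite lt_min r00 divr_gt0.
  move/cvgrPdist_lt : dcvg => /(_ _ m0); apply: filterS => n.
  rewrite sub0r normrN gtr0_norm// lt_min => /andP[dr de].
  apply: le_trans (H (d n) _) _; first by rewrite d0.
  rewrite lerD2l; move: de; rewrite ltr_pdivlMr// => /ltW; apply: le_trans.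
  by rewrite mulrC ler_wpM2l ?(ltW (d0 n))// lerDl.
Qed.

End IntegralAlong.

Section Operators.
Variables (P Q : {poly C}) (m : nat) (c : R).
Hypothesis sQ : size Q = m.+1.
Hypothesis c0 : 0 < c.
Hypothesis sPQ : (size (P - c%:C *: ('X * Q))%R <= m.+1)%N.
Hypothesis selfPQ : forall z : Cplx R, 0 < complex.Im z -> 0 < complex.Im (P.[z] / Q.[z] : Cplx R).

Definition rPQ (z : Cplx R) : Cplx R := P.[z] / Q.[z].

Lemma composition_le (f : Cplx R -> Cplx R) (p N : R) : 1 <= p ->
  (forall z, 0 < complex.Im z -> cdiff f z) -> (hardy_sup p f <= N%:E)%E ->
  (hardy_sup p (composition_operator rPQ f) <= (c^-1 * N)%:E)%E.
Proof.
move=> p1 df /hardy_sup_leP hN; apply/hardy_sup_leP => y y0.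
rewrite /composition_operator /= y0.
have E (z : Cplx R) : ('X : {poly C}).[z] / (1 : {poly C}).[z] = z by rewrite hornerX hornerC divr1.
(* The rational function is here the identity ['X / 1], whose kernel is Poisson's, and the symbol
   becomes the curve [W]; [integral_pullback] evaluates the kernel integrated along it. *)
refine (@integral_along_le 'X 1 0 _ _ _ _ _ f p N c^-1 (fun s => P.[s +i* y] / Q.[s +i* y]) p1 df _ _ _ _ _).
- by rewrite size_poly1.
- by rewrite mulr1 scale1r subrr size_poly0.
- by move=> z; rewrite E.
- by rewrite coprimep1.
- by move=> x _; rewrite E.
- by move=> t t0; under eq_integral do rewrite E; exact: hN.
- move=> s; apply: (@continuous_comp _ _ _ (fun s : R => (s +i* y : Cplx R)) (fun z : Cplx R => P.[z] / Q.[z] : Cplx R)).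
    by apply: continuous_cplx; [exact: cvg_id|exact: cvg_cst].
  by apply: cdiff_continuous; exact: (cdiff_r selfPQ).
- by move=> s; exact: selfPQ.
- by rewrite invr_ge0 ltW.
- move=> t.
  have H := integral_pullback sQ c0 sPQ selfPQ t y0.
  have E1 (s : R) : complex.Im (P.[s +i* y] / Q.[s +i* y] : Cplx R) / pi *
      kker 'X 1 (P.[s +i* y] / Q.[s +i* y]) t =
      pi^-1 * (complex.Im (P.[s +i* y] / Q.[s +i* y] : Cplx R) /
        normc (P.[s +i* y] / Q.[s +i* y] - t%:C : Cplx R) ^+ 2).
    have w0 : complex.Im (P.[s +i* y] / Q.[s +i* y] : Cplx R) != 0.
      by rewrite gt_eqF//; exact: selfPQ.
    have realX (x : R) : (1 : {poly C}).[(x +i* 0 : Cplx R)] != 0 ->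
        complex.Im (('X : {poly C}).[(x +i* 0 : Cplx R)] / (1 : {poly C}).[(x +i* 0 : Cplx R)]) = 0.
      by move=> _; rewrite E.
    have one0 : (1 : {poly C}).[(t +i* 0 : Cplx R)] != 0 by rewrite hornerC oner_eq0.
    rewrite /kker (kfunE (coprimep1 'X) realX w0 one0) /= E normcB.
    by ring.
  have E2 : (\int[mu]_s (complex.Im (P.[s +i* y] / Q.[s +i* y] : Cplx R) / pi *
      kker 'X 1 (P.[s +i* y] / Q.[s +i* y]) t)%:E =
      \int[mu]_s (pi^-1 * (complex.Im (P.[s +i* y] / Q.[s +i* y] : Cplx R) /
        normc (P.[s +i* y] / Q.[s +i* y] - t%:C : Cplx R) ^+ 2))%:E)%E.
    by apply: eq_integral => s _; rewrite E1.
  have cr : forall z : Cplx R, 0 < complex.Im z -> {for z, continuous (fun z : Cplx R => complex.Im (P.[z] / Q.[z] : Cplx R) / normc (P.[z] / Q.[z] - t%:C : Cplx R) ^+ 2 : R)}.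
    move=> z z0; have c1 := cdiff_continuous (cdiff_r selfPQ z0).
    have c2 : {for z, continuous (fun z : Cplx R => complex.Im (P.[z] / Q.[z] : Cplx R))}.
      exact: (@continuous_comp (Cplx R) (Cplx R) R (fun z : Cplx R => P.[z] / Q.[z] : Cplx R) (@complex.Im R) z c1 (@continuous_Im R _)).
    have c3 : {for z, continuous (fun z : Cplx R => normc (P.[z] / Q.[z] - t%:C : Cplx R))}.
      have c4 := ccontB c1 (@ccont_cst _ (t%:C) z).
      exact: (@continuous_comp (Cplx R) (Cplx R) R (fun z : Cplx R => P.[z] / Q.[z] - t%:C : Cplx R) (@normc R) z c4 (@continuous_normc R _)).
    have n1 : normc (P.[z] / Q.[z] - t%:C : Cplx R) != 0.
      rewrite normc_eq0 subr_eq0; apply/eqP => E0.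
      by have := selfPQ z0; rewrite E0 ltxx.
    have n0 := mulf_neq0 n1 n1.
    have c5 := @continuousM R (Cplx R) _ _ z c3 c3.
    have c6 := @continuousV R (Cplx R) _ z n0 c5.
    exact: (@continuousM R (Cplx R) _ _ z c2 c6).
  rewrite E2 ge0_intZ.
  - by rewrite H -EFinM lee_fin mulrCA mulVf ?mulr1// gt_eqF// pi_gt0.
  - by [].
  - exact: (measurable_hline y0 cr).
  - by move=> s _; rewrite divr_ge0 ?sqr_ge0// ltW//; exact: selfPQ.
  - by rewrite invr_ge0 pi_ge0.
Qed.

Lemma composition_ge (f : Cplx R -> Cplx R) (p N : R) : 1 <= p -> c = 1 ->
  coprimep P Q ->
  (forall x : R, Q.[(x +i* 0 : Cplx R)] != 0 ->
    complex.Im (P.[(x +i* 0 : Cplx R)] / Q.[(x +i* 0 : Cplx R)]) = 0) ->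
  (forall z, 0 < complex.Im z -> cdiff f z) ->
  (hardy_sup p (composition_operator rPQ f) <= N%:E)%E -> (hardy_sup p f <= N%:E)%E.
Proof.
move=> p1 cE cop rea df /hardy_sup_leP hN; apply/hardy_sup_leP => K K0.
have sPQ1 := sPQ; rewrite cE in sPQ1; rewrite -[N]mul1r.
refine (@integral_along_le P Q m sQ sPQ1 selfPQ cop rea f p N 1 (fun s => s +i* K) p1 df _ _ _ ler01 _) => //.
- by move=> y y0; have := hN y y0; rewrite /composition_operator /= y0.
- by move=> s; apply: continuous_cplx; [exact: cvg_id|exact: cvg_cst].
(* When [x] is a pole, [rho] is 0 by convention, and the comparison with a Poisson kernel still
   holds because [kker] vanishes there. *)
- move=> x; pose rho := complex.Re (P.[x +i* 0] / Q.[x +i* 0] : Cplx R).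
  have mp : measurable_fun setT (fun s : R => K / ((s - rho) ^+ 2 + K ^+ 2)).
    by apply: continuous_measurable_fun; exact: continuous_poisson.
  apply: le_trans (_ : \int[mu]_s (pi^-1 * (K / ((s - rho) ^+ 2 + K ^+ 2)))%:E <= _)%E.
    apply: ge0_le_int => //.
    + have cW : continuous (fun s : R => (s +i* K : Cplx R)).
        by move=> s'; apply: continuous_cplx; [exact: cvg_id|exact: cvg_cst].
      have ck := continuous_kker cop rea cW (fun _ => lt0r_neq0 K0).
      have H : measurable_fun [set: R] (fun s : R => kker P Q (s +i* K) x).
        exact: (measurable_fun_pair1 x (measurable_continuous2 ck)).
      have H' : measurable_fun [set: R] (fun s : R => K / pi * kker P Q (s +i* K) x).
        exact: measurable_funM.
      exact: H'.
    + exact: measurable_funM.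
    + by move=> s _; rewrite mulr_ge0 ?divr_ge0 ?pi_ge0 ?(ltW K0)// kker_ge0//= gt_eqF.
    + move=> s _ /=; rewrite mulrAC [pi^-1 * _]mulrC ler_wpM2r ?invr_ge0 ?pi_ge0//.
      rewrite ler_wpM2l ?(ltW K0)//.
      have := @kker_le R P Q cop rea (s +i* K) x; rewrite /= gt_eqF// => /(_ isT) /le_trans; apply.
      rewrite normc_sqr ReB ImB /= -/rho.
      have -> : complex.Im (P.[x +i* 0] / Q.[x +i* 0] : Cplx R) = 0.
        have [Qx|Qx] := eqVneq Q.[(x +i* 0 : Cplx R)] 0; last exact: rea.
        by rewrite Qx invr0 mulr0.
      by rewrite sub0r sqrrN -[(rho - s) ^+ 2]sqrrN opprB.
  rewrite ge0_intZ//.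
  + by rewrite integral_poisson// -EFinM mulVf// gt_eqF// pi_gt0.
  + by move=> s _; rewrite divr_ge0 ?(ltW K0)// ltW// poisson_denom_gt0.
  + by rewrite invr_ge0 pi_ge0.
Qed.

End Operators.
End HardyBounds.

(** * Operators similar to isometries *)

Section OperatorLemmas.
Context {K : nzRingType} {R : realType} {V : lmodType K}.
Variables (X : set V) (N : V -> R) (T : V -> V).
Hypothesis N0 : forall f, 0 <= N f.

Lemma isometry_similar : isometry_on X N T -> similar_to_isometry_on X N T.
Proof.
move=> [linT isoT]; have bid : bounded_operator_on X N id.
  by split; [split|exists 1 => f _; rewrite mul1r].
split; first by split=> //; exists 1 => f /isoT ->; rewrite mul1r.
by exists id, id, T; split.
Qed.

Lemma similar_power_bounded : similar_to_isometry_on X N T ->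
  (forall f, X f -> X (T f)) /\
  exists2 M : R, 0 < M & forall n f, X f ->
    N (iter n T f) <= M * N f /\ N f <= M * N (iter n T f).
Proof.
move=> [[[XT _] _] [S [S' [U [[[XS _] [a Sa]] [[XS' _] [b Sb]] SS' [[XU _] NU] TE]]]]].
split=> //.
have XTn n f : X f -> X (iter n T f) by move=> Xf; elim: n => //= n; exact: XT.
have STn n f : X f -> S (iter n T f) = iter n U (S f).
  move=> Xf; elim: n => //= n IH; have XTnf := XTn n f Xf.
  by rewrite TE// (SS' _ (XU _ (XS _ XTnf))).2 IH.
have XUn n g : X g -> X (iter n U g) by move=> Xg; elim: n => //= n; exact: XU.
have NUn n g : X g -> N (iter n U g) = N g.
  by move=> Xg; elim: n => //= n IH; rewrite NU//; exact: XUn.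
(* The bounds [a] and [b] of [S] and [S'] may have any sign; this keeps the constant positive. *)
exists ((`|a| + 1) * (`|b| + 1)); first by rewrite mulr_gt0// ltr_wpDl.
have Sa' f : X f -> N (S f) <= (`|a| + 1) * N f.
  by move=> Xf; apply: le_trans (Sa f Xf) _; rewrite ler_wpM2r// (le_trans (ler_norm a))// lerDl.
have Sb' f : X f -> N (S' f) <= (`|b| + 1) * N f.
  by move=> Xf; apply: le_trans (Sb f Xf) _; rewrite ler_wpM2r// (le_trans (ler_norm b))// lerDl.
move=> n f Xf; have XSf := XS _ Xf; have XTf := XTn n f Xf.
have E : N (S (iter n T f)) = N (S f) by rewrite STn// NUn.
split.
  rewrite -{1}(SS' _ XTf).1; apply: le_trans (Sb' _ (XS _ XTf)) _.
  by rewrite E -mulrA mulrCA ler_wpM2l ?addr_ge0// Sa'.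
rewrite -{1}(SS' _ Xf).1; apply: le_trans (Sb' _ XSf) _.
by rewrite -E -mulrA mulrCA ler_wpM2l ?addr_ge0// Sa'.
Qed.

End OperatorLemmas.

Section HardyNorm.
Variable R : realType.
Local Notation mu := (@lebesgue_measure R).
Implicit Types (p : R) (f : Cplx R -> Cplx R).

Lemma hardy_norm_ge0 p f : 0 <= hardy_norm p f.
Proof. exact: powR_ge0. Qed.

Lemma hardy_supE p f : hardy_space p f -> hardy_sup p f = (fine (hardy_sup p f))%:E.
Proof.
by move=> [_ _ fin]; rewrite fineK// ge0_fin_numE// hardy_sup_ge0.
Qed.

Lemma fine_hardy_sup_ge0 p f : 0 <= fine (hardy_sup p f).
Proof. by rewrite fine_ge0// hardy_sup_ge0. Qed.

Lemma hardy_norm_powR p f : p != 0 -> hardy_norm p f `^ p = fine (hardy_sup p f).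
Proof.
by move=> p0; rewrite /hardy_norm -powRrM mulVf// powRr1// fine_hardy_sup_ge0.
Qed.

Lemma powR_le_powR (p M x y a b : R) : 0 <= p -> 0 <= M -> 0 <= x -> 0 <= y ->
  x `^ p = a -> y `^ p = b -> x <= M * y -> a <= M `^ p * b.
Proof.
move=> p0 M0 x0 y0 <- <- xy; rewrite -powRM//.
by apply: ge0_ler_powR; rewrite // nnegrE mulr_ge0.
Qed.

Lemma hardy_norm_le p f g (M : R) : 1 <= p -> 0 <= M ->
  hardy_norm p f <= M * hardy_norm p g ->
  fine (hardy_sup p f) <= M `^ p * fine (hardy_sup p g).
Proof.
move=> p1 M0; have p0 : p != 0 by rewrite gt_eqF// (lt_le_trans ltr01).
exact: (powR_le_powR (le_trans ler01 p1) M0 (hardy_norm_ge0 p f) (hardy_norm_ge0 p g)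
  (hardy_norm_powR f p0) (hardy_norm_powR g p0)).
Qed.

Lemma hardy_space_cdiff p f : hardy_space p f ->
  forall z, 0 < complex.Im z -> cdiff f z.
Proof. by move=> [H _ _] z z0; apply/derivable_cdiff; exact: H. Qed.

Lemma composition_operatorE r f z : 0 < complex.Im z ->
  composition_operator r f z = f (r z) :> Cplx R.
Proof. by move=> z0; rewrite /composition_operator z0. Qed.

Lemma composition_hardy p r f : (forall z, 0 < complex.Im z -> cdiff r z) ->
  (forall z, 0 < complex.Im z -> 0 < complex.Im (r z)) ->
  hardy_space p f -> (hardy_sup p (composition_operator r f) < +oo)%E ->
  hardy_space p (composition_operator r f).
Proof.
move=> dr sr Xf fin; split=> //.
  move=> z z0; apply/derivable_cdiff; apply: (@cdiff_near _ (fun z => f (r z))).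
    by apply: cdiff_comp; [exact: dr|apply: (hardy_space_cdiff Xf); exact: sr].
  by apply: filterS (nbhs_upper z0) => w w0; rewrite composition_operatorE.
by move=> z /negP nz; rewrite /composition_operator; case: ifP => // zz; rewrite /upper_half_plane /= zz in nz.
Qed.

Lemma composition_linear p r : (forall f, hardy_space p f -> hardy_space p (composition_operator r f)) ->
  linear_operator_on (hardy_space p) (@composition_operator R r).
Proof.
move=> H; split; first exact: H.
move=> a f g _ _; apply/funext => z.
change (composition_operator r (a *: f + g) z =
  a * composition_operator r f z + composition_operator r g z).
rewrite /composition_operator; case: (0 < complex.Im z); first by [].
by rewrite mulr0 addr0.
Qed.

Lemma iter_composition r f n z : (forall z, 0 < complex.Im z -> 0 < complex.Im (r z)) ->
  0 < complex.Im z -> iter n (composition_operator r) f z = f (iter n r z) :> Cplx R.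
Proof.
move=> sr; elim: n z => [//|n IH] z z0.
by rewrite iterS composition_operatorE// IH ?sr// -iterSr.
Qed.

Lemma iter_upper (r : Cplx R -> Cplx R) n z : (forall z, 0 < complex.Im z -> 0 < complex.Im (r z)) ->
  0 < complex.Im z -> 0 < complex.Im (iter n r z).
Proof. by move=> sr z0; elim: n => //= n; exact: sr. Qed.

End HardyNorm.

(** * Rational self-maps near infinity *)

Section RationalAtInfinity.
Variable R : realType.
Local Notation C := (complex R).
Variables (P Q : {poly C}).
Hypothesis Q0 : Q != 0.

Lemma ratio_upper (A B : {poly C}) n : B != 0 -> (size A <= size B + n)%N ->
  exists K rho : R, [/\ 0 < K, 1 <= rho & forall z : Cplx R, rho <= normc z ->
    B.[z] != 0 /\ normc (A.[z] / B.[z]) <= K * (1 + normc z) ^+ n].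
Proof.
move=> B0 sAB; have [rho rho1 Hr] := far_from_roots B0.
have sB : (0 < size B)%N by rewrite lt0n size_poly_eq0.
have sA' : (size A <= ((size B).-1 + n).+1)%N by rewrite -addSn prednK.
have [K K0 HK] := poly_upper sA'.
have [k k0 Hk] := poly_lower (E := fun z => rho <= normc z) B0 ltr01 Hr.
exists (K / k), rho; split=> //; first by rewrite divr_gt0.
move=> z rz; have := Hk z rz => Bz.
have z0 : 0 < 1 + normc z by rewrite ltr_wpDr// normc_ge0.
have Bz0 : 0 < normc B.[z] by apply: lt_le_trans Bz; rewrite mulr_gt0// exprn_gt0.
split; first by rewrite -normc_gt0.
rewrite normcM normcV ler_pdivrMr//; apply: le_trans (HK z) _.
have -> : K * (1 + normc z) ^+ ((size B).-1 + n) =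
    K / k * (1 + normc z) ^+ n * (k * (1 + normc z) ^+ (size B).-1).
  by rewrite exprD; field; rewrite lt0r_neq0.
by rewrite ler_wpM2l// !mulr_ge0 ?invr_ge0 ?exprn_ge0 ?(ltW K0) ?(ltW k0) ?(ltW z0).
Qed.

Lemma size_lead_cancel (M : nat) : (size P = size Q + M)%N -> (0 < size Q)%N ->
  (size (P - (lead_coef P / lead_coef Q) *: ('X^M * Q) : {poly C})%R < size P)%N.
Proof.
move=> sPQ sQ; have sP : (0 < size P)%N by rewrite sPQ addn_gt0 sQ.
rewrite -(prednK sP) ltnS; apply/leq_sizeP => j; rewrite leq_eqVlt => /predU1P[<-|jP].
  rewrite coefB coefZ coefXnM ifF; last first.
    by apply/negbTE; rewrite -leqNgt sPQ -subn1 -addnBAC// leq_addl.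
  have -> : ((size P).-1 - M = (size Q).-1)%N by rewrite sPQ -!subn1 subnAC addnK.
  by rewrite -!lead_coefE divfK ?subrr// lead_coef_eq0.
rewrite coefB coefZ coefXnM nth_default; last by rewrite -(prednK sP).
have jM : (j < M)%N = false.
  apply/negbTE; rewrite -leqNgt; apply: leq_trans (ltnW jP).
  by rewrite sPQ -subn1 -addnBAC// leq_addl.
rewrite jM nth_default ?mulr0 ?subr0//.
by rewrite leq_subRL; [rewrite addnC -sPQ -(prednK sP)|rewrite leqNgt jM].
Qed.

Hypothesis self : forall z : Cplx R, 0 < complex.Im z -> 0 < complex.Im (P.[z] / Q.[z] : Cplx R).

(** Along the ray through [u], [r (t u)] equals [l (t u)^(M+1)] up to a term of order [t^M], so a
    leading term below the axis would drag [r] out of the half-plane. *)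
Lemma lead_upper (M : nat) (u : Cplx R) : (size P = size Q + M.+1)%N -> 0 < complex.Im u ->
  0 <= complex.Im ((lead_coef P / lead_coef Q) * u ^+ M.+1 : Cplx R).
Proof.
move=> sPQ u0; set l := lead_coef P / lead_coef Q.
have sQ : (0 < size Q)%N by rewrite lt0n size_poly_eq0.
pose D := P - l *: ('X^(M.+1) * Q).
have sD : (size D <= size Q + M)%N by rewrite -ltnS -addnS -sPQ; exact: size_lead_cancel sPQ sQ.
have [K [rho [K0 rho1 HK]]] := ratio_upper Q0 sD.
rewrite leNgt; apply/negP => neg; set e := complex.Im (l * u ^+ M.+1) in neg.
pose K' := K * (1 + normc u) ^+ M.
have nu0 : 0 < normc u by apply: lt_le_trans u0 _; apply: le_trans (Im_le_normc u); exact: ler_norm.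
have K'0 : 0 < K' by rewrite mulr_gt0// exprn_gt0// addr_gt0.
(* The second summand moves [t u] beyond the radius [rho]; the third makes [t * e + K'] negative, so
   that the remainder cannot compensate the leading term. *)
pose t := 1 + rho / normc u + K' / - e.
have t1 : 1 <= t by rewrite /t -addrA lerDl addr_ge0// divr_ge0 ?oppr_ge0 ?(ltW neg) ?(ltW nu0) ?(ltW K'0)// (le_trans ler01).
have t0 : 0 < t by exact: lt_le_trans t1.
have h1 : 0 <= rho / normc u by rewrite divr_ge0 ?(ltW nu0)// (le_trans ler01).
have h2 : 0 <= K' / - e by rewrite divr_ge0 ?oppr_ge0 ?(ltW neg) ?(ltW K'0).
pose z : Cplx R := t%:C * u.
have nz : normc z = t * normc u by rewrite /z normcM normc_real gtr0_norm.
have rz : rho <= normc z.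
  rewrite nz -ler_pdivrMr// /t; lra.
have z0 : 0 < complex.Im z by rewrite /z ImM /= mul0r addr0 mulr_gt0.
have [Qz HD] := HK z rz.
have rE : P.[z] / Q.[z] = l * z ^+ M.+1 + D.[z] / Q.[z].
  have -> : P = D + l *: ('X^(M.+1) * Q) by rewrite /D subrK.
  by rewrite hornerD hornerZ hornerM hornerXn mulrDl addrC; congr (_ + _); rewrite -!mulrA divff ?mulr1.
have := self z0; rewrite rE ImD => pos.
have Im1 : complex.Im (l * z ^+ M.+1 : Cplx R) = t ^+ M.+1 * e.
  rewrite /z exprMn -rmorphXn mulrCA ImM /= mul0r addr0.
  by [].
have le1 : complex.Im (D.[z] / Q.[z] : Cplx R) <= K' * t ^+ M.
  apply: le_trans (ler_norm _) _; apply: le_trans (Im_le_normc _) _; apply: le_trans HD _.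
  rewrite /K' -mulrA ler_wpM2l ?(ltW K0)// -exprMn lerXn2r ?nnegrE ?mulr_ge0 ?addr_ge0 ?normc_ge0 ?(ltW t0)//.
  by rewrite nz [leRHS]mulrDl mul1r [normc u * t]mulrC lerD2r.
have : 0 < t ^+ M * (t * e + K').
  apply: lt_le_trans pos _; rewrite Im1 exprS; apply: le_trans (lerD (lexx _) le1) _.
  by rewrite le_eqVlt; apply/orP; left; apply/eqP; ring.
rewrite pmulr_rgt0 ?exprn_gt0// => pos2.
have : K' <= - e * t.
  rewrite /t mulrDr; have -> : - e * (K' / - e) = K' by rewrite mulrC divfK// oppr_eq0 lt_eqF.
  by rewrite lerDr mulr_ge0 ?oppr_ge0 ?(ltW neg)// addr_ge0.
by lra.
Qed.

Lemma de_moivre (t : R) n : (cos t +i* sin t : Cplx R) ^+ n = cos (n%:R * t) +i* sin (n%:R * t).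
Proof.
elim: n => [|n IH]; first by rewrite expr0 mul0r cos0 sin0.
rewrite exprS IH -natr1 mulrDl mul1r addrC cosD sinD.
by apply/eqP; rewrite eq_complex /=; apply/andP; split; apply/eqP; ring.
Qed.

(* A leading term [l z^n] with [n >= 2] turns an arc of length [n pi > pi] out of
   the closed half-plane. *)
Lemma degree_excess (M : nat) : (size P = size Q + M.+1)%N -> M = 0%N.
Proof.
move=> sPQ; case: M sPQ => // M sPQ; exfalso.
have l0 : lead_coef P / lead_coef Q != 0.
  rewrite mulf_neq0 ?invr_eq0 ?lead_coef_eq0//.
  by rewrite -size_poly_eq0 sPQ addnS.
set l := lead_coef P / lead_coef Q in l0.
have H (s : R) : 0 < s < M.+2%:R * pi -> 0 <= complex.Re l * sin s + complex.Im l * cos s.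
  move=> /andP[s0 s1]; pose t := s / M.+2%:R.
  have t0 : 0 < t < pi by rewrite divr_gt0//= ltr_pdivrMr// mulrC.
  have u0 : 0 < complex.Im (cos t +i* sin t : Cplx R) by exact: sin_gt0_pi.
  have := lead_upper sPQ u0; rewrite de_moivre -/l ImM /=.
  by rewrite /t mulrCA divff ?mulr1// pnatr_eq0.
have p0 := pi_gt0 R.
have M2 : 2 <= M.+2%:R :> R by rewrite ler_nat.
have M2p : 2 * pi <= M.+2%:R * pi :> R by rewrite ler_wpM2r// ltW.
(* All test angles are below [2 pi]: [pi / 2] and [3 pi / 2] force [Re l = 0], then [pi] and
   [pi / 4] force [Im l = 0]. *)
have a1 : 0 <= complex.Re l.
  by have := H (pi / 2); rewrite sin_pihalf cos_pihalf mulr1 mulr0 addr0; apply; apply/andP; split; lra.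
have a2 : complex.Re l <= 0.
  have := H (pi / 2 + pi); rewrite sinDpi cosDpi sin_pihalf cos_pihalf oppr0 mulr0 addr0 mulrN1 oppr_ge0.
  by apply; apply/andP; split; lra.
have a0 : complex.Re l = 0 by lra.
have b1 : complex.Im l <= 0.
  have := H pi; rewrite sinpi cospi mulr0 add0r mulrN1 oppr_ge0; apply; apply/andP; split; lra.
have b2 : 0 <= complex.Im l.
  have q : 0 < cos (pi / 4) :> R by apply: cos_gt0_pihalf; apply/andP; split; lra.
  by have := H (pi / 4); rewrite a0 mul0r add0r pmulr_lge0//; apply; apply/andP; split; lra.
have b0 : complex.Im l = 0 by lra.
by case: l a0 b0 l0 {H a1 a2 b1 b2} => a b /= -> -> /eqP.
Qed.

(** Testing [lead_upper] at [x + i] for every real [x] gives an affine function of [x] that is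
    nowhere negative, so its slope [Im l] is 0. *)
Lemma slope_gt0 : (size P = size Q + 1)%N ->
  exists2 c : R, 0 < c & lead_coef P / lead_coef Q = c%:C.
Proof.
move=> sPQ.
have l0 : lead_coef P / lead_coef Q != 0.
  rewrite mulf_neq0 ?invr_eq0 ?lead_coef_eq0//.
  by rewrite -size_poly_eq0 sPQ addnS.
have H (x : R) : 0 <= complex.Re (lead_coef P / lead_coef Q : Cplx R) + complex.Im (lead_coef P / lead_coef Q : Cplx R) * x.
  have := @lead_upper 0%N (x +i* 1) sPQ ltr01.
  by rewrite expr1 ImM /= mulr1.
set l := lead_coef P / lead_coef Q in l0 H *.
have b0 : complex.Im l = 0.
  apply/eqP; apply/negPn/negP => b0; have := H (- (complex.Re l + 1) / complex.Im l).
  by rewrite mulrC divfK// opprD addrA subrr sub0r ler0N1.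
exists (complex.Re l); last by case: l b0 {l0 H} => a b /= ->.
rewrite lt_def; apply/andP; split; last by have := H 0; rewrite mulr0 addr0.
by apply: contraNneq l0 => a0; case: l a0 b0 {H} => a b /= -> ->.
Qed.

End RationalAtInfinity.

Section SlopeAtInfinity.
Variable R : realType.
Local Notation C := (complex R).
Variables (P Q : {poly C}).
Hypothesis Q0 : Q != 0.

Lemma size_XQ : size ('X * Q) = (size Q).+1.
Proof. by rewrite mulrC size_mulX. Qed.

Lemma slope_residue (z : Cplx R) : Q.[z] != 0 -> z != 0 ->
  rPQ P Q z / z - 1 = (P - 'X * Q).[z] / Q.[z] / z.
Proof.
move=> Qz z0; rewrite hornerD hornerN hornerM hornerX mulrBl mulrBl /rPQ; congr (_ - _).
by rewrite mulfK// divff.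
Qed.

(** If [D = P - X Q] had larger degree than [Q], then [X Q / D] would stay bounded near infinity;
    but it is the inverse of [r(z) / z - 1], which tends to 0. *)
Lemma slope_limit_size : (rPQ P Q z / z @[z --> @at_infinity R] --> (1 : Cplx R)) ->
  (size (P - 'X * Q)%R <= size Q)%N.
Proof.
move=> /cvg_cplxP H; rewrite leqNgt; apply/negP => sD.
set D : {poly C} := P - 'X * Q in sD.
have D0 : D != 0 by rewrite -size_poly_gt0; apply: leq_trans sD.
have sXQ : (size ('X * Q)%R <= size D + 0)%N by rewrite size_XQ addn0.
have [K [rho [K0 rho1 HK]]] := ratio_upper D0 sXQ.
have [K' [rho' [_ _ HK']]] := ratio_upper Q0 (leq_addr 0%N (size Q)).
have K1 : 0 < (K + 1)^-1 by rewrite invr_gt0 addr_gt0.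
have big : \forall z \near @at_infinity R, Num.max rho rho' < normc z by exists (Num.max rho rho').
have [z [/= Hz]] := filter_ex (filterI (H _ K1) big).
rewrite gt_max => /andP[rz rz'].
have [Dz Dle] := HK z (ltW rz); have [Qz _] := HK' z (ltW rz').
have z0 : z != 0 by rewrite -normc_gt0; apply: lt_trans rz; exact: lt_le_trans rho1.
rewrite slope_residue// -/D in Hz; rewrite expr0 mulr1 in Dle.
have E : normc (D.[z] / Q.[z] / z) * normc (('X * Q).[z] / D.[z]) = 1.
  rewrite -normcM hornerM hornerX.
  have -> : D.[z] / Q.[z] / z * (z * Q.[z] / D.[z]) = 1 by field; rewrite Qz Dz z0.
  by rewrite normc1.
have : normc (D.[z] / Q.[z] / z) * normc (('X * Q).[z] / D.[z]) <= (K + 1)^-1 * K.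
  by apply: ler_pM => //; [exact: normc_ge0|exact: normc_ge0|exact: ltW].
by rewrite E mulrC ler_pdivlMr ?addr_gt0// mul1r leNgt ltrDl ltr01.
Qed.

Lemma slope_size_limit : (size (P - 'X * Q)%R <= size Q)%N ->
  (rPQ P Q z / z @[z --> @at_infinity R] --> (1 : Cplx R)).
Proof.
move=> sD; have sD' : (size (P - 'X * Q)%R <= size Q + 0)%N by rewrite addn0.
have [K [rho [K0 rho1 HK]]] := ratio_upper Q0 sD'.
apply/cvg_cplxP => e e0; exists (Num.max rho (K / e)) => // z /=.
rewrite gt_max => /andP[rz ez]; have [Qz Dle] := HK z (ltW rz).
have nz0 : 0 < normc z by apply: lt_trans rz; exact: lt_le_trans rho1.
rewrite slope_residue//; last by rewrite -normc_gt0.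
rewrite normcM normcV ltr_pdivrMr//; rewrite expr0 mulr1 in Dle.
by apply: le_lt_trans Dle _; rewrite mulrC -ltr_pdivrMr.
Qed.

End SlopeAtInfinity.

(** * Necessary conditions *)

Section TestFunctions.
Variable R : realType.
Local Notation mu := (@lebesgue_measure R).

Lemma hardy_sup_lower (p : R) (f : Cplx R -> Cplx R) (y a b k : R) : 1 <= p ->
  (forall z, 0 < complex.Im z -> cdiff f z) -> 0 < y -> a <= b -> 0 <= k ->
  (forall x, a <= x <= b -> k <= normc (f (x +i* y))) ->
  (((b - a) * k `^ p)%:E <= hardy_sup p f)%E.
Proof.
move=> p1 df y0 ab k0 H.
have mG : measurable_fun setT (fun x : R => normc (f (x +i* y)) `^ p).
  apply: (@measurable_hline R (fun z => normc (f z) `^ p)) => // z z0.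
  by apply: continuous_powR_normc => //; apply: cdiff_continuous; exact: df.
have mGD : measurable_fun `[a, b] (fun x : R => normc (f (x +i* y)) `^ p).
  exact: measurable_funS mG.
have G0 (x : R) : 0 <= normc (f (x +i* y)) `^ p by exact: powR_ge0.
have le1 : (\int[mu]_(x in `[a, b]) (k `^ p)%:E <=
    \int[mu]_(x in `[a, b]) (normc (f (x +i* y)) `^ p)%:E)%E.
  apply: ge0_le_int => //= x; first by move=> _; exact: powR_ge0.
  rewrite in_itv/= => /H kx; apply: ge0_ler_powR; rewrite ?nnegrE ?normc_ge0//.
  exact: le_trans p1.
have le2 : (\int[mu]_(x in `[a, b]) (normc (f (x +i* y)) `^ p)%:E <=
    \int[mu]_x (normc (f (x +i* y)) `^ p)%:E)%E.
  apply: ge0_subset_integral => //; first exact: measurable_EFin_fun.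
  by move=> x _; rewrite lee_fin G0.
have le3 : (\int[mu]_x (normc (f (x +i* y)) `^ p)%:E <= hardy_sup p f)%E.
  by apply: ereal_sup_ubound; exists y.
apply: le_trans (le_trans le1 (le_trans le2 le3)).
rewrite integral_cst//= lebesgue_measure_itv/= lte_fin.
case: ltP => ab'; first by rewrite -EFinB -EFinM mulrC.
have -> : b = a by apply: le_anti; rewrite ab ab'.
by rewrite subrr mul0r mule0.
Qed.

(** The pole lies at depth [l] below the point [s]. The exponent 2 puts the function in [H^p] for
    every [p >= 1], and the extension by 0 matches the encoding of [hardy_space]. *)
Definition test_fun (s l : R) (z : Cplx R) : Cplx R :=
  if 0 < complex.Im z then (z - (s +i* - l))^-1 ^+ 2 else 0.

Variables (s l p : R).
Hypothesis l0 : 0 < l.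
Hypothesis p1 : 1 <= p.

Lemma test_fun_upper z : 0 < complex.Im z -> test_fun s l z = (z - (s +i* - l))^-1 ^+ 2.
Proof. by rewrite /test_fun => ->. Qed.

Lemma normc_test_fun z : 0 < complex.Im z ->
  normc (test_fun s l z) = (normc (z - (s +i* - l)) ^+ 2)^-1.
Proof. by move=> z0; rewrite test_fun_upper// normcX normcV exprVn. Qed.

Lemma test_pole_sqr z :
  normc (z - (s +i* - l)) ^+ 2 = (complex.Re z - s) ^+ 2 + (complex.Im z + l) ^+ 2.
Proof. by rewrite normc_sqr ReB ImB /= opprK. Qed.

Lemma cdiff_test_fun z : 0 < complex.Im z -> cdiff (test_fun s l) z.
Proof.
move=> z0; pose g (w : Cplx R) : Cplx R := (w - (s +i* - l))^-1.
apply: (@cdiff_near _ (fun w => g w * g w)).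
  have dg : cdiff g z.
    apply: cdiffV; last by apply: cdiffB; [exact: cdiff_id|exact: cdiff_cst].
    rewrite -normc_gt0; apply: lt_le_trans (Im_le_normc _).
    by rewrite ImB /= opprK normr_gt0 gt_eqF// addr_gt0.
  exact: cdiffM.
by apply: filterS (nbhs_upper z0) => w w0; rewrite test_fun_upper// expr2.
Qed.

Lemma test_fun_sup_le : (hardy_sup p (test_fun s l) <= (pi * l * (l ^- 2) `^ p)%:E)%E.
Proof.
apply/hardy_sup_leP => y y0; have yl : 0 < y + l by exact: addr_gt0.
pose A := (l ^- 2) `^ p.
have A0 : 0 <= A by exact: powR_ge0.
have l2 : 0 < l ^+ 2 by exact: exprn_gt0.
have mq : measurable_fun setT (fun x : R => (y + l) / ((x - s) ^+ 2 + (y + l) ^+ 2)).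
  apply: continuous_measurable_fun; exact: (@continuous_poisson _ (y + l) s yl).
have q0 (x : R) : 0 <= (y + l) / ((x - s) ^+ 2 + (y + l) ^+ 2).
  by rewrite divr_ge0 ?(ltW yl)// addr_ge0// sqr_ge0.
have -> : (pi * l * A)%:E = (\int[mu]_x ((l * A) * ((y + l) / ((x - s) ^+ 2 + (y + l) ^+ 2)))%:E)%E.
  rewrite ge0_intZ//; last by rewrite mulr_ge0// ltW.
  by rewrite integral_poisson// -EFinM; congr (_%:E); ring.
apply: ge0_le_int => //.
- apply: (@measurable_hline R (fun z => normc (test_fun s l z) `^ p)) => // z z0.
  by apply: continuous_powR_normc => //; apply: cdiff_continuous; exact: cdiff_test_fun.
- exact: measurable_funM.
- by move=> x _; exact: powR_ge0.
move=> x _; rewrite normc_test_fun// test_pole_sqr /=.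
set d := (x - s) ^+ 2 + (y + l) ^+ 2.
have yl2 : l ^+ 2 <= (y + l) ^+ 2 by rewrite lerXn2r ?nnegrE ?(ltW l0) ?(ltW yl)// lerDr ltW.
have dl : l ^+ 2 <= d by apply: le_trans yl2 _; rewrite lerDr sqr_ge0.
have d0 : 0 < d by exact: lt_le_trans dl.
(* Since [l^2 / d] is at most 1, its [p]-th power is at most itself, which reduces every [p] to a
   Poisson integral. *)
have -> : d^-1 `^ p = A * (l ^+ 2 / d) `^ p.
  rewrite -powRM ?invr_ge0 ?(ltW l2)//; last by rewrite divr_ge0 ?(ltW l2) ?(ltW d0).
  by congr (_ `^ p); rewrite mulrA mulVf ?mul1r// lt0r_neq0.
rewrite [l * A]mulrC -[leRHS]mulrA; apply: ler_wpM2l => //.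
apply: le_trans (powR_le_id _ p1) _.
  by rewrite divr_ge0 ?(ltW l2) ?(ltW d0)//= ler_pdivrMr// mul1r.
rewrite mulrA ler_pM2r ?invr_gt0// expr2 ler_pM2l// lerDr ltW//.
Qed.

(** On the line of height [l], over [[s - l, s + l]], the squared distance to the pole is at most
    [l^2 + (2 l)^2 = 5 l^2]. *)
Lemma test_fun_sup_ge :
  ((2 * l * (5^-1 * l ^- 2) `^ p)%:E <= hardy_sup p (test_fun s l))%E.
Proof.
have -> : 2 * l = (s + l) - (s - l) by ring.
have l2 : 0 < l ^+ 2 by exact: exprn_gt0.
apply: (@hardy_sup_lower _ _ l) => //.
- exact: cdiff_test_fun.
- by rewrite lerD2l ge0_cp// ltW.
- by rewrite mulr_ge0// invr_ge0 ltW.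
move=> x /andP[x1 x2]; rewrite normc_test_fun// test_pole_sqr /= -invfM.
have H : (x - s) ^+ 2 + (l + l) ^+ 2 <= 5 * l ^+ 2 by nra.
rewrite lef_pV2 ?posrE// ?mulr_gt0//.
by apply: ltr_wpDl; [exact: sqr_ge0|rewrite exprn_gt0// addr_gt0].
Qed.

Lemma test_fun_hardy : hardy_space p (test_fun s l).
Proof.
split.
- by move=> z z0; apply/derivable_cdiff; exact: cdiff_test_fun.
- by move=> z /negP nz; rewrite /test_fun; case: ifP => // zz; rewrite /upper_half_plane /= zz in nz.
- by apply: le_lt_trans test_fun_sup_le _; rewrite ltry.
Qed.

End TestFunctions.

Section Necessity.
Variable R : realType.
Local Notation C := (complex R).
Local Notation mu := (@lebesgue_measure R).
Variables (P Q : {poly C}).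
Hypothesis Q0 : Q != 0.
Hypothesis self : forall z : Cplx R, 0 < complex.Im z -> 0 < complex.Im (P.[z] / Q.[z] : Cplx R).
Variables (p M : R).
Hypothesis p1 : 1 <= p.
Hypothesis M0 : 0 < M.
Local Notation T := (composition_operator (rPQ P Q)).
Local Notation X := (hardy_space p).
Hypothesis XT : forall f, X f -> X (T f).
Hypothesis powT : forall n f, X f ->
  hardy_norm p (iter n T f) <= M * hardy_norm p f /\
  hardy_norm p f <= M * hardy_norm p (iter n T f).

Let X_iter n f : X f -> X (iter n T f).
Proof. move=> Xf; elim: n => [|n IH]; [exact Xf|exact (XT IH)]. Qed.

Let Mp0 : 0 < M `^ p. Proof. exact: powR_gt0. Qed.

Lemma iter_sup_upper n f : X f ->
  fine (hardy_sup p (iter n T f)) <= M `^ p * fine (hardy_sup p f).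
Proof. by move=> Xf; apply: (hardy_norm_le p1 (ltW M0)); have [] := powT n Xf. Qed.

Lemma iter_sup_lower n f : X f ->
  fine (hardy_sup p f) <= M `^ p * fine (hardy_sup p (iter n T f)).
Proof. by move=> Xf; apply: (hardy_norm_le p1 (ltW M0)); have [] := powT n Xf. Qed.

Lemma fine_sup_lower f (y a b k : R) : X f -> 0 < y -> a <= b -> 0 <= k ->
  (forall x, a <= x <= b -> k <= normc (f (x +i* y))) ->
  (b - a) * k `^ p <= fine (hardy_sup p f).
Proof.
move=> Xf y0 ab k0 H; rewrite -lee_fin -(hardy_supE Xf).
exact: (hardy_sup_lower p1 (hardy_space_cdiff Xf) y0 ab k0 H).
Qed.

Lemma test_fun_lower (l B : R) (w : Cplx R) : 0 < l -> 0 < complex.Im w ->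
  normc w + l <= B -> (B ^+ 2)^-1 <= normc (test_fun 0 l w).
Proof.
move=> l0 w0 wB; rewrite normc_test_fun//.
have d0 : 0 < normc (w - (0 +i* - l)).
  apply: lt_le_trans (Im_le_normc _).
  by rewrite ImB /= opprK normr_gt0 gt_eqF// addr_gt0.
have dB : normc (w - (0 +i* - l)) <= B.
  apply: le_trans wB; apply: le_trans (normc_triangle _ _) _; rewrite lerD2l normcN.
  by apply: le_trans (normc_le_ReIm _) _; rewrite /= normr0 add0r normrN gtr0_norm.
rewrite lef_pV2 ?posrE ?exprn_gt0//; last exact: lt_le_trans dB.
by rewrite lerXn2r ?nnegrE ?(ltW d0)// (le_trans (ltW d0)).
Qed.

Lemma size_gt : (size Q < size P)%N.
Proof.
rewrite ltnNge; apply/negP => sPQ.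
have sPQ' : (size P <= size Q + 0)%N by rewrite addn0.
have [K [rho [K0 rho1 HK]]] := ratio_upper Q0 sPQ'.
pose g := test_fun (0 : R) 1; have Xg : X g := test_fun_hardy 0 ltr01 p1.
pose k := ((K + 1) ^+ 2)^-1.
have k0 : 0 < k by rewrite invr_gt0 exprn_gt0// addr_gt0.
have kp : 0 < k `^ p by exact: powR_gt0.
pose S := fine (hardy_sup p (T g)).
have S0 : 0 <= S by exact: fine_hardy_sup_ge0.
(* For [x >= rho] the values of [r] are bounded by [K], so [|g o r| >= k]; an interval of length
   [(S + 1) / k^p] then gives the absurd [S + 1 <= S]. *)
have : (rho + (S + 1) / k `^ p - rho) * k `^ p <= S.
  apply: (fine_sup_lower (XT Xg) ltr01 _ (ltW k0)).
    by rewrite lerDl divr_ge0 ?(ltW kp)// addr_ge0.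
  move=> x /andP[x1 _].
  rewrite composition_operatorE//; apply: test_fun_lower => //; first exact: self.
  have xz : rho <= normc (x +i* 1 : Cplx R).
    by apply: le_trans x1 _; apply: le_trans (ler_norm _) (Re_le_normc (x +i* 1)).
  by have [_] := HK _ xz; rewrite expr0 mulr1 lerD2r.
by rewrite addrAC subrr add0r divfK ?gt_eqF// leNgt ltrDl ltr01.
Qed.

Lemma slope_exists : exists2 c : R, 0 < c &
  (size (P - c%:C *: ('X * Q))%R <= size Q)%N.
Proof.
have sPQ := size_gt; have sQ : (0 < size Q)%N by rewrite size_poly_gt0.
have sE : size P = (size Q + (size P - size Q).-1.+1)%N.
  by rewrite prednK ?subn_gt0// subnKC// ltnW.
have E0 := degree_excess Q0 self sE; rewrite E0 in sE.
have [c c0 cE] := slope_gt0 Q0 self sE; exists c => //.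
have := size_lead_cancel Q0 sE sQ; rewrite cE expr1.
by move=> H; rewrite -ltnS -[(size Q).+1]addn1 -sE.
Qed.

Variable c : R.
Hypothesis c0 : 0 < c.
Hypothesis sD : (size (P - c%:C *: ('X * Q))%R <= size Q)%N.

Lemma slope_le1 : c <= 1.
Proof.
rewrite leNgt; apply/negP => c1.
pose g := test_fun (0 : R) 1; have Xg : X g := test_fun_hardy 0 ltr01 p1.
have sQ : size Q = (size Q).-1.+1 by rewrite prednK// size_poly_gt0.
have sD' : (size (P - c%:C *: ('X * Q))%R <= (size Q).-1.+1)%N by rewrite -sQ.
have H n : (hardy_sup p (iter n T g) <= (c^-1 ^+ n * fine (hardy_sup p g))%:E)%E.
  elim: n => [|n IH]; first by rewrite expr0 mul1r -(hardy_supE Xg).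
  rewrite exprS -mulrA.
  exact: (composition_le sQ c0 sD' self p1 (hardy_space_cdiff (X_iter n Xg)) IH).
pose S := fine (hardy_sup p g).
have S0 : 0 < S.
  rewrite -lte_fin -(hardy_supE Xg); apply: lt_le_trans (test_fun_sup_ge 0 ltr01 p1).
  by rewrite lte_fin mulr_gt0 ?mulr_gt0// powR_gt0// mulr_gt0.
have H' n : 1 <= M `^ p * c^-1 ^+ n.
  rewrite -(ler_pM2r S0) mul1r; apply: le_trans (iter_sup_lower n Xg) _.
  rewrite -mulrA ler_pM2l//.
  by have := H n; rewrite (hardy_supE (X_iter n Xg)) lee_fin.
have ci : `|c^-1| < 1 by rewrite gtr0_norm ?invr_gt0// invf_lt1.
have /cvgrPdist_lt/(_ (M `^ p)^-1) := cvg_expr ci.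
rewrite invr_gt0 => /(_ Mp0)[n _ /(_ n (leqnn n))]/=.
rewrite sub0r normrN ger0_norm ?exprn_ge0 ?invr_ge0 ?(ltW c0)// => Hn.
by have := H' n; rewrite leNgt -ltr_pdivlMl ?mulr1 ?Hn.
Qed.

(** Beyond radius [rho], [r(w) - c w] is bounded. The lower bound on [c^n |z|] keeps all iterates
    before the [n]-th outside that radius, and as [c < 1] the errors add up like a geometric
    series. *)
Lemma iter_slope : c < 1 -> exists D rho : R, [/\ 0 <= D, 1 <= rho &
  forall n (z : Cplx R), 0 < complex.Im z -> rho + D <= c ^+ n * normc z ->
  normc (iter n (rPQ P Q) z) <= c ^+ n * normc z + D].
Proof.
move=> c1; have sD' : (size (P - c%:C *: ('X * Q))%R <= size Q + 0)%N by rewrite addn0.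
have [K [rho [K0 rho1 HK]]] := ratio_upper Q0 sD'.
have c1' : 0 < 1 - c by rewrite subr_gt0.
(* [D] is the fixed point of [e -> K + c * e], the recursion that bounds the distance from the
   [n]-th iterate to [c^n z]. *)
pose D := K / (1 - c); exists D, rho.
have D0 : 0 <= D by rewrite divr_ge0 ?(ltW c1') ?(ltW K0).
have DE : K + c * D = D by rewrite /D; field; rewrite gt_eqF.
split=> // n z z0 zn.
suff : normc (iter n (rPQ P Q) z - (c ^+ n)%:C * z) <= D.
  move=> H; rewrite -[iter n _ z](subrK ((c ^+ n)%:C * z)).
  apply: le_trans (normc_triangle _ _) _; rewrite addrC lerD// normcM normc_real.
  by rewrite ger0_norm// exprn_ge0// ltW.
elim: n zn => [|n IH] zn; first by rewrite /= expr0 mul1r subrr normc0.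
have zn' : rho + D <= c ^+ n * normc z.
  apply: le_trans zn _; rewrite ler_wpM2r ?normc_ge0// exprS ler_piMl ?ltW//.
  by rewrite exprn_gt0.
have {}IH := IH zn'; set w := iter n (rPQ P Q) z in IH.
have rw : rho <= normc w.
  have cn0 : 0 <= c ^+ n by rewrite exprn_ge0 ?ltW.
  have := normc_sub_ge ((c ^+ n)%:C * z) w.
  rewrite normcB normcM normc_real (ger0_norm cn0) => h.
  by have := le_trans h IH; lra.
have [Qw Hw] := HK w rw; rewrite expr0 mulr1 in Hw.
have -> : iter n.+1 (rPQ P Q) z - (c ^+ n.+1)%:C * z =
    (P - c%:C *: ('X * Q)).[w] / Q.[w] + c%:C * (w - (c ^+ n)%:C * z) :> Cplx R.
  rewrite iterS -/w hornerD hornerN hornerZ hornerM hornerX mulrBl /rPQ.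
  by rewrite -[c%:C * (w * Q.[w]) / _]mulrA mulfK// exprS rmorphM /=; ring.
rewrite -DE; apply: le_trans (normc_triangle _ _) _; apply: lerD => //.
by rewrite normcM normc_real gtr0_norm// ler_pM2l.
Qed.

Lemma slope_ge1 : 1 <= c.
Proof.
rewrite leNgt; apply/negP => c1; have [D [rho [D0 rho1 H]]] := iter_slope c1.
pose l := rho + D; have l1 : 1 <= l by rewrite /l; lra.
have l0 : 0 < l by exact: lt_le_trans l1.
pose g := test_fun (0 : R) l; have Xg : X g := test_fun_hardy 0 l0 p1.
pose k := ((4 * l + l) ^+ 2)^-1.
have k0 : 0 < k by rewrite invr_gt0 exprn_gt0// addr_gt0// mulr_gt0.
have kp : 0 < k `^ p by exact: powR_gt0.
pose S := M `^ p * fine (hardy_sup p g).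
have S0 : 0 <= S by rewrite mulr_ge0 ?(ltW Mp0)// fine_hardy_sup_ge0.
(* At height 1, for [x] between [l / c^n] and [2 l / c^n], the [n]-th iterate has modulus at most
   [4 * l], so the composed test function is at least [k] on an interval of length [l / c^n]. *)
have low n : l * k `^ p <= c ^+ n * S.
  have cn : 0 < c ^+ n by rewrite exprn_gt0.
  have cn1 : c ^+ n <= 1 by rewrite exprn_ile1 ?ltW.
  have ci : 0 <= l / c ^+ n by rewrite divr_ge0 ?ltW.
  rewrite -ler_pdivrMl//; apply: le_trans (iter_sup_upper n Xg).
  have -> : (c ^+ n)^-1 * (l * k `^ p) = (2 * (l / c ^+ n) - l / c ^+ n) * k `^ p.
    by ring.
  apply: (fine_sup_lower (X_iter n Xg) ltr01 _ (ltW k0)).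
    by lra.
  move=> x /andP[x1 x2]; rewrite iter_composition//; apply: test_fun_lower => //.
    exact: iter_upper.
  rewrite lerD2r; have x0 : 0 <= x by exact: le_trans x1.
  have xz : x <= normc (x +i* 1 : Cplx R).
    by apply: le_trans (ler_norm _) (Re_le_normc (x +i* 1)).
  have zx : normc (x +i* 1 : Cplx R) <= x + 1.
    by apply: le_trans (normc_le_ReIm _) _; rewrite /= normr1 ger0_norm.
  have h1 : l <= c ^+ n * x by rewrite mulrC -ler_pdivrMr.
  have h2 : c ^+ n * x <= 2 * l by rewrite mulrC -ler_pdivlMr// -mulrA.
  have h3 : l <= c ^+ n * normc (x +i* 1 : Cplx R) by apply: le_trans h1 _; rewrite ler_pM2l.
  have h4 : c ^+ n * normc (x +i* 1 : Cplx R) <= c ^+ n * x + c ^+ n.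
    by rewrite -[X in _ + X]mulr1 -mulrDr ler_pM2l.
  apply: le_trans (H n (x +i* 1) ltr01 h3) _; rewrite /l; rewrite /l in h2; lra.
have ca : `|c| < 1 by rewrite gtr0_norm.
have e0 : 0 < l * k `^ p / (S + 1) by rewrite divr_gt0 ?mulr_gt0// ltr_wpDl.
have /cvgrPdist_lt/(_ _ e0)[n _ /(_ n (leqnn n))]/= := cvg_expr ca.
rewrite sub0r normrN ger0_norm ?exprn_ge0 ?(ltW c0)// ltr_pdivlMr ?ltr_wpDl// => Hn.
have : c ^+ n * S < l * k `^ p.
  by apply: le_lt_trans Hn; rewrite ler_pM2l ?exprn_gt0// lerDl.
by rewrite ltNge low.
Qed.

End Necessity.

(** * Reality of the symbol on the real line *)

Section RealBoundary.
Variable R : realType.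
Local Notation C := (complex R).
Local Notation mu := (@lebesgue_measure R).
Variables (P Q : {poly C}).

(** On the real line this is [2 i] times the imaginary part of [P] times the conjugate of [Q];
    conjugating coefficients keeps it a polynomial, so that reality of [r] becomes an algebraic
    identity. *)
Definition boundary_poly : {poly C} :=
  P * map_poly (@conjc R) Q - map_poly (@conjc R) P * Q.

Lemma horner_conj (A : {poly C}) (x : R) :
  (map_poly (@conjc R) A).[(x +i* 0 : C)] = (A.[(x +i* 0 : C)])^*.
Proof.
have {1}-> : (x +i* 0 : C) = conjc (x +i* 0 : C) by rewrite /= oppr0.
exact: horner_map.
Qed.

Lemma boundary_polyP (x : R) : Q.[(x +i* 0 : C)] != 0 ->
  root boundary_poly (x +i* 0) = (complex.Im (P.[(x +i* 0 : C)] / Q.[(x +i* 0 : C)]) == 0).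
Proof.
move=> Qx; rewrite /root /boundary_poly hornerD hornerN !hornerM !horner_conj.
set a := P.[_]; rewrite -/a in Qx *; set b := Q.[_] in Qx *.
have bn : normc (b : Cplx R) ^+ 2 != 0 by rewrite expf_eq0 /= normc_eq0.
rewrite (ImM (a : Cplx R)) Im_inv Re_inv.
have -> : complex.Re a * (- complex.Im b / normc b ^+ 2) +
    complex.Im a * (complex.Re b / normc b ^+ 2) =
    (complex.Im a * complex.Re b - complex.Re a * complex.Im b) / normc b ^+ 2 by ring.
rewrite mulf_eq0 invr_eq0 (negbTE bn) orbF.
case: a {bn Qx} => a1 a2; case: b => b1 b2 /=.
rewrite eq_complex /=; apply/andP/eqP => [[_ /eqP h]|h]; first by lra.
by split; apply/eqP; lra.
Qed.

Hypothesis Q0 : Q != 0.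

(** Otherwise the line would be covered by the null set of the hypothesis and the finitely many
    roots of [boundary_poly * Q]; the factor [Q] takes care of the real poles. *)
Lemma inner_boundary_poly : rational_inner (rPQ P Q) -> boundary_poly = 0.
Proof.
move=> [N [mN N0 sub]]; apply/eqP/negPn/negP => A0.
pose B := boundary_poly * Q; have B0 : B != 0 by rewrite mulf_neq0.
pose F := [set x : R | x \in map (@complex.Re R) (root_list B)].
have cF : countable F by apply: finite_set_countable; exact: finite_seq.
have F0 : mu F = 0 by exact: countable_lebesgue_measure0.
have mF : measurable F by exact: countable_measurable.
have TFN : [set: R] `<=` F `|` N.
  move=> x _; have [?|xN] := pselect (N x); [by right|left].
  have Im0 : complex.Im (rPQ P Q x%:C) = 0.
    by apply: contrapT => h; apply: xN; exact: sub.
  apply/mapP; exists (x +i* 0) => //; rewrite mem_root_list// /B rootM.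
  have [//|Qx] := boolP (root Q (x +i* 0)); first by rewrite orbT.
  by rewrite boundary_polyP// -[_ / _]/(rPQ P Q x%:C) Im0 eqxx.
have U2 : (mu (F `|` N) <= mu F + mu N)%E by exact: measureU2.
have IU : (mu `[0%R, 1%R] <= mu (F `|` N))%E.
  apply: le_measure; rewrite ?inE//; first exact: measurableU.
  by apply: subset_trans TFN.
have := le_trans IU U2.
by rewrite F0 N0 adde0 lebesgue_measure_itv/= lte_fin ltr01 sube0 lee_fin ler10.
Qed.

End RealBoundary.

Section BoundaryNecessity.
Variable R : realType.
Local Notation C := (complex R).
Local Notation mu := (@lebesgue_measure R).

Lemma exists_notin (s : seq R) : exists t, t \notin s.
Proof.
suff [B HB] : exists B, forall x, x \in s -> x < B.
  by exists B; apply/negP => /HB; rewrite ltxx.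
elim: s => [|a s [B HB]]; first by exists 0.
exists (Num.max B (a + 1)) => x; rewrite inE lt_max => /predU1P[->|/HB->//].
by rewrite ltrDl ltr01 orbT.
Qed.

Variables (P Q : {poly C}) (m : nat) (c : R).
Hypothesis sQ : size Q = m.+1.
Hypothesis c0 : 0 < c.
Hypothesis sPQ : (size (P - c%:C *: ('X * Q))%R <= m.+1)%N.
Hypothesis self : forall z : Cplx R, 0 < complex.Im z -> 0 < complex.Im (P.[z] / Q.[z] : Cplx R).
Hypothesis copPQ : coprimep P Q.

(* If [r] is not real on the real line, then for almost every real [t] all roots
   of [P - t Q] lie strictly below it, and [r - t] stays away from 0. *)
Lemma omitted_value : boundary_poly P Q != 0 -> exists t k : R, 0 < k /\
  forall z : Cplx R, 0 < complex.Im z -> k * (1 + normc z) <= normc (rPQ P Q z - t%:C).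
Proof.
(* Away from poles, [r] is real at a real point only if that point is a root of [boundary_poly]; so
   [t] has just finitely many values to avoid. *)
move=> A0; have [t Ht] := exists_notin [seq complex.Re (rPQ P Q x) | x <- root_list (boundary_poly P Q)].
pose B : {poly C} := P - t%:C *: Q.
have B0 : B != 0 by exact: (PvQ_neq0 sQ c0 sPQ).
have sB : size B = m.+2 by exact: (size_PvQ sQ c0 sPQ).
have rootB b : root B b -> complex.Im b < 0.
  move=> rb; rewrite ltNge le_eqVlt; apply/negP => /orP[/eqP b0|b0]; last first.
    by have := self b0; rewrite (root_PvQ_upper self b0 rb) /= ltxx.
  have bE : b = (complex.Re b +i* 0) by case: b b0 {rb} => ? ? /= <-.
  have PE : P.[b] = t%:C * Q.[b].
    by move: rb; rewrite /root /B hornerD hornerN hornerZ subr_eq0 => /eqP.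
  have Qb : Q.[b] != 0.
    apply/eqP => Qb; have := P_neq0_at_root copPQ Qb.
    by rewrite PE Qb mulr0 eqxx.
  have rE : rPQ P Q b = t%:C by rewrite /rPQ PE mulfK.
  move/negP: Ht; apply; apply/mapP; exists b; last by rewrite rE.
  rewrite mem_root_list// bE boundary_polyP -bE//.
  by rewrite -[_ / _]/(rPQ P Q b) rE.
(* A root lies below the axis, hence at least as far from [z] as from its own projection to the
   axis, where [far_from_real_roots] applies. *)
have [d d0 Hd] : exists2 d : R, 0 < d & forall z b : Cplx R, 0 < complex.Im z ->
    root B b -> d <= normc (z - b).
  have [|d d0 Hd] := far_from_real_roots B0; first by move=> b /rootB b0; rewrite lt_eqF.
  exists d => // z b z0 rb; have b0 := rootB b rb.
  have := Hd (complex.Re b +i* 0) b; rewrite /= normr0 (ltW d0) => /(_ isT rb) h.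
  apply: le_trans h _; apply: le_trans (Im_le_normc _).
  apply: le_trans (normc_le_ReIm _) _.
  rewrite !ReB !ImB /= subrr normr0 add0r sub0r ger0_norm ?oppr_ge0 ?(ltW b0)//.
  by rewrite ger0_norm ?subr_ge0 ?(le_trans (ltW b0)) ?(ltW z0)// lerDr ltW.
have [k k0 Hk] := poly_lower B0 d0 Hd; rewrite sB /= in Hk.
have sQ' : (size Q <= m.+1)%N by rewrite sQ.
have [K K0 HK] := poly_upper sQ'.
exists t, (k / K); split; first by rewrite divr_gt0.
move=> z z0; have Qz := Q_upper self z0.
have nQ : 0 < normc (Q.[z] : Cplx R) by rewrite normc_gt0.
have -> : rPQ P Q z - t%:C = B.[z] / Q.[z].
  by rewrite /B hornerD hornerN hornerZ mulrBl mulfK.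
rewrite normcM normcV ler_pdivlMr//; apply: le_trans (Hk z z0).
have z1 : 0 <= 1 + normc z by rewrite addr_ge0// normc_ge0.
have -> : k * (1 + normc z) ^+ m.+1 = k / K * (1 + normc z) * (K * (1 + normc z) ^+ m).
  by rewrite exprS; field; rewrite gt_eqF.
by apply: ler_wpM2l (HK z); rewrite mulr_ge0// divr_ge0 ?ltW.
Qed.

Variables (p : R).
Hypothesis p1 : 1 <= p.

(** The bound is independent of [l]: as [r z] lies above the axis, lowering the pole from [t] by [l]
    only increases its distance from [r z]. *)
Lemma composition_test_fun_le (t k l : R) : 0 < k -> 0 < l ->
  (forall z : Cplx R, 0 < complex.Im z -> k * (1 + normc z) <= normc (rPQ P Q z - t%:C)) ->
  (hardy_sup p (composition_operator (rPQ P Q) (test_fun t l)) <=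
    ((k ^- 2) `^ p * pi)%:E)%E.
Proof.
move=> k0 l0 Hk; apply/hardy_sup_leP => y y0.
pose A := (k ^- 2) `^ p; have A0 : 0 <= A by exact: powR_ge0.
have k2 : 0 < k ^+ 2 by exact: exprn_gt0.
have mq : measurable_fun setT (fun x : R => 1 / ((x - 0) ^+ 2 + 1 ^+ 2)).
  apply: continuous_measurable_fun; exact: (@continuous_poisson _ 1 0 ltr01).
have q0 (x : R) : 0 <= 1 / ((x - 0) ^+ 2 + 1 ^+ 2).
  by rewrite divr_ge0// addr_ge0// sqr_ge0.
have -> : (A * pi)%:E = (\int[mu]_x (A * (1 / ((x - 0) ^+ 2 + 1 ^+ 2)))%:E)%E.
  by rewrite ge0_intZ// (integral_poisson 0 ltr01) EFinM.
have selfr (z : Cplx R) : 0 < complex.Im z -> 0 < complex.Im (rPQ P Q z) by exact: self.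
apply: ge0_le_int => //.
- apply: (@measurable_hline R (fun z => normc (composition_operator (rPQ P Q) (test_fun t l) z) `^ p)) => // z z0.
  apply: continuous_powR_normc => //; apply: cdiff_continuous.
  apply: (@cdiff_near _ (fun z => test_fun t l (rPQ P Q z))).
    apply: cdiff_comp; last by apply: cdiff_test_fun => //; exact: self.
    by apply: cdiffM; [exact: cdiff_horner|apply: cdiffV; [exact: (Q_upper self z0)|exact: cdiff_horner]].
  by apply: filterS (nbhs_upper z0) => w w0; rewrite composition_operatorE.
- exact: measurable_funM.
- by move=> x _; exact: powR_ge0.
move=> x _; rewrite composition_operatorE// normc_test_fun//; last exact: selfr.
set z : Cplx R := x +i* y; have z0 : 0 < complex.Im z by [].
have Iz := selfr z z0.
set d := (x - 0) ^+ 2 + 1 ^+ 2; have d0 : 0 < d by rewrite ltr_wpDl// sqr_ge0.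
have d1 : 1 <= d by rewrite /d expr1n lerDr sqr_ge0.
have le0 : k ^+ 2 * d <= normc (rPQ P Q z - (t +i* - l)) ^+ 2.
  have h1 : (k * (1 + normc z)) ^+ 2 <= normc (rPQ P Q z - t%:C) ^+ 2.
    rewrite lerXn2r ?nnegrE ?normc_ge0 ?mulr_ge0 ?(ltW k0) ?addr_ge0 ?normc_ge0//.
    exact: Hk.
  have h2 : normc (rPQ P Q z - t%:C) ^+ 2 <= normc (rPQ P Q z - (t +i* - l)) ^+ 2.
    rewrite test_pole_sqr normc_sqr ReB ImB /= subr0 lerD2l.
    by rewrite lerXn2r ?nnegrE ?addr_ge0 ?(ltW Iz) ?(ltW l0)// lerDl ltW.
  apply: le_trans (le_trans h1 h2); rewrite exprMn ler_pM2l//.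
  have h3 : x ^+ 2 <= normc z ^+ 2 by rewrite normc_sqr /= lerDl sqr_ge0.
  have h4 := normc_ge0 z; rewrite /d subr0 expr1n; nra.
have kd : 0 < k ^+ 2 * d by rewrite mulr_gt0.
apply: (@le_trans _ _ ((k ^+ 2 * d)^-1 `^ p)).
  apply: ge0_ler_powR; rewrite ?nnegrE ?invr_ge0 ?(ltW kd) ?exprn_ge0 ?normc_ge0//.
    exact: le_trans p1.
  by rewrite lef_pV2 ?posrE//; exact: lt_le_trans le0.
rewrite invfM powRM ?invr_ge0 ?(ltW k2) ?(ltW d0)//; apply: ler_wpM2l => //.
rewrite div1r; apply: powR_le_id => //.
by rewrite invr_ge0 (ltW d0) invf_le1.
Qed.

Variable M : R.
Hypothesis M0 : 0 < M.
Local Notation T := (composition_operator (rPQ P Q)).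
Hypothesis XT : forall f, hardy_space p f -> hardy_space p (T f).
Hypothesis lowT : forall f, hardy_space p f ->
  fine (hardy_sup p f) <= M * fine (hardy_sup p (T f)).

Lemma real_boundary : boundary_poly P Q = 0.
Proof.
apply/eqP/negPn/negP => /omitted_value[t [k [k0 Hk]]].
pose W := M * ((k ^- 2) `^ p * pi).
have W0 : 0 <= W by rewrite !mulr_ge0 ?powR_ge0 ?pi_ge0// ltW.
(* With this choice [5^-1 * l^-2] equals [(W + 1) / l], which is at least 1 and so at most its
   [p]-th power; the lower bound for the norm becomes [2 * (W + 1)], more than [W]. *)
pose l := (5 * (W + 1))^-1.
have W1 : 0 < W + 1 by rewrite ltr_wpDl.
have l0 : 0 < l by rewrite invr_gt0 mulr_gt0.
have Xg := test_fun_hardy t l0 p1; have XTg := XT Xg.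
have up : fine (hardy_sup p (T (test_fun t l))) <= (k ^- 2) `^ p * pi.
  by rewrite -lee_fin -(hardy_supE XTg); exact: composition_test_fun_le.
have low : 2 * l * (5^-1 * l ^- 2) `^ p <= fine (hardy_sup p (test_fun t l)).
  by rewrite -lee_fin -(hardy_supE Xg); exact: test_fun_sup_ge.
have := le_trans low (lowT Xg).
move=> h; have {h} : 2 * l * (5^-1 * l ^- 2) `^ p <= W.
  by apply: le_trans h _; rewrite ler_pM2l.
have lE : 5^-1 * l ^- 2 = (W + 1) * l^-1.
  by rewrite /l exprVn invrK invrK; field.
have b1 : 1 <= 5^-1 * l ^- 2.
  have a1 : 1 <= W + 1 by rewrite lerDr.
  have a5 : 1 <= 5 * (W + 1) by apply: le_trans a1 _; rewrite ler_peMl ?ler1n// ltW.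
  by rewrite lE /l invrK; apply: le_trans a1 _; rewrite ler_peMr// ltW.
have := ler_powR b1 p1; rewrite powRr1 ?(le_trans ler01 b1)// => h1 h2.
have : 2 * l * (5^-1 * l ^- 2) <= W by apply: le_trans h2; rewrite ler_pM2l ?mulr_gt0.
rewrite lE; have -> : 2 * l * ((W + 1) / l) = 2 * (W + 1) by field; rewrite gt_eqF.
by apply/negP; rewrite -ltNge mulrDr mulr1 mulr_natl mulr2n -addrA ltrDl ltr_wpDl.
Qed.

End BoundaryNecessity.

(** * Reduction to conditions on the polynomials *)

Section Characterization.
Variable R : realType.
Local Notation C := (complex R).
Variables (P Q : {poly C}).
Hypothesis Q0 : Q != 0.
Hypothesis copPQ : coprimep P Q.
Hypothesis self : forall z : Cplx R, 0 < complex.Im z -> 0 < complex.Im (P.[z] / Q.[z] : Cplx R).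

Let sizeQ : size Q = (size Q).-1.+1.
Proof. by rewrite prednK// size_poly_gt0. Qed.

Lemma similar_necessary (p : R) : 1 <= p ->
  similar_to_isometry_on (hardy_space p) (hardy_norm p) (composition_operator (rPQ P Q)) ->
  (size (P - 'X * Q)%R <= size Q)%N /\ boundary_poly P Q = 0.
Proof.
move=> p1 sim.
have [XT [M M0 powT]] := similar_power_bounded (fun f => hardy_norm_ge0 p f) sim.
have [c c0 sD] := slope_exists Q0 self p1 XT.
have cle := slope_le1 Q0 self p1 M0 XT powT c0 sD.
have cge := slope_ge1 Q0 self p1 M0 XT powT c0 sD.
have c1 : c = 1 by apply: le_anti; rewrite cle cge.
split; first by move: sD; rewrite c1 scale1r.
have sD' : (size (P - c%:C *: ('X * Q))%R <= (size Q).-1.+1)%N by rewrite -sizeQ.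
apply: (real_boundary sizeQ c0 sD' self copPQ p1 (powR_gt0 p M0) XT) => f Xf.
exact: (@iter_sup_lower _ P Q p M p1 M0 powT 1%N f Xf).
Qed.

Lemma sufficient_isometry (p : R) : 1 <= p ->
  (size (P - 'X * Q)%R <= size Q)%N -> boundary_poly P Q = 0 ->
  isometry_on (hardy_space p) (hardy_norm p) (composition_operator (rPQ P Q)).
Proof.
move=> p1 sD A0.
have sD' : (size (P - (1 : R)%:C *: ('X * Q))%R <= (size Q).-1.+1)%N by rewrite -sizeQ scale1r.
have realPQ (x : R) : Q.[(x +i* 0 : Cplx R)] != 0 ->
    complex.Im (P.[(x +i* 0 : Cplx R)] / Q.[(x +i* 0 : Cplx R)]) = 0.
  by move=> Qx; apply/eqP; rewrite -boundary_polyP// A0 root0.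
have le f : hardy_space p f -> (hardy_sup p (composition_operator (rPQ P Q) f) <= hardy_sup p f)%E.
  move=> Xf; have := hardy_supE Xf => E.
  have B : (hardy_sup p f <= (fine (hardy_sup p f))%:E)%E by rewrite -E.
  have := composition_le sizeQ ltr01 sD' self p1 (hardy_space_cdiff Xf) B.
  by rewrite invr1 mul1r -E.
have dr (z : Cplx R) : 0 < complex.Im z -> cdiff (rPQ P Q) z.
  move=> z0; apply: cdiffM; first exact: cdiff_horner.
  by apply: cdiffV; [exact: (Q_upper self z0)|exact: cdiff_horner].
have XT f : hardy_space p f -> hardy_space p (composition_operator (rPQ P Q) f).
  move=> Xf; apply: (composition_hardy dr self Xf).
  by apply: le_lt_trans (le f Xf) _; case: Xf.
split; first exact: composition_linear.
move=> f Xf; have XTf := XT f Xf; have E := hardy_supE XTf.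
have B : (hardy_sup p (composition_operator (rPQ P Q) f) <=
  (fine (hardy_sup p (composition_operator (rPQ P Q) f)))%:E)%E by rewrite -E.
have := composition_ge sizeQ sD' self p1 erefl copPQ realPQ (hardy_space_cdiff Xf) B.
rewrite -E => ge; rewrite /hardy_norm.
by rewrite (@le_anti _ _ (hardy_sup p f) _ (introT andP (conj ge (le f Xf)))).
Qed.

Lemma inner_slope_iff :
  ((size (P - 'X * Q)%R <= size Q)%N /\ boundary_poly P Q = 0) <->
  (rational_inner (rPQ P Q) /\
   (rPQ P Q z / z @[z --> @at_infinity R] --> (1 : Cplx R))).
Proof.
split=> [[sD A0]|[inn lim]].
  split; last exact: slope_size_limit.
  (* At a pole the division convention gives the real value 0, so the property holds at every
     point. *)
  apply: aeW => x; have [Qx|Qx] := eqVneq Q.[x%:C] 0; first by rewrite /rPQ Qx invr0 mulr0.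
  by apply/eqP; rewrite -[x%:C]/(x +i* 0) -boundary_polyP// A0 root0.
split; first exact: slope_limit_size.
exact: inner_boundary_poly.
Qed.

End Characterization.

Local Close Scope complex_scope.

Theorem theorem4p2 (R : realType) (r : Cplx R -> Cplx R)
    (r_rational : rational_function r)
    (r_self_map : forall z, upper_half_plane z -> upper_half_plane (r z)) :
  [<-> exists2 p : R, 1 <= p &
         isometry_on (hardy_space p) (hardy_norm p) (composition_operator r);
       forall p : R, 1 <= p ->
         isometry_on (hardy_space p) (hardy_norm p) (composition_operator r);
       exists2 p : R, 1 <= p &
         similar_to_isometry_on (hardy_space p) (hardy_norm p)
           (composition_operator r);
       forall p : R, 1 <= p ->
         similar_to_isometry_on (hardy_space p) (hardy_norm p)
           (composition_operator r);
       rational_inner r /\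
         (r z / z @[z --> @at_infinity R] --> (1 : Cplx R))].
Proof.
have [P [Q [Q0 cop rE]]] := r_rational.
have {rE} rE : r = rPQ P Q by apply/funext => z; exact: rE.
subst r; have self : forall z : Cplx R, 0 < complex.Im z -> 0 < complex.Im (P.[z] / Q.[z] : Cplx R).
  exact: r_self_map.
(* The exponent does not occur in this condition: it follows from similarity for one [p] and implies
   isometry for all of them. *)
pose cond := (size (P - 'X * Q)%R <= size Q)%N /\ boundary_poly P Q = 0.
have iso p : cond -> 1 <= p -> isometry_on (hardy_space p) (hardy_norm p) (composition_operator (rPQ P Q)).
  by move=> [h1 h2] p1; exact: sufficient_isometry.
have sim p : isometry_on (hardy_space p) (hardy_norm p) (composition_operator (rPQ P Q)) ->
    similar_to_isometry_on (hardy_space p) (hardy_norm p) (composition_operator (rPQ P Q)).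
  by move=> h; exact: isometry_similar.
have nec p : 1 <= p -> similar_to_isometry_on (hardy_space p) (hardy_norm p)
    (composition_operator (rPQ P Q)) -> cond.
  by move=> p1; exact: similar_necessary.
have one : (1 : R) <= 1 by [].
tfae.
- by move=> [p p1 h] q q1; apply: iso => //; exact: (nec p p1 (sim p h)).
- by move=> h; exists 1; [exact: one|exact: sim (h 1 one)].
- by move=> [p p1 h] q q1; apply: sim; apply: iso => //; exact: (nec p p1 h).
- by move=> h; apply/(inner_slope_iff P Q0); exact: (nec 1 one (h 1 one)).
- move=> h; exists 1; [exact: one|apply: iso => //].
  exact: (inner_slope_iff P Q0).2 h.
Qed.
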